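(* Let $K$ and $\widetilde K$ be transition kernels on $\mathbb{R}^d\times\mathcal{B}(\mathbb{R}^d)$ with unique stationary distributions $\mu_K$ and $\mu_{\widetilde K}$ respectively, and let $P,\widetilde P$ be probability distributions on $\mathbb{R}^d$. Assume that there exists $\rho<2$ such that $\mu_K\in\mathcal{M}_\rho$ and $\mu_{\widetilde K}\in\mathcal{M}_\rho$. Assume also that for each $R\in\{R_K,R_{\widetilde K}\}$ the following holds: for any $z_0\in\mathbb{C}^d$, the function $z\in\mathbb{C}^d\mapsto\Phi_R(z_0,z)$ is not the null function or the function $z\in\mathbb{C}^d\mapsto\Phi_R(z,z_0)$ is not the null function. Then $\mathbb{P}_{K,P}=\mathbb{P}_{\widetilde K,\widetilde P}$ implies that $R_K=R_{\widetilde K}$ and $P=\widetilde P$ up to translation.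
   Context: $\mathbb{R}^d$ carries its Borel sigma-field $\mathcal{B}(\mathbb{R}^d)$. For a transition kernel $K$ on $\mathbb{R}^d$ with unique stationary distribution $\mu_K$, $R_K$ is the measure on $\mathbb{R}^{2d}$ given by $R_K(E)=\int \mu_K(dx)K(x,dy)\mathbf{1}_E(x,y)$ (the law of two consecutive states of the stationary chain). For a probability distribution $P$ on $\mathbb{R}^d$, $\mathbb{P}_{K,P}$ is the law of the sequence $(Y_i)_{i\ge1}$, $Y_i=X_i+\varepsilon_i$, where $(X_i)_{i\ge1}$ is the stationary Markov chain with transition kernel $K$ and $(\varepsilon_i)_{i\ge1}$ are i.i.d. with distribution $P$, independent of $(X_i)_{i\ge1}$. For $\rho>0$, $\mathcal{M}_\rho$ is the set of finite measures $\mu$ on $\mathbb{R}^d$ for which there exist $A,B>0$ with $\int\exp(u^Tx)\,d\mu(x)\le A\exp(B\|u\|^\rho)$ for all $u\in\mathbb{R}^d$ ($\|\cdot\|$ the Euclidean norm). If the marginals of a probability distribution $R$ on $\mathbb{R}^d\times\mathbb{R}^d$ are in $\mathcal{M}_\rho$ for some $\rho$, then $\Phi_R(z_1,z_2)=\int\exp(z_1^Tx_1+z_2^Tx_2)\,dR(x_1,x_2)$ is well defined for all $(z_1,z_2)\in\mathbb{C}^d\times\mathbb{C}^d$. ''$R_K=R_{\widetilde K}$ and $P=\widetilde P$ up to translation'' means: there exists $m\in\mathbb{R}^d$ such that if $(X_1,X_2)$ has distribution $R_K$ and $(\varepsilon_1,\varepsilon_2)$ has distribution $P\otimes P$, then $(X_1-m,X_2-m)$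 has distribution $R_{\widetilde K}$ and $(\varepsilon_1+m,\varepsilon_2+m)$ has distribution $\widetilde P\otimes\widetilde P$. *)

(* Defs.v *)
From HB Require Import structures.
From mathcomp Require Import all_boot all_order all_algebra finmap.
From mathcomp Require Import all_classical all_reals all_analysis.
From mathcomp Require Import complex.

Set Implicit Arguments.
Unset Strict Implicit.
Unset Printing Implicit Defensive.
Import Order.TTheory GRing.Theory Num.Theory.
Import numFieldNormedType.Exports.

Local Open Scope classical_set_scope.
Local Open Scope ring_scope.

(* R^d is 'rV[R]_d with its Borel sigma-field. *)
Definition mx_display (R : realType) (m n : nat) : measure_display :=
  sigma_display (@open 'M[R]_(m, n)).

HB.instance Definition _ (R : realType) (m n : nat) :=
  @isMeasurable.Build (mx_display R m n) 'M[R]_(m, n)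
    <<s open >> (@sigma_algebra0 _ setT open) (@sigma_algebraC _ open)
    (@sigma_algebra_bigcup _ setT open).

(* The product sigma-field on (R^d)^N is generated by the coordinates.
   Sequences are indexed from 0: index i stands for time i + 1. *)
Definition coordinate_sets (R : realType) (d : nat) :
    set (set (nat -> 'rV[R]_d)) :=
  [set C | exists i : nat, exists2 B : set 'rV[R]_d,
     measurable B & C = [set y | B (y i)]].

Definition seq_space (R : realType) (d : nat) :=
  g_sigma_algebraType (@coordinate_sets R d).

Section StationaryKernels.
Context (R : realType) (d : nat).
Local Notation V := 'rV[R]_d.
Local Open Scope ereal_scope.

Definition stationary (K : R.-pker V ~> V) (mu : probability V R) : Prop :=
  forall A : set V, measurable A -> \int[mu]_x K x A = mu A.

(* Equality of measures is always tested on measurable sets only: a library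
   measure is a function on all sets, unconstrained on the other ones. *)
Definition unique_stationary (K : R.-pker V ~> V) (mu : probability V R) :
    Prop :=
  stationary K mu /\
  forall nu : probability V R, stationary K nu ->
    forall A : set V, measurable A -> nu A = mu A.

(* For mu = mu_K this is R_K, the law of two consecutive states of the
   stationary chain. *)
Definition pair_law (mu : probability V R) (K : R.-pker V ~> V)
    (E : set (V * V)) : \bar R :=
  \int[mu]_x \int[K x]_y (\1_E (x, y))%:E.

Section pair_law_probability.
Variables (mu : probability V R) (K : R.-pker V ~> V).

Let pair_law0 : pair_law mu K set0 = 0.
Proof.
by apply: integral0_eq => x _; apply: integral0_eq => y _; rewrite indic0.
Qed.

Let pair_law_ge0 E : 0 <= pair_law mu K E.
Proof.
by apply: integral_ge0 => x _; apply: integral_ge0 => y _; rewrite lee_fin.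
Qed.

Let pair_law_semi_sigma_additive : semi_sigma_additive (pair_law mu K).
Proof.
have := @semi_sigma_additive_kproduct _ _ _ unit V V R
  (kprobability (measurable_cst (mu : pprobability V R)))
  (kernel.kernel_snd K) tt.
exact.
Qed.

HB.instance Definition _ := isMeasure.Build _ _ _ (pair_law mu K)
  pair_law0 pair_law_ge0 pair_law_semi_sigma_additive.

Let pair_law_setT : pair_law mu K [set: V * V] = 1.
Proof.
rewrite /pair_law (eq_integral (cst 1)).
  by rewrite integral_cst// mul1e; exact: probability_setT.
move=> x _; rewrite (eq_integral (cst 1)) => [|y _]; last by rewrite indicT.
by rewrite integral_cst// mul1e; exact: prob_kernel.
Qed.

HB.instance Definition _ := Measure_isProbability.Build _ _ _
  (pair_law mu K) pair_law_setT.

End pair_law_probability.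

End StationaryKernels.

Section HiddenMarkovModel.
Context (R : realType) (d : nat).
Local Notation V := 'rV[R]_d.
Local Open Scope ereal_scope.

Section Processes.
Context (d0 : measure_display) (Omega : measurableType d0).
Variable Pr : probability Omega R.

(* The Markov property P(X_{n+1} \in A | X_0, ..., X_n) = K(X_n, A) a.s., in
   the integrated form that defines this conditional probability. *)
Definition markov_chain (K : R.-pker V ~> V) (X : nat -> {RV Pr >-> V}) :
    Prop :=
  forall (n : nat) (H : set (n.+1.-tuple V)) (A : set V),
    measurable H -> measurable A ->
    let past := [set w | H [tuple X i w | i < n.+1]] in
    Pr (past `&` X n.+1 @^-1` A) = \int[Pr]_(w in past) K (X n w) A.

Definition has_law (X : {RV Pr >-> V}) (mu : probability V R) : Prop :=
  forall A : set V, measurable A -> distribution Pr X A = mu A.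

Definition mutually_independent (e : nat -> {RV Pr >-> V}) : Prop :=
  forall (J : {fset nat}) (A : nat -> set V), (forall j, measurable (A j)) ->
    Pr (\bigcap_(j in [set` J]) (e j @^-1` A j)) =
    \prod_(j <- J) Pr (e j @^-1` A j).

Definition independent_sequences (X e : nat -> {RV Pr >-> V}) : Prop :=
  forall A B : set (seq_space R d), measurable A -> measurable B ->
    Pr ([set w | A (fun i => X i w)] `&` [set w | B (fun i => e i w)]) =
    Pr [set w | A (fun i => X i w)] * Pr [set w | B (fun i => e i w)].

End Processes.

(* Q is the law P_{K,P} of Y = X + e, where X is the Markov chain with kernel
   K started from its stationary distribution mu. By the Ionescu-Tulcea
   theorem such a realization always exists, and Q is determined on measurable
   sets by K, mu and P. *)
Definition is_observation_law (K : R.-pker V ~> V) (mu P : probability V R)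
    (Q : probability (seq_space R d) R) : Prop :=
  exists (d0 : measure_display) (Omega : measurableType d0)
      (Pr : probability Omega R) (X e : nat -> {RV Pr >-> V}),
    [/\ markov_chain K X /\ has_law (X 0%N) mu,
        mutually_independent e /\ (forall i, has_law (e i) P),
        independent_sequences X e &
        forall A : set (seq_space R d), measurable A ->
          Q A = Pr [set w | A (fun i => X i w + e i w)%R]].

End HiddenMarkovModel.

Section LaplaceTransform.
Context (R : realType) (d : nat).
Local Notation V := 'rV[R]_d.

Definition dotv (T : pzRingType) (u v : 'rV[T]_d) : T :=
  \sum_(i < d) u 0 i * v 0 i.

(* The library norm `|u| of a matrix is the sup norm. *)
Definition euclidean_norm (u : V) : R := Num.sqrt (dotv u u).

(* The class M_rho; meaningful for 0 < rho. *)
Definition light_tailed (rho : R) (mu : {finite_measure set V -> \bar R}) :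
    Prop :=
  exists A B : R, [/\ 0 < A, 0 < B & forall u : V,
    (\int[mu]_x (expR (dotv u x))%:E <=
       (A * expR (B * euclidean_norm u `^ rho))%:E)%E].

Definition expC (z : R[i]) : R[i] :=
  (expR (complex.Re z) * cos (complex.Im z) +i* (expR (complex.Re z) * sin (complex.Im z)))%C.

Definition complex_vec (x : V) : 'rV[R[i]]_d := map_mx (fun a => a%:C%C) x.

(* Complex-valued integrals are taken componentwise. *)
Definition integralC (d0 : measure_display) (T : measurableType d0)
    (nu : {measure set T -> \bar R}) (f : T -> R[i]) : R[i] :=
  (Rintegral nu setT (fun x => complex.Re (f x)) +i*
   Rintegral nu setT (fun x => complex.Im (f x)))%C.

Definition Phi (nu : {measure set (V * V) -> \bar R}) (z1 z2 : 'rV[R[i]]_d) :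
    R[i] :=
  integralC nu (fun x =>
    expC (dotv z1 (complex_vec x.1) + dotv z2 (complex_vec x.2))).

Definition nonnull_sections (nu : {measure set (V * V) -> \bar R}) : Prop :=
  forall z0 : 'rV[R[i]]_d,
    (fun z => Phi nu z0 z) <> (fun=> 0) \/ (fun z => Phi nu z z0) <> (fun=> 0).

End LaplaceTransform.

Section Translation.
Context (R : realType) (d : nat).
Local Notation V := 'rV[R]_d.
Local Open Scope ereal_scope.

Definition equal_up_to_translation (RK RK' : probability (V * V)%type R)
    (P P' : probability V R) : Prop :=
  exists m : V, forall E : set (V * V), measurable E ->
    pushforward RK (fun x => (x.1 - m, x.2 - m)%R) E = RK' E /\
    pushforward (P \x P) (fun e => (e.1 + m, e.2 + m)%R) E = (P' \x P') E.

End Translation.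

(* Main.v *)
Require Import Defs.
From HB Require Import structures.
From mathcomp Require Import all_boot all_order all_algebra finmap.
From mathcomp Require Import all_classical all_reals all_analysis.
From mathcomp Require Import measurable_realfun complex.
From mathcomp Require Import ring lra.
Import Order.TTheory GRing.Theory Num.Theory.
Import numFieldNormedType.Exports.
Set Implicit Arguments.
Unset Strict Implicit.
Unset Printing Implicit Defensive.
Local Open Scope classical_set_scope.
Local Open Scope ring_scope.
Local Notation Re := complex.Re.
Local Notation Im := complex.Im.
Local Notation normc := ComplexField.Normc.normc.

(* Cancelling the characteristic functions of the noises near 0, where they do not
   vanish, and continuing analytically gives, with f(z) = Phi_R(z, 0),

     Phi_R(z1, z2) f'(z1) f'(z2) = Phi_R'(z1, z2) f(z1) f(z2)

   on all of C^d x C^d. Since at every z0 one of the two sections of Phi_R, and one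
   of those of Phi_R', is not identically zero, f and f' have the same zeros with
   the same multiplicities on every complex line C v with v real. On such a line both are entire functions of order less than 2,
   so by Hadamard factorization their quotient is exp(s (m.v)), where m is the
   difference of the means. Only this consequence of Hadamard's theorem is proved:
   after division by the common zeros in a disc of radius r, the coefficients of
   index at least 1 of the logarithmic derivatives are bounded through the sums of
   |w|^2 over the inverses w of the roots of long Taylor polynomials, and these tend
   to 0 as r grows because the order is less than 2. Hence the noises have
   characteristic functions differing by the factor exp(i m.t), first where f' is
   not zero and then everywhere by continuity, and Fourier uniqueness concludes. *)

(** * Complex power series *)

(** No contour integral occurs: an entire function is its Taylor sequence [a], measured by the
    weighted norms ||a||_T = sum |a_k| T^k. These are submultiplicative for Cauchy products, and
    dividing out a zero z with 3 |z| <= T halves them. A series with constant term 1 has norm at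
    least 1, so the number of possible divisions, hence of zeros, is at most log_2 ||a||_T. The
    radii 6 * 2^j are 3 * 2 * 2^j: zeros are removed in the disc of radius 2 * 2^j so that the
    quotient is bounded below on the disc of radius 2^j, and the factor 3 is the price of a
    division. Order less than 2 enters as log ||a|| <= c kappa^j at these radii, with kappa < 4. A
    dyadic shell then holds O(kappa^j) roots, whose squared inverses are O(4^-j), so the sum over
    the shells from the j-th on is geometric, of size (kappa / 4)^j. Coefficient n of the
    logarithmic derivative is a power sum of exponent n + 1 of the inverse roots. The exponent is at
    least 2 except for n = 0; that coefficient is a mean, and the translation adjusts it. *)

Section ComplexModulus.
Context (R : realType).
Local Notation C := R[i].
Implicit Types (z w : C) (u v : nat -> C).

Lemma normc_Re_Im z : normc z = Num.sqrt (Re z ^+ 2 + Im z ^+ 2).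
Proof. by case: z. Qed.

Lemma normc_ge0 z : 0 <= normc z.
Proof. by rewrite normc_Re_Im sqrtr_ge0. Qed.

Lemma normcX z n : normc (z ^+ n) = normc z ^+ n.
Proof.
elim: n => [|n IH]; first by rewrite !expr0 ComplexField.Normc.normc1.
by rewrite !exprS ComplexField.Normc.normcM IH.
Qed.

Lemma normc_real (x : R) : normc x%:C%C = `|x|.
Proof. by rewrite normc_Re_Im /= expr0n addr0 sqrtr_sqr. Qed.

Lemma normc_eq0 z : (normc z == 0) = (z == 0).
Proof.
apply/eqP/eqP => [/ComplexField.Normc.eq0_normc//|->].
exact: ComplexField.Normc.normc0.
Qed.

Lemma normc_gt0 z : (0 < normc z) = (z != 0).
Proof. by rewrite lt_def normc_ge0 andbT normc_eq0. Qed.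

Lemma normcB z w : normc (z - w) = normc (w - z).
Proof. by rewrite -(normcN (w - z)) opprB. Qed.

Lemma normc_sum (I : Type) (r : seq I) (P : pred I) (F : I -> C) :
  normc (\sum_(i <- r | P i) F i) <= \sum_(i <- r | P i) normc (F i).
Proof.
elim/big_ind2: _ => [|x x' y y' hx hy|//]; first by rewrite ComplexField.Normc.normc0.
exact: le_trans (le_normcD _ _) (lerD hx hy).
Qed.

Lemma cReD z w : Re (z + w) = Re z + Re w. Proof. by case: z w => ? ? []. Qed.
Lemma cImD z w : Im (z + w) = Im z + Im w. Proof. by case: z w => ? ? []. Qed.
Lemma cReN z : Re (- z) = - Re z. Proof. by case: z. Qed.
Lemma cImN z : Im (- z) = - Im z. Proof. by case: z. Qed.
Lemma cReM z w : Re (z * w) = Re z * Re w - Im z * Im w.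
Proof. by case: z w => ? ? []. Qed.
Lemma cImM z w : Im (z * w) = Re z * Im w + Im z * Re w.
Proof. by case: z w => ? ? []. Qed.

Lemma complex_ext z w : Re z = Re w -> Im z = Im w -> z = w.
Proof. by case: z w => ? ? [? ?] /= -> ->. Qed.

Lemma normc_Re z : `|Re z| <= normc z.
Proof. by rewrite normc_Re_Im -sqrtr_sqr ler_sqrt ?addr_ge0 ?sqr_ge0// lerDl sqr_ge0. Qed.

Lemma normc_Im z : `|Im z| <= normc z.
Proof. by rewrite normc_Re_Im -sqrtr_sqr ler_sqrt ?addr_ge0 ?sqr_ge0// lerDr sqr_ge0. Qed.

Lemma normc_le z : normc z <= `|Re z| + `|Im z|.
Proof.
have h : 0 <= `|Re z| + `|Im z| by rewrite addr_ge0.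
rewrite normc_Re_Im -(ger0_norm h) -sqrtr_sqr ler_sqrt ?sqr_ge0//.
rewrite sqrrD !real_normK ?num_real// lerD2r lerDl.
by rewrite mulrn_wge0// mulr_ge0.
Qed.

Lemma normc_lerB z w : normc z - normc w <= normc (z - w).
Proof. by rewrite lerBlDr (le_trans _ (le_normcD _ _))// subrK. Qed.

(** Componentwise, to match [integralC]; [ccvg_normP] gives the equivalent form with the modulus. *)
Definition ccvg u z :=
  (Re (u n) @[n --> \oo] --> Re z) /\ (Im (u n) @[n --> \oo] --> Im z).

Lemma rcvgP (f : nat -> R) (l : R) :
  f n @[n --> \oo] --> l <->
  forall e : R, 0 < e -> exists N, forall n, (N <= n)%N -> `|f n - l| < e.
Proof.
split=> [/cvgrPdist_lt h e e0|h].
- by have [N _ hN] := h e e0; exists N => n Nn; rewrite distrC; exact: hN.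
- apply/cvgrPdist_lt => e e0; have [N hN] := h e e0.
  by exists N => // n /= Nn; rewrite distrC hN.
Qed.

Lemma ccvg_normP u z :
  ccvg u z <-> forall e : R, 0 < e -> exists N, forall n, (N <= n)%N -> normc (u n - z) < e.
Proof.
split=> [[/rcvgP hr /rcvgP hi] e e0|h].
- have e2 : 0 < e / 2 by rewrite divr_gt0.
  have [N hN] := hr _ e2; have [M hM] := hi _ e2.
  exists (maxn N M) => n; rewrite geq_max => /andP[Nn Mn].
  rewrite (le_lt_trans (normc_le _))// cReD cImD cReN cImN.
  by rewrite [ltRHS]splitr ltrD// ?hN ?hM.
- split; apply/rcvgP => e e0; have [N hN] := h e e0; exists N => n /hN; apply: le_lt_trans.
  + by rewrite -cReN -cReD normc_Re.
  + by rewrite -cImN -cImD normc_Im.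
Qed.

Lemma ccvg_cst z : ccvg (fun=> z) z.
Proof. by split; exact: cvg_cst. Qed.

Lemma ccvgD u v z w : ccvg u z -> ccvg v w -> ccvg (fun n => u n + v n) (z + w).
Proof.
move=> [h1 h2] [h3 h4]; split.
- by rewrite cReD; under eq_fun do rewrite cReD; apply: cvgD.
- by rewrite cImD; under eq_fun do rewrite cImD; apply: cvgD.
Qed.

Lemma ccvgN u z : ccvg u z -> ccvg (fun n => - u n) (- z).
Proof.
move=> [h1 h2]; split.
- by rewrite cReN; under eq_fun do rewrite cReN; apply: cvgN.
- by rewrite cImN; under eq_fun do rewrite cImN; apply: cvgN.
Qed.

Lemma ccvgB u v z w : ccvg u z -> ccvg v w -> ccvg (fun n => u n - v n) (z - w).
Proof. by move=> h1 h2; apply: ccvgD => //; exact: ccvgN. Qed.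

Lemma ccvgM u v z w : ccvg u z -> ccvg v w -> ccvg (fun n => u n * v n) (z * w).
Proof.
move=> [h1 h2] [h3 h4]; split.
- by rewrite cReM; under eq_fun do rewrite cReM; apply: cvgB; apply: cvgM.
- by rewrite cImM; under eq_fun do rewrite cImM; apply: cvgD; apply: cvgM.
Qed.

Lemma ccvg_uniq u z w : ccvg u z -> ccvg u w -> z = w.
Proof.
move=> [h1 h2] [h3 h4]; apply: complex_ext.
- exact: (cvg_unique _ h1 h3).
- exact: (cvg_unique _ h2 h4).
Qed.

Lemma ccvg_eq u v z : (forall n, u n = v n) -> ccvg u z -> ccvg v z.
Proof. by move=> /funext ->. Qed.

Lemma ccvgS u z : ccvg u z -> ccvg (fun n => u n.+1) z.
Proof.
move=> /ccvg_normP h; apply/ccvg_normP => e e0; have [N hN] := h e e0.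
by exists N => n Nn; apply: hN; rewrite leqW.
Qed.

Lemma ccvg_eqS u v z : (forall n, u n.+1 = v n) -> ccvg v z -> ccvg u z.
Proof.
move=> e /ccvg_normP h; apply/ccvg_normP => d d0; have [N hN] := h d d0.
by exists N.+1 => -[//|n] Nn; rewrite e; apply: hN.
Qed.

Lemma ccvg_norm u z : ccvg u z -> normc (u n) @[n --> \oo] --> normc z.
Proof.
move=> /ccvg_normP h; apply/rcvgP => e e0; have [N hN] := h e e0.
exists N => n /hN; apply: le_lt_trans.
by rewrite ler_norml normc_lerB andbT lerNl opprB normcB normc_lerB.
Qed.

Lemma ccvg_le u z (m : R) : ccvg u z -> (forall n, normc (u n) <= m) -> normc z <= m.
Proof.
move=> /ccvg_norm h hm; apply: (@cvgr_to_le _ _ _ _ _ _ _ h); exact: nearW.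
Qed.

End ComplexModulus.

Definition psum (R : realType) (a : nat -> R[i]) (s : R[i]) (N : nat) : R[i] :=
  \sum_(k < N) a k * s ^+ k.

(** Where the partial sums diverge this is only the default value of [lim]; every use is justified
    by a bound on the absolute series, through [ev_ccvg]. *)
HB.lock Definition ev (R : realType) (a : nat -> R[i]) (s : R[i]) : R[i] :=
  (lim (Re (psum a s n) @[n --> \oo]) +i* lim (Im (psum a s n) @[n --> \oo]))%C.

Section PowerSeries.
Context (R : realType).
Local Notation C := R[i].
Implicit Types (a b : nat -> C) (s z : C) (T m : R).

(** Partial sums of the weighted norm ||a||_T. [bnd] bounds the norm itself, and [ent] says that all
    these norms are finite, which characterizes the Taylor sequences of entire functions. *)
Definition apsum a T (N : nat) : R := \sum_(k < N) normc (a k) * T ^+ k.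
Definition bnd a T m := forall N, apsum a T N <= m.
Definition ent a := forall T, 0 <= T -> exists m, bnd a T m.

Lemma psumS a s N : psum a s N.+1 = psum a s N + a N * s ^+ N.
Proof. by rewrite /psum big_ord_recr. Qed.

Lemma apsumS a T N : apsum a T N.+1 = apsum a T N + normc (a N) * T ^+ N.
Proof. by rewrite /apsum big_ord_recr. Qed.

Lemma apsum_ge0 a T N : 0 <= T -> 0 <= apsum a T N.
Proof.
by move=> T0; apply: sumr_ge0 => i _; rewrite mulr_ge0 ?normc_ge0// exprn_ge0.
Qed.

Lemma apsum_nd a T M N : 0 <= T -> (M <= N)%N -> apsum a T M <= apsum a T N.
Proof.
move=> T0; elim: N => [|N IH]; first by rewrite leqn0 => /eqP ->.
rewrite leq_eqVlt => /predU1P[->//|]; rewrite ltnS => /IH h.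
by rewrite apsumS (le_trans h)// lerDl mulr_ge0 ?normc_ge0// exprn_ge0.
Qed.

Lemma apsum_mono a T T' N : 0 <= T -> T <= T' -> apsum a T N <= apsum a T' N.
Proof.
move=> T0 TT'; apply: ler_sum => i _; apply: ler_wpM2l; first exact: normc_ge0.
by rewrite lerXn2r// nnegrE// (le_trans T0).
Qed.

Lemma bnd_mono a T T' m : 0 <= T -> T <= T' -> bnd a T' m -> bnd a T m.
Proof. by move=> T0 TT' h N; rewrite (le_trans (apsum_mono _ _ T0 TT')). Qed.

Lemma bnd_ge0 a T m : bnd a T m -> 0 <= m.
Proof. by move=> /(_ 0%N); rewrite /apsum big_ord0. Qed.

Lemma bnd_coef a T m k : 0 <= T -> bnd a T m -> normc (a k) * T ^+ k <= m.
Proof.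
by move=> T0 h; rewrite (le_trans _ (h k.+1))// apsumS lerDr apsum_ge0.
Qed.

Lemma psum_diff a s M N : (M <= N)%N ->
  normc (psum a s N - psum a s M) <= apsum a (normc s) N - apsum a (normc s) M.
Proof.
elim: N => [|N IH]; first by rewrite leqn0 => /eqP ->; rewrite !subrr ComplexField.Normc.normc0.
rewrite leq_eqVlt => /predU1P[->|]; first by rewrite !subrr ComplexField.Normc.normc0.
rewrite ltnS => /IH h; rewrite psumS apsumS addrAC [leRHS]addrAC.
by rewrite (le_trans (le_normcD _ _))// lerD// ComplexField.Normc.normcM normcX.
Qed.

Lemma normc_psum a s N : normc (psum a s N) <= apsum a (normc s) N.
Proof.
have := @psum_diff a s 0 N (leq0n _).
by rewrite /psum big_ord0 /apsum big_ord0 !subr0.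
Qed.

Lemma apsum_tail a T m (e : R) : 0 <= T -> bnd a T m -> 0 < e ->
  exists N, forall M n, (N <= n)%N -> apsum a T M - apsum a T n < e.
Proof.
move=> T0 h e0.
have nd : nondecreasing_seq (apsum a T) by move=> M N; exact: apsum_nd.
have ub : has_ubound (range (apsum a T)) by exists m => _ [n _ <-]; exact: h.
have cv := nondecreasing_is_cvgn nd ub.
have [l lE] : exists l, l = limn (apsum a T) by eexists.
have /rcvgP/(_ _ e0)[N hN] : apsum a T n @[n --> \oo] --> l by rewrite lE.
exists N => M n Nn; have := hN n Nn; rewrite ltr_norml => /andP[+ _].
have := nondecreasing_cvgn_le nd cv M; rewrite -lE; lra.
Qed.

Lemma ev_ccvg a s m : bnd a (normc s) m -> ccvg (psum a s) (ev a s).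
Proof.
(* Real and imaginary parts are treated together, as an additive functional dominated by the
   modulus. *)
move=> h; suff H : forall (f : C -> R), (f 0 = 0) -> (forall x y, f (x + y) = f x + f y) ->
    (forall x, `|f x| <= normc x) -> cvgn (fun n => f (psum a s n)).
  by rewrite ev.unlock; split; apply: H; [|exact: cReD|exact: normc_Re| |exact: cImD|exact: normc_Im].
move=> f f0 fD fn.
have -> : (fun n => f (psum a s n)) = series (fun k => f (a k * s ^+ k)).
  apply/funext => n; rewrite /series /= big_mkord /psum.
  by elim/big_ind2: _ => // x x' y y' <- <-; rewrite fD.
apply: normed_cvg; apply: nondecreasing_is_cvgn.
- apply/nondecreasing_seqP => n. by rewrite -subr_ge0 [X in X - _](_ : _ = series (fun k => `|f (a k * s ^+ k)|) n.+1)// seriesS addrK.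

- exists m => _ [n _ <-]; apply: le_trans (h n).
  change (series (fun k => `|f (a k * s ^+ k)|) n <= apsum a (normc s) n).
  rewrite /series /= big_mkord.
  apply: ler_sum => i _; rewrite (le_trans (fn _))//.
  by rewrite ComplexField.Normc.normcM normcX.
Qed.

Lemma ev_tail a s m N : bnd a (normc s) m ->
  normc (ev a s - psum a s N) <= m - apsum a (normc s) N.
Proof.
move=> h; have := ccvgB (ev_ccvg h) (ccvg_cst (psum a s N)).
move=> /ccvg_normP H; rewrite leNgt; apply/negP => lt.
have e0 : 0 < normc (ev a s - psum a s N) - (m - apsum a (normc s) N) by rewrite subr_gt0.
have [M hM] := H _ e0; have := hM (maxn M N) (leq_maxl _ _).
have := psum_diff a s (leq_maxr M N); have := h (maxn M N).
set p := psum a s (maxn M N) => h1 h2.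
have := normc_lerB (ev a s - psum a s N) (p - psum a s N).
rewrite (normcB (ev a s - psum a s N)); lra.
Qed.

Lemma ent_ccvg a s : ent a -> ccvg (psum a s) (ev a s).
Proof. by move=> /(_ _ (normc_ge0 s))[m]; exact: ev_ccvg. Qed.

Lemma ev_unique a s z : ent a -> ccvg (psum a s) z -> ev a s = z.
Proof. by move=> /ent_ccvg h1 h2; exact: ccvg_uniq (h1 s) h2. Qed.

Lemma ev0 a : ent a -> ev a 0 = a 0%N.
Proof.
move=> h; apply: ev_unique => //; apply: (@ccvg_eqS _ _ (fun=> a 0%N)); last exact: ccvg_cst.
move=> n; rewrite /psum big_ord_recl expr0 mulr1 big1 ?addr0// => i _.
by rewrite expr0n mulr0.
Qed.

(** The factor k T^(k-1) of the mean value inequality is coarsened to (2 T)^k, so that [ev a] is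
    Lipschitz on the disc of radius T with constant ||a||_(2T). *)
Lemma normcXB s z T k : 1 <= T -> normc s <= T -> normc z <= T ->
  normc (s ^+ k - z ^+ k) <= normc (s - z) * (2 * T) ^+ k.
Proof.
move=> T1 sT zT; have T0 : 0 <= T by lra.
elim: k => [|k IH]; first by rewrite !expr0 subrr ComplexField.Normc.normc0 mulr_ge0 ?normc_ge0.
have -> : s ^+ k.+1 - z ^+ k.+1 = s * (s ^+ k - z ^+ k) + (s - z) * z ^+ k.
  by rewrite !exprS; ring.
rewrite (le_trans (le_normcD _ _))// !ComplexField.Normc.normcM normcX.
have h0 : 0 <= normc (s - z) by exact: normc_ge0.
have hk : (T : R) ^+ k <= (2 * T) ^+ k by rewrite lerXn2r ?nnegrE//; lra.
have h1 : normc s * normc (s ^+ k - z ^+ k) <= T * (normc (s - z) * (2 * T) ^+ k).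
  by apply: ler_pM => //; exact: normc_ge0.
have h2 : normc (s - z) * normc z ^+ k <= normc (s - z) * (T * (2 * T) ^+ k).
  apply: ler_wpM2l => //; rewrite (le_trans _ (ler_peMl _ T1)) ?exprn_ge0//; last by lra.
  by rewrite (le_trans _ hk)// lerXn2r ?nnegrE// normc_ge0.
by rewrite (le_trans (lerD h1 h2))// exprS; lra.
Qed.

Lemma ev_lipschitz a T m s z : 1 <= T -> bnd a (2 * T) m ->
  normc s <= T -> normc z <= T ->
  normc (ev a s - ev a z) <= normc (s - z) * m.
Proof.
move=> T1 h sT zT; have T2 : T <= 2 * T by lra.
have hs : bnd a (normc s) m by apply: bnd_mono h; rewrite ?normc_ge0//; lra.
have hz : bnd a (normc z) m by apply: bnd_mono h; rewrite ?normc_ge0//; lra.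
apply: ccvg_le (ccvgB (ev_ccvg hs) (ev_ccvg hz)) _ => n.
rewrite /psum -sumrB (le_trans (normc_sum _ _ _))//.
rewrite (le_trans _ (ler_wpM2l (normc_ge0 _) (h n)))// /apsum mulr_sumr.
apply: ler_sum => i _; rewrite -mulrBr ComplexField.Normc.normcM mulrCA.
by apply: ler_wpM2l; [exact: normc_ge0|exact: normcXB].
Qed.

Definition ccont (f : C -> C) := forall (u : nat -> C) z, ccvg u z -> ccvg (fun n => f (u n)) (f z).

Lemma ccont_ev a : ent a -> ccont (ev a).
Proof.
move=> ha u z uz; apply/ccvg_normP => e e0.
have [N1 hN1] := (ccvg_normP _ _).1 uz 1 ltr01.
have T1 : 1 <= normc z + 1 by rewrite lerDr normc_ge0.
have [m hm] := ha (2 * (normc z + 1)) ltac:(lra).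
have m0 := bnd_ge0 hm.
have e1 : 0 < e / (m + 1) by rewrite divr_gt0//; lra.
have [N2 hN2] := (ccvg_normP _ _).1 uz _ e1.
exists (maxn N1 N2) => n; rewrite geq_max => /andP[n1 n2].
have un : normc (u n) <= normc z + 1.
  by have := normc_lerB (u n) z; have := hN1 _ n1; lra.
have zz : normc z <= normc z + 1 by lra.
rewrite (le_lt_trans (ev_lipschitz T1 hm un zz))//.
have := hN2 _ n2; rewrite ltr_pdivlMr; last by lra.
apply: le_lt_trans; apply: ler_wpM2l; [exact: normc_ge0|lra].
Qed.

Lemma ccontM f g : ccont f -> ccont g -> ccont (fun s => f s * g s).
Proof. by move=> hf hg u z uz; apply: ccvgM; [exact: hf|exact: hg]. Qed.

Lemma ccont_cst (w : C) : ccont (fun=> w).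
Proof. by move=> u z _; exact: ccvg_cst. Qed.

(* If a_p is the first nonzero coefficient then ev a s / s^p is close to a_p. *)
Lemma ev_isolated_zeros a : ent a -> (exists k, a k != 0) ->
  exists2 d : R, 0 < d & forall s, 0 < normc s -> normc s < d -> ev a s != 0.
Proof.
move=> ha ex; have [p ap pmin] := ex_minnP ex.
have [m hm] := ha 1 ler01.
have m0 := bnd_ge0 hm.
have ap0 : 0 < normc (a p) by rewrite normc_gt0.
(* For |s| <= 1 the terms of index above [p] add up to at most |s|^(p+1) m, and this radius keeps
   that below |a_p| |s|^p. The denominator m + 1 is positive even if m = 0. *)
pose d := Num.min 1 (normc (a p) / (m + 1)).
have d1 : d <= 1 by rewrite /d ge_min lexx.
have d2 : d <= normc (a p) / (m + 1) by rewrite /d ge_min lexx orbT.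
exists d; first by rewrite /d lt_min ltr01 divr_gt0//; lra.
move=> s s0 sd; apply/negP => /eqP es.
have ps n : psum a s (p + n.+1) = a p * s ^+ p + \sum_(k < n) a (p + k.+1)%N * s ^+ (p + k.+1).
  rewrite /psum big_split_ord/= big1 ?add0r.
    by rewrite big_ord_recl/= addn0; congr (_ + _); apply: eq_bigr.
  move=> i _; case: (eqVneq (a i) 0) => [->|/pmin]; first by rewrite mul0r.
  by rewrite leqNgt ltn_ord.
have lim : ccvg (fun n => psum a s (p + n.+1)) 0.
  have /ccvg_normP h := ent_ccvg s ha; apply/ccvg_normP => e e0; have [N hN] := h e e0.
  by exists N => n Nn; rewrite -es hN// (leq_trans Nn)// addnS ltnW// ltnS leq_addl.
have : ccvg (fun n => - (\sum_(k < n) a (p + k.+1)%N * s ^+ (p + k.+1))) (a p * s ^+ p).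
  have := ccvgB (ccvg_cst (a p * s ^+ p)) lim; rewrite subr0; apply: ccvg_eq => n.
  by rewrite ps opprD addrA subrr add0r.
move=> /(@ccvg_le _ _ _ (normc s ^+ p * (normc s * m))).
have -> : normc (a p * s ^+ p) = normc s ^+ p * normc (a p).
  by rewrite ComplexField.Normc.normcM normcX mulrC.
rewrite ler_pM2l ?exprn_gt0// => H.
have : normc (a p) <= normc s * m; last first.
  apply/negP; rewrite -ltNge (le_lt_trans (ler_wpM2l (normc_ge0 _) (_ : m <= m + 1)))//; first by lra.
  by rewrite -ltr_pdivlMr; [exact: lt_le_trans sd d2|lra].
apply: H => n; rewrite normcN (le_trans (normc_sum _ _ _))//.
rewrite mulrA -exprSr.
rewrite (le_trans _ (ler_wpM2l (exprn_ge0 _ (normc_ge0 _)) (hm (p.+1 + n)%N)))//.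
rewrite /apsum big_split_ord /= mulrDr ler_wpDl//.
  by rewrite mulr_ge0 ?exprn_ge0 ?normc_ge0// sumr_ge0// => i _; rewrite mulr_ge0 ?normc_ge0 ?exprn_ge0.
rewrite mulr_sumr; apply: ler_sum => i _.
rewrite expr1n mulr1 ComplexField.Normc.normcM normcX -addSnnS [leRHS]mulrC.
apply: ler_wpM2l; first exact: normc_ge0.
by rewrite exprD ler_piMr ?exprn_ge0 ?normc_ge0// exprn_ile1 ?normc_ge0// (le_trans (ltW sd)).
Qed.

End PowerSeries.

(** * Cauchy products, the identity theorem and the exponential series *)

Section CauchyProduct.
Context (R : realType).
Local Notation C := R[i].
Implicit Types (a b : nat -> C) (s z : C) (T m : R).

Definition conv a b (n : nat) : C := \sum_(i < n.+1) a i * b (n - i)%N.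

Lemma triangular_sum (V : nmodType) (F : nat -> nat -> V) N :
  \sum_(n < N) \sum_(i < n.+1) F i (n - i)%N = \sum_(i < N) \sum_(j < N - i) F i j.
Proof.
elim: N => [|N IH]; first by rewrite !big_ord0.
rewrite big_ord_recr/= IH [RHS]big_ord_recr/= [X in _ + X = _]big_ord_recr/= subnn.
rewrite subSnn big_ord1 addrA; congr (_ + _); rewrite -big_split/=.
by apply: eq_bigr => i _; rewrite subSn ?(ltnW (ltn_ord _))// big_ord_recr.
Qed.

Lemma psum_conv a b s N :
  psum (conv a b) s N = \sum_(i < N) a i * s ^+ i * psum b s (N - i).
Proof.
transitivity (\sum_(n < N) \sum_(i < n.+1) (a i * s ^+ i * (b (n - i)%N * s ^+ (n - i)))).
  apply: eq_bigr => n _; rewrite /conv mulr_suml; apply: eq_bigr => i _.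
  rewrite mulrACA -exprD subnKC// -ltnS ltn_ord//.
rewrite (triangular_sum (fun i j => a i * s ^+ i * (b j * s ^+ j))).
by apply: eq_bigr => i _; rewrite /psum mulr_sumr.
Qed.

Lemma bnd_conv a b T m m' : 0 <= T -> bnd a T m -> bnd b T m' ->
  bnd (conv a b) T (m * m').
Proof.
move=> T0 ha hb N; have m0 := bnd_ge0 hb.
apply: (@le_trans _ _ (\sum_(n < N) \sum_(i < n.+1)
    (normc (a i) * T ^+ i * (normc (b (n - i)%N) * T ^+ (n - i))))).
  apply: ler_sum => n _; rewrite (le_trans (ler_wpM2r _ (normc_sum _ _ _))) ?exprn_ge0//.
  rewrite mulr_suml; apply: ler_sum => i _; rewrite ComplexField.Normc.normcM.
  by rewrite [leRHS]mulrACA -exprD subnKC// -ltnS ltn_ord.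
rewrite (triangular_sum (fun i j => normc (a i) * T ^+ i * (normc (b j) * T ^+ j))).
apply: (@le_trans _ _ (\sum_(i < N) normc (a i) * T ^+ i * m')).
  apply: ler_sum => i _; rewrite -mulr_sumr ler_wpM2l ?mulr_ge0 ?normc_ge0 ?exprn_ge0//.
  exact: hb.
by rewrite -mulr_suml ler_wpM2r//; exact: ha.
Qed.

Lemma ent_conv a b : ent a -> ent b -> ent (conv a b).
Proof.
move=> ha hb T T0; have [m hm] := ha T T0; have [m' hm'] := hb T T0.
by exists (m * m'); exact: bnd_conv.
Qed.

(** The defect of the partial sums is the sum over i < N of a_i s^i times the tail of b from index N
    - i. For i < N - N1 the tail of b is small; the last N1 terms carry a small part of the absolute
    series of a, while the tails of b stay bounded. *)
Lemma ev_conv a b s : ent a -> ent b -> ev (conv a b) s = ev a s * ev b s.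
Proof.
move=> ha hb; apply: ev_unique; first exact: ent_conv.
have s0 := normc_ge0 s.
have [m hm] := ha _ s0; have [m' hm'] := hb _ s0.
have m0 := bnd_ge0 hm; have m'0 := bnd_ge0 hm'.
suff : ccvg (fun N => \sum_(i < N) a i * s ^+ i * (ev b s - psum b s (N - i))) 0.
  move=> h; have := ccvgB (ccvgM (ent_ccvg s ha) (ccvg_cst (ev b s))) h.
  rewrite subr0; apply: ccvg_eq => N; rewrite psum_conv /psum mulr_suml -sumrB.
  by apply: eq_bigr => i _; rewrite mulrBr opprB addrC subrK.
apply/ccvg_normP => e e0.
have e1 : 0 < e / 2 / (m + 1) by rewrite !divr_gt0//; lra.
have e2 : 0 < e / 2 / (m' + 1) by rewrite !divr_gt0//; lra.
have [N1 hN1] := (ccvg_normP _ _).1 (ent_ccvg s hb) _ e1.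
have [N2 hN2] := apsum_tail s0 hm e2.
exists (N1 + N2)%N => N hN; rewrite subr0 (le_lt_trans (normc_sum _ _ _))//.
have N1N : (N1 <= N)%N by rewrite (leq_trans _ hN)// leq_addr.
have hk : (N2 <= N - N1)%N by rewrite leq_subRL.
rewrite -(subnK N1N) big_split_ord/= [e]splitr ltr_leD//.
- apply: (@le_lt_trans _ _ (\sum_(i < N - N1) normc (a i) * normc s ^+ i * (e / 2 / (m + 1)))).
    apply: ler_sum => i _; rewrite !ComplexField.Normc.normcM normcX.
    apply: ler_wpM2l; first by rewrite mulr_ge0 ?exprn_ge0 ?normc_ge0.
    by rewrite normcB ltW// subnK// hN1// leq_subRL ?(leq_trans (ltnW (ltn_ord i)) (leq_subr _ _))// addnC -leq_subRL// ltnW.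
  rewrite -mulr_suml -/(apsum _ _ _) mulrA ltr_pdivrMr; last lra.
  rewrite mulrC ltr_pM2l; last lra.
  by have := hm (N - N1)%N; lra.
- apply: (@le_trans _ _ (\sum_(i < N1) normc (a (N - N1 + i)%N) * normc s ^+ (N - N1 + i) * m')).
    apply: ler_sum => i _; rewrite !ComplexField.Normc.normcM normcX.
    apply: ler_wpM2l; first by rewrite mulr_ge0 ?exprn_ge0 ?normc_ge0.
    by rewrite (le_trans (ev_tail _ hm'))// gerBl apsum_ge0.
  rewrite -mulr_suml.
  have -> : \sum_(i < N1) normc (a (N - N1 + i)%N) * normc s ^+ (N - N1 + i) =
      apsum a (normc s) N - apsum a (normc s) (N - N1).
    by rewrite /apsum -[in X in X - _](subnK N1N) big_split_ord/= [RHS]addrAC subrr add0r.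
  have := hN2 N _ hk; set d := _ - _ => hd.
  rewrite (@le_trans _ _ (e / 2 / (m' + 1) * m'))//; first by rewrite ler_wpM2r// ltW.
  rewrite mulrAC ler_pdivrMr; last lra.
  by apply: ler_wpM2l; lra.
Qed.

(** The test points [i l] are those at which the functional equation becomes available: there real
    directions turn into arguments of characteristic functions. *)
Lemma ev_identity a : ent a ->
  (exists2 d : R, 0 < d & forall l : R, 0 < l -> l < d -> ev a (0 +i* l)%C = 0) ->
  forall k, a k = 0.
Proof.
move=> ha [d d0 hd] k; apply/eqP; apply/negPn/negP => ak.
have [d' d'0 h] := ev_isolated_zeros ha (ex_intro _ k ak).
pose l := Num.min d d' / 2.
have l0 : 0 < l by rewrite divr_gt0// lt_min d0.
have ll : l < Num.min d d' by rewrite /l; move: l0; rewrite /l; lra.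
move: ll; rewrite lt_min => /andP[ld ld'].
have nl : normc (0 +i* l)%C = l by rewrite /= expr0n add0r sqrtr_sqr gtr0_norm.
by have := h (0 +i* l)%C; rewrite nl => /(_ l0 ld'); rewrite hd// eqxx.
Qed.

Lemma ev_zero a s : (forall k, a k = 0) -> ev a s = 0.
Proof.
move=> h; have ha : ent a.
  by move=> T _; exists 0 => N; rewrite /apsum big1// => i _; rewrite h ComplexField.Normc.normc0 mul0r.
apply: ev_unique => //; apply: ccvg_eq (ccvg_cst 0) => n.
by rewrite /psum big1// => i _; rewrite h mul0r.
Qed.

Lemma bndB a b T m m' : 0 <= T -> bnd a T m -> bnd b T m' ->
  bnd (fun k => a k - b k) T (m + m').
Proof.
move=> T0 ha hb N; apply: le_trans (lerD (ha N) (hb N)).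
rewrite /apsum -big_split/=; apply: ler_sum => i _.
rewrite -mulrDl ler_wpM2r ?exprn_ge0//.
by rewrite (le_trans (le_normcD _ _))// normcN.
Qed.

Lemma entB a b : ent a -> ent b -> ent (fun k => a k - b k).
Proof.
move=> ha hb T T0; have [m hm] := ha T T0; have [m' hm'] := hb T T0.
by exists (m + m'); exact: bndB.
Qed.

Lemma evB a b s : ent a -> ent b -> ev (fun k => a k - b k) s = ev a s - ev b s.
Proof.
move=> ha hb; apply: ev_unique; first exact: entB.
apply: ccvg_eq (ccvgB (ent_ccvg s ha) (ent_ccvg s hb)) => n.
by rewrite /psum -sumrB; apply: eq_bigr => i _; rewrite mulrBl.
Qed.

Definition invfact (k : nat) : C := (k`!%:R)^-1.

Lemma normc_invfact k : normc (invfact k) = (k`!%:R)^-1.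
Proof.
rewrite /invfact ComplexField.Normc.normcV; congr (_^-1).
have -> : (k`!%:R : C) = (k`!%:R : R)%:C%C by rewrite rmorph_nat.
by rewrite normc_real ger0_norm.
Qed.

Lemma bnd_invfact T : 0 <= T -> bnd invfact T (expR T).
Proof.
move=> T0 N.
have -> : apsum invfact T N = series (exp_coeff T) N.
  rewrite /series /= big_mkord; apply: eq_bigr => i _.
  by rewrite normc_invfact mulrC.
rewrite /expR; apply: nondecreasing_cvgn_le; last exact: is_cvg_series_exp_coeff.
apply/nondecreasing_seqP => n; rewrite seriesS lerDr divr_ge0// exprn_ge0//.
Qed.

Definition geomexp z (k : nat) : C := invfact k * z ^+ k.

Lemma psum_geomexp z N : psum (geomexp z) 1 N = psum invfact z N.
Proof. by apply: eq_bigr => i _; rewrite expr1n mulr1. Qed.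

Lemma ent_geomexp z : ent (geomexp z).
Proof.
move=> T T0; exists (expR (T * normc z)) => N.
have -> : apsum (geomexp z) T N = apsum invfact (T * normc z) N.
  apply: eq_bigr => i _; rewrite /geomexp ComplexField.Normc.normcM normcX exprMn.
  by rewrite -mulrA [in RHS](mulrC (T ^+ i)).
by apply: bnd_invfact; rewrite mulr_ge0 ?normc_ge0.
Qed.

(** The binomial theorem; it yields the addition formula for [expC] through [ev_conv]. *)
Lemma conv_geomexp z w : conv (geomexp z) (geomexp w) = geomexp (z + w).
Proof.
apply/funext => n; rewrite /geomexp addrC exprDn mulr_sumr /conv; apply: eq_bigr => i _.
have fn0 k : (k`!%:R : C) != 0 by rewrite pnatr_eq0 -lt0n fact_gt0.
have ni : (i <= n)%N by rewrite -ltnS ltn_ord.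
rewrite /invfact -mulr_natr -(bin_fact ni) !natrM.
have b0 : ('C(n, i)%:R : C) != 0 by rewrite pnatr_eq0 -lt0n bin_gt0.
by field; rewrite ?b0 ?fn0.
Qed.

(** [expC] is defined by real functions, so it is matched with its series on the real axis (series
    of [expR]) and on the imaginary axis (series of [cos] and [sin]), and a Cauchy product combines
    the two. *)
Lemma expC_ccvg z : ccvg (psum invfact z) (expC z).
Proof.
have Hre x : ccvg (psum invfact x%:C%C) (expR x)%:C%C.
  have -> : psum invfact x%:C%C = fun n => (series (exp_coeff x) n)%:C%C.
    apply/funext => n; rewrite /series /= big_mkord rmorph_sum/=; apply: eq_bigr => i _.
    by rewrite /invfact [exp_coeff _ _]/exp_coeff /= mulrC rmorphM rmorphXn /= fmorphV rmorph_nat.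
  split => /=; last exact: cvg_cst.
  by rewrite /expR; exact: is_cvg_series_exp_coeff.
have Him y : ccvg (psum invfact (0 +i* y)%C) (cos y +i* sin y)%C.
  have hk (k : nat) : invfact k * (0 +i* y)%C ^+ k = (cos_coeff y k +i* sin_coeff y k)%C.
    have ik : ((0 +i* 1)%C : C) ^+ k = ((~~ odd k)%:R * (-1) ^+ k./2 +i* ((odd k)%:R * (-1) ^+ k.-1./2))%C.
      elim/ltn_ind: k => -[|[|k]] IH.
      - by rewrite expr0 /= mulr1 mul0r.
      - by rewrite expr1 /= mul0r mulr1.
      - rewrite !exprS mulrA -expr2 sqr_i IH// mulN1r /= negbK.
        apply: complex_ext; rewrite /= ?cReN ?cImN /=.
          by rewrite ?exprS; ring.
        case: k {IH} => [|k] /=; first by ring.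
        by rewrite ?negbK ?exprS; ring.
    transitivity (invfact k * ((0 +i* 1)%C * y%:C%C) ^+ k).
      by congr (_ * _ ^+ _); apply: complex_ext => /=; ring.
    rewrite exprMn ik /invfact -(rmorph_nat (real_complex R)) -fmorphV -rmorphXn.
    apply: complex_ext; rewrite /cos_coeff /sin_coeff /= ?(exprnP (-1 : R) k./2); ring.
  split => /=.
  - rewrite unlock; under eq_fun.
      move=> n; have -> : Re (psum invfact (0 +i* y)%C n) = series (cos_coeff y) n.
        rewrite /series /= big_mkord /psum.
        by elim/big_ind2: _ => // [x x' u u' <- <-|i _]; rewrite ?cReD// hk.
      over.
    exact: is_cvg_series_cos_coeff.
  - rewrite unlock; under eq_fun.
      move=> n; have -> : Im (psum invfact (0 +i* y)%C n) = series (sin_coeff y) n.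
        rewrite /series /= big_mkord /psum.
        by elim/big_ind2: _ => // [x x' u u' <- <-|i _]; rewrite ?cImD// hk.
      over.
    exact: is_cvg_series_sin_coeff.
case: z => x y.
have -> : (x +i* y)%C = x%:C%C + (0 +i* y)%C :> C by apply: complex_ext; rewrite /= ?addr0 ?add0r.
have e1 : ev (geomexp x%:C%C) 1 = (expR x)%:C%C.
  apply: ev_unique; first exact: ent_geomexp.
  by apply: ccvg_eq (Hre x) => n; rewrite psum_geomexp.
have e2 : ev (geomexp (0 +i* y)%C) 1 = (cos y +i* sin y)%C.
  apply: ev_unique; first exact: ent_geomexp.
  by apply: ccvg_eq (Him y) => n; rewrite psum_geomexp.
have e3 : ev (geomexp (x%:C%C + (0 +i* y)%C)) 1 = expC (x%:C%C + (0 +i* y)%C).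
  rewrite -conv_geomexp ev_conv; [|exact: ent_geomexp..].
  rewrite e1 e2 /expC; apply: complex_ext => /=; rewrite ?addr0 ?add0r; ring.
rewrite -e3; apply: ccvg_eq (ent_ccvg _ (@ent_geomexp _)) => n.
exact: psum_geomexp.
Qed.

Lemma expCD z w : expC (z + w) = expC z * expC w.
Proof.
have h u : ev (geomexp u) 1 = expC u.
  apply: ev_unique; first exact: ent_geomexp.
  by apply: ccvg_eq (expC_ccvg u) => n; rewrite psum_geomexp.
by rewrite -!h -conv_geomexp ev_conv//; exact: ent_geomexp.
Qed.

End CauchyProduct.

(** * Entire functions of order less than 2 *)

Section LogDerivative.
Context (R : realType).
Local Notation C := R[i].
Implicit Types (a b l : nat -> C) (s z w : C) (T m : R) (ws : seq C).

(* Coefficients of [(1 - w X) b]. *)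
Definition mulw b w (n : nat) : C := b n - (if n is k.+1 then w * b k else 0).
Definition mulws ws b := foldr (fun w c => mulw c w) b ws.

Lemma mulw0 b w : mulw b w 0%N = b 0%N.
Proof. by rewrite /mulw subr0. Qed.

Lemma mulws0 ws b : mulws ws b 0%N = b 0%N.
Proof. by elim: ws => //= w ws IH; rewrite mulw0. Qed.

Lemma conv_mulw b x w n : conv (mulw b w) x n = mulw (conv b x) w n.
Proof.
rewrite /conv /mulw; under eq_bigr do rewrite mulrBl.
rewrite sumrB; congr (_ - _); case: n => [|n]; first by rewrite big_ord1 mul0r.
by rewrite big_ord_recl mul0r add0r mulr_sumr; apply: eq_bigr => i _; rewrite mulrA.
Qed.

(* [l] is [a' / a] up to order [N]. *)
Definition log_deriv (N : nat) a l :=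
  forall n, (n < N)%N -> conv a l n = a n.+1 *+ n.+1.

(** With constant term 1 the equations defining [l] are triangular with unit diagonal;
    [log_deriv_ex] solves the same recursion. *)
Lemma log_deriv_uniq N a l l' : a 0%N = 1 -> log_deriv N a l -> log_deriv N a l' ->
  forall n, (n < N)%N -> l n = l' n.
Proof.
move=> a0 h h'; elim/ltn_ind => n IH nN.
have := h n nN; rewrite -(h' n nN) /conv !big_ord_recl a0 !mul1r !subn0.
have -> : \sum_(i < n) a (lift ord0 i) * l (n - lift ord0 i)%N =
          \sum_(i < n) a (lift ord0 i) * l' (n - lift ord0 i)%N.
  apply: eq_bigr => i _; rewrite IH//; last by rewrite (leq_ltn_trans (leq_subr _ _)).
  by rewrite lift0 ltn_subrL /= (leq_ltn_trans (leq0n i) (ltn_ord i)).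
exact: addIr.
Qed.

Lemma log_deriv_ex N a : a 0%N = 1 -> exists l, log_deriv N a l.
Proof.
move=> a0; elim: N => [|N [l hl]]; first by exists (fun=> 0).
pose t := a N.+1 *+ N.+1 - \sum_(i < N) a i.+1 * l (N - i.+1)%N.
exists (fun k => if k == N then t else l k) => n; rewrite ltnS leq_eqVlt => /predU1P[->|nN].
- rewrite /conv big_ord_recl a0 mul1r subn0 eqxx /t -addrA [X in _ + X](_ : _ = 0) ?addr0//.
  apply/eqP; rewrite addrC subr_eq0; apply/eqP/eq_bigr => i _ /=.
  rewrite /bump /= add1n ifF//; apply/negbTE.
  by rewrite neq_ltn ltn_subrL /= (leq_ltn_trans (leq0n i) (ltn_ord i)).
- rewrite -hl//; apply: eq_bigr => i _; rewrite ifF//; apply/negbTE.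
  by rewrite neq_ltn (leq_ltn_trans (leq_subr _ _)).
Qed.

Lemma log_deriv_inj N a b l : a 0%N = b 0%N -> log_deriv N a l -> log_deriv N b l ->
  forall n, (n <= N)%N -> a n = b n.
Proof.
move=> ab ha hb; elim/ltn_ind => -[//|n] IH nN.
have := ha n nN; have -> : conv a l n = conv b l n.
  by apply: eq_bigr => i _; rewrite IH// (leq_trans _ nN)// ltnW.
rewrite hb// => /esym/eqP; rewrite -subr_eq0 -mulrnBl mulrn_eq0/= subr_eq0 => /eqP.
exact: id.
Qed.

(** Logarithmic derivatives add under products, and that of 1 - w X is minus the sum of the w^(n+1)
    X^n. *)
Lemma log_deriv_mulw N b l w : log_deriv N b l ->
  log_deriv N (mulw b w) (fun n => l n - w ^+ n.+1).
Proof.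
move=> h n nN.
have -> : conv (mulw b w) (fun n => l n - w ^+ n.+1) n =
    conv (mulw b w) l n - conv (mulw b w) (fun n => w ^+ n.+1) n.
  by rewrite /conv -sumrB; apply: eq_bigr => i _; rewrite mulrBr.
rewrite !conv_mulw.
(* The convolution represents w b / (1 - w X), so multiplying by 1 - w X gives back w b. *)
have -> : mulw (conv b (fun n => w ^+ n.+1)) w n = w * b n.
  rewrite /mulw; case: {nN} n => [|n]; first by rewrite /conv big_ord1 subr0 expr1 mulrC.
  rewrite /conv big_ord_recr/= subnn expr1 mulr_sumr addrAC -sumrB big1 ?add0r 1?mulrC// => i _.
  have iN : (i <= n)%N by rewrite -ltnS.
  by rewrite subSn// [_ ^+ (n - i).+2]exprS mulrCA subrr.
rewrite /mulw h//; case: n nN => [|n] nN; first by rewrite subr0 !mulr1n.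
rewrite h ?(ltnW nN)// mulrnBl [(w * b n.+1) *+ n.+2]mulrSr mulrnAr opprD addrA.
by [].
Qed.

Lemma log_deriv_mulws N b l ws : log_deriv N b l ->
  log_deriv N (mulws ws b) (fun n => l n - \sum_(w <- ws) w ^+ n.+1).
Proof.
move=> h; elim: ws => [|w ws IH] /=.
  by move=> n nN; rewrite -h//; apply: eq_bigr => i _; rewrite big_nil subr0.
move=> n nN; rewrite -(log_deriv_mulw w IH nN); apply: eq_bigr => i _.
by rewrite big_cons opprD addrA addrAC.
Qed.

Lemma psum_mulw b w s N : psum (mulw b w) s N.+1 = psum b s N.+1 - w * s * psum b s N.
Proof.
rewrite /psum /mulw; under eq_bigr do rewrite mulrBl.
rewrite sumrB; congr (_ - _); rewrite big_ord_recl mul0r add0r mulr_sumr.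
by apply: eq_bigr => i _; rewrite lift0 exprS; ring.
Qed.

Lemma ev_mulw b w s : ent b -> ent (mulw b w) -> ev (mulw b w) s = (1 - w * s) * ev b s.
Proof.
move=> hb hm; apply: ev_unique => //; have h := ent_ccvg s hb.
apply: (@ccvg_eqS _ _ (fun n => psum b s n.+1 - w * s * psum b s n)).
  by move=> n; rewrite psum_mulw.
rewrite mulrBl mul1r; apply: ccvgB; first exact: ccvgS.
by apply: ccvgM => //; exact: ccvg_cst.
Qed.

(* [(|w| T - 1) ||b||_T <= ||(1 - w X) b||_T], where [||.||_T] is [apsum] at [T];
   for truncated sums this holds up to the boundary term [b_M T^M]. *)
Lemma bnd_divw b w T m : 0 < T -> 3 <= normc w * T ->
  (forall N, exists2 M, (N <= M)%N & normc (b M) * T ^+ M + apsum (mulw b w) T M.+1 <= m) ->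
  bnd b T (m / 2).
Proof.
move=> T0 wT h N; have [M NM hM] := h N.
rewrite (le_trans (apsum_nd b (ltW T0) NM))//.
(* Sum of |w b_i| <= |b_(i+1)| + |(mulw b w)_(i+1)|, weighted by T^(i+1). As |w| T >= 3, moving one
   copy of [apsum b T M] to the left leaves a factor at least 2, which is the halving. *)
have key : normc w * T * apsum b T M <= apsum b T M.+1 + apsum (mulw b w) T M.+1.
  rewrite /apsum [X in _ <= X + _]big_ord_recl [X in _ <= _ + X]big_ord_recl.
  rewrite mulr_sumr addrACA ler_wpDl//.
    by rewrite !expr0 !mulr1 addr_ge0// normc_ge0.
  rewrite -big_split/=; apply: ler_sum => i _; rewrite -mulrDl /bump/= add1n.
  rewrite [leLHS](_ : _ = normc (w * b i) * T ^+ i.+1); last first.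
    by rewrite ComplexField.Normc.normcM exprS; ring.
  rewrite ler_wpM2r ?exprn_ge0 ?(ltW T0)//.
  rewrite [w * b i](_ : _ = b i.+1 - mulw b w i.+1); last by rewrite /mulw opprB addrC subrK.
  by rewrite (le_trans (le_normcD _ _))// normcN.
have := ler_wpM2r (apsum_ge0 b M (ltW T0)) wT.
rewrite apsumS in key; lra.
Qed.

(* Coefficients of [a / (1 - w X)]. *)
Definition dvs a w (n : nat) : C := \sum_(k < n.+1) a k * w ^+ (n - k).

Lemma dvs0 a w : dvs a w 0%N = a 0%N.
Proof. by rewrite /dvs big_ord1 expr0 mulr1. Qed.

Lemma mulw_dvs a w : mulw (dvs a w) w = a.
Proof.
apply/funext => -[|n]; rewrite /mulw; first by rewrite dvs0 subr0.
rewrite /dvs big_ord_recr/= subnn expr0 mulr1 mulr_sumr addrAC -sumrB big1 ?add0r// => i _.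
by rewrite subSn -1?ltnS ?ltn_ord// exprS mulrCA subrr.
Qed.

(** The zero of [ev a] controls the boundary term of [bnd_divw]. If b = a / (1 - X / z) then b_N z^N
    is a partial sum of a at z, that is, minus the corresponding tail. The tail is at most (|z| /
    T)^N times the tail of the norm at T, so |b_N| T^N is at most m minus the partial norm of a. *)
Lemma dvs_bnd a z T m : z != 0 -> ent a -> ev a z = 0 ->
  3 * normc z <= T -> bnd a T m -> bnd (dvs a z^-1) T (m / 2).
Proof.
move=> z0 ha az zT hb; have nz : 0 < normc z by rewrite normc_gt0.
have T0 : 0 < T by lra.
apply: (@bnd_divw _ z^-1) => //.
  by rewrite ComplexField.Normc.normcV mulrC ler_pdivlMr.
move=> N; exists N => //; rewrite mulw_dvs.
have bE : dvs a z^-1 N * z ^+ N = psum a z N.+1.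
  rewrite /dvs mulr_suml; apply: eq_bigr => i _.
  have iN : (i <= N)%N by rewrite -ltnS.
  by rewrite exprVn -mulrA -[X in _ * (_ * z ^+ X) = _](subnK iN) exprD mulKf// expf_neq0.
have H : ccvg (fun n => psum a z (N.+1 + n) - psum a z N.+1) (- psum a z N.+1).
  have /ccvg_normP h := ent_ccvg z ha; apply/ccvg_normP => e e0; have [N' hN] := h e e0.
  exists N' => n Nn; rewrite opprK subrK.
  have := hN (N.+1 + n)%N; rewrite az subr0; apply.
  by rewrite (leq_trans Nn)// leq_addl.
have hd n : normc (psum a z (N.+1 + n) - psum a z N.+1) <=
    (normc z / T) ^+ N * (m - apsum a T N.+1).
  rewrite (le_trans (psum_diff _ _ (leq_addr _ _)))//.
  apply: (@le_trans _ _ ((normc z / T) ^+ N * (apsum a T (N.+1 + n) - apsum a T N.+1))); last first.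
    apply: ler_wpM2l; first by rewrite exprn_ge0// divr_ge0// ltW.
    by have := hb (N.+1 + n)%N; lra.
  rewrite /apsum !big_split_ord/= !(addrAC _ _ (- _)) !subrr !add0r mulr_sumr.
  apply: ler_sum => i _; rewrite mulrCA ler_wpM2l ?normc_ge0//.
  have -> : normc z ^+ (N.+1 + i) = (normc z / T) ^+ (N.+1 + i) * T ^+ (N.+1 + i).
    by rewrite exprMn -mulrA -exprMn mulVf ?expr1n ?mulr1// gt_eqF.
  rewrite ler_wpM2r ?exprn_ge0 ?(ltW T0)// addSnnS exprD ler_piMr//.
    by rewrite exprn_ge0// divr_ge0// ltW.
  by rewrite exprn_ile1 ?divr_ge0 ?(ltW T0) ?(ltW nz)// ler_pdivrMr//; lra.
have := ccvg_le H hd; rewrite normcN -bE ComplexField.Normc.normcM normcX.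
have c0 : 0 < (normc z / T) ^+ N by rewrite exprn_gt0// divr_gt0.
rewrite -lerBrDr -(ler_pM2l c0); apply: le_trans.
rewrite mulrCA -exprMn [_ / T * T]mulfVK// gt_eqF//.
Qed.

Lemma dvs_ent a z : z != 0 -> ent a -> ev a z = 0 -> ent (dvs a z^-1).
Proof.
move=> z0 ha az T T0.
have T'0 : 0 <= Num.max T (3 * normc z) by rewrite le_max T0.
have [m hm] := ha _ T'0; exists (m / 2).
apply: (bnd_mono T0) (dvs_bnd z0 ha az _ hm); rewrite le_max lexx ?orbT//.
Qed.

Lemma ev_dvs a z s : z != 0 -> ent a -> ev a z = 0 ->
  ev a s = (1 - z^-1 * s) * ev (dvs a z^-1) s.
Proof.
move=> z0 ha az; rewrite -{1}(mulw_dvs a z^-1) ev_mulw ?mulw_dvs//.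
exact: dvs_ent.
Qed.

End LogDerivative.

(** * Counting the roots of polynomials with constant term 1 *)

Section RootCount.
Context (R : realType).
Local Notation C := R[i].
Implicit Types (a b l : nat -> C) (s z w : C) (T m : R) (ws : seq C).

Definition rprod ws : {poly C} := \prod_(w <- ws) (1 - w *: 'X).

Lemma coef_rfactor w (q : {poly C}) :
  (fun k => ((1 - w *: 'X) * q)`_k) = mulw (fun k => q`_k) w.
Proof.
apply/funext => k; rewrite mulrBl mul1r coefB -scalerAl coefZ coefXM /mulw.
by case: k => [|k] //=; rewrite mulr0.
Qed.

Lemma coef_rprod ws (q : {poly C}) :
  (fun k => (rprod ws * q)`_k) = mulws ws (fun k => q`_k).
Proof.
elim: ws => [|w ws IH] /=; first by rewrite /rprod big_nil; under eq_fun do rewrite mul1r.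
by rewrite /rprod big_cons -mulrA; rewrite coef_rfactor IH.
Qed.

Lemma rprod_large_factors T m ws (q : {poly C}) : 0 < T ->
  all (fun w => 3 <= normc w * T) ws -> q`_0 = 1 ->
  bnd (fun k => (rprod ws * q)`_k) T m -> 2 ^+ size ws <= m.
Proof.
move=> T0; elim: ws m => [|w ws IH] m /=.
  move=> _ q0 h; have := bnd_coef 0 (ltW T0) h.
  by rewrite /rprod big_nil mul1r q0 ComplexField.Normc.normc1 !expr0 mulr1.
move=> /andP[wT aws] q0; rewrite /rprod big_cons -mulrA -/(rprod ws) coef_rfactor => h.
have hq : bnd (fun k => (rprod ws * q)`_k) T (m / 2).
  (* An index beyond the degree makes the boundary term zero. *)
  apply: (bnd_divw T0 wT) => N; exists (maxn N (size (rprod ws * q))); first exact: leq_maxl.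
  by rewrite nth_default ?leq_maxr// ComplexField.Normc.normc0 mul0r add0r.
by have := IH _ aws q0 hq; rewrite exprS; lra.
Qed.

(* Dividing out a root of modulus at most [T / 3] halves the bound on [||.||_T]
   and keeps the constant term 1; this replaces Jensen's formula. *)
Lemma rprod_count T m ws : 0 < T -> bnd (fun k => (rprod ws)`_k) T m ->
  2 ^+ count (fun w => 3 <= normc w * T) ws <= m.
Proof.
move=> T0 h; pose P w := 3 <= normc w * T.
have e : rprod ws = rprod [seq w <- ws | P w] * rprod [seq w <- ws | ~~ P w].
  by rewrite /rprod !big_filter [LHS](bigID P).
rewrite -size_filter; apply: (@rprod_large_factors T m _ (rprod [seq w <- ws | ~~ P w])) => //.
- exact: filter_all.
- have := congr1 (@^~ 0%N) (coef_rprod [seq w <- ws | ~~ P w] 1).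
  by rewrite mulws0 mulr1 coef1.
- by rewrite -e.
Qed.

Lemma dyadic (x : R) : 0 < x -> x < 1 -> exists k, (2^-1) ^+ k.+1 <= x < (2^-1) ^+ k.
Proof.
move=> x0 x1; have ex : exists k, (2^-1) ^+ k <= x.
  have /rcvgP/(_ _ x0)[N hN] : ((2^-1 : R) ^+ n) @[n --> \oo] --> (0 : R).
    by apply: cvg_expr; rewrite ger0_norm ?invr_ge0// invf_lt1// ltr1n.
  exists N; have := hN N (leqnn _); rewrite subr0 ger0_norm; first exact: ltW.
  by rewrite exprn_ge0.
have [k hk kmin] := ex_minnP ex; case: k hk kmin => [|k] hk kmin.
  by move: hk; rewrite expr0 leNgt x1.
exists k; rewrite hk/= ltNge; apply/negP => /kmin; by rewrite ltnn.
Qed.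

(** An entry in the shell from 2^-(k+1) to 2^-k has square at most 4^-k. Counting every entry above
    the lower end of the shell overestimates, but this cumulative count is the one that
    [rprod_count] bounds. *)
Lemma dyadic_sum (xs : seq R) : all (fun x => (0 < x) && (x < 1)) xs ->
  exists K, \sum_(x <- xs) x ^+ 2 <=
    \sum_(k < K) (4^-1) ^+ k * (count (fun x => (2^-1) ^+ k.+1 <= x) xs)%:R.
Proof.
elim: xs => [|x xs IH] /=; first by exists 0%N; rewrite big_nil big_ord0.
move=> /andP[/andP[x0 x1] /IH[K hK]]; have [k /andP[h1 h2]] := dyadic x0 x1.
exists (maxn K k.+1); rewrite big_cons.
under [X in _ <= X]eq_bigr do rewrite natrD mulrDr; rewrite big_split/= lerD//.
- have kK : (k < maxn K k.+1)%N by rewrite leq_maxr.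
  rewrite (bigD1 (Ordinal kK))//= h1 mulr1 ler_wpDr//.
    by apply: sumr_ge0 => i _; rewrite mulr_ge0.
  have -> : (4^-1 : R) ^+ k = ((2^-1) ^+ k) ^+ 2.
    by rewrite exprAC; congr (_ ^+ _); field.
  by rewrite lerXn2r ?nnegrE ?(ltW x0) ?ltW.
- rewrite (le_trans hK)//.
  rewrite -(subnKC (leq_maxl K k.+1)) big_split_ord/= lerDl.
  by apply: sumr_ge0 => i _; rewrite mulr_ge0.
Qed.

(** At radius 6 * 2^(j+k) the condition |w| T >= 3 of [rprod_count] reads |w| 2^j >= 2^-(k+1), so at
    most c kappa^(j+k) / ln 2 of the w satisfy it. Weighting by 4^-k gives a geometric series of
    ratio kappa / 4 < 1, and undoing the scaling by 2^j divides by 4^j. *)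
Lemma sum_sqr_roots (c kappa : R) (j : nat) ws : 0 <= c -> 0 <= kappa -> kappa < 4 ->
  all (fun w => (0 < normc w * 2 ^+ j) && (normc w * 2 ^+ j < 1)) ws ->
  (forall k, bnd (fun i => (rprod ws)`_i) (6 * 2 ^+ (j + k)) (expR (c * kappa ^+ (j + k)))) ->
  \sum_(w <- ws) normc w ^+ 2 <= c / ln 2 / (1 - kappa / 4) * (kappa / 4) ^+ j.
Proof.
move=> c0 k0 k4 aw hb.
have ln2 : 0 < ln (2 : R) by rewrite ln_gt0// ltr1n.
have cnt k : (count (fun w => (2^-1) ^+ k.+1 <= normc w * 2 ^+ j) ws)%:R <= c * kappa ^+ (j + k) / ln 2.
  have T0 : (0 : R) < 6 * 2 ^+ (j + k) by rewrite mulr_gt0// exprn_gt0.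
  have := rprod_count T0 (hb k).
  rewrite (eq_count (a2 := fun w => (2^-1) ^+ k.+1 <= normc w * 2 ^+ j)); last first.
    move=> w; rewrite -[LHS](ler_pM2r (_ : 0 < (2^-1) ^+ k.+1 / 3)); last first.
      by rewrite divr_gt0 ?exprn_gt0.
    congr (_ <= _); first by field.
    have h2 : (2 : R) ^+ k != 0 by rewrite expf_neq0.
    by rewrite exprD exprS exprVn; field.
  move=> h; rewrite ler_pdivlMr// -ler_expR mulrC.
  have -> : expR (ln 2 * (count (fun w => (2^-1) ^+ k.+1 <= normc w * 2 ^+ j) ws)%:R) =
    2 ^+ (count (fun w => (2^-1) ^+ k.+1 <= normc w * 2 ^+ j) ws) :> R.
    by rewrite mulrC expRM_natl lnK// posrE.
  exact: h.
have aw' : all (fun x => (0 < x) && (x < 1)) [seq normc w * 2 ^+ j | w <- ws].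
  by rewrite all_map.
have [K hK] := dyadic_sum aw'; move: hK; rewrite big_map.
under eq_bigr do rewrite exprMn; rewrite -mulr_suml.
under [X in _ <= X -> _]eq_bigr do rewrite count_map/=.
move=> hK; have p4 : (0 : R) < (2 ^+ j) ^+ 2 by rewrite !exprn_gt0.
rewrite -(ler_pM2r p4) (le_trans hK)//.
apply: (@le_trans _ _ (\sum_(k < K) (c * kappa ^+ j / ln 2) * (kappa / 4) ^+ k)).
  apply: ler_sum => k _; rewrite (le_trans (ler_wpM2l _ (cnt k)))// exprD exprMn.
  by rewrite le_eqVlt; apply/orP; left; apply/eqP; ring.
rewrite -mulr_sumr.
have q0 : 0 <= kappa / 4 by rewrite divr_ge0.
have q1 : 0 < 1 - kappa / 4 by lra.
have geo : \sum_(k < K) (kappa / 4) ^+ k <= (1 - kappa / 4)^-1.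
  rewrite -[leRHS]mul1r ler_pdivlMr// mulrC.
  have -> : (1 - kappa / 4) * (\sum_(k < K) (kappa / 4) ^+ k) = 1 - (kappa / 4) ^+ K.
    elim: K {hK} => [|K IH]; first by rewrite big_ord0 mulr0 expr0 subrr.
    by rewrite big_ord_recr/= mulrDr IH exprS; ring.
  by rewrite gerBl exprn_ge0.
rewrite (le_trans (ler_wpM2l _ geo))//.
  by rewrite mulr_ge0 ?invr_ge0 ?(ltW ln2)// mulr_ge0 ?exprn_ge0.
rewrite le_eqVlt; apply/orP; left; apply/eqP.
have -> : (2 ^+ j) ^+ 2 = (4 : R) ^+ j by rewrite exprAC; congr (_ ^+ _); ring.
by rewrite exprMn exprVn; field; rewrite ?expf_neq0//= ?(gt_eqF ln2) ?andbT//; lra.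
Qed.

End RootCount.

(** * Entire functions of order less than 2 with the same zeros *)

Section SameZeros.
Context (R : realType).
Local Notation C := R[i].
Implicit Types (a b l : nat -> C) (s z w : C) (T m : R) (ws : seq C).

Lemma normc_ev_continuous a : ent a ->
  continuous (fun p : R * R => normc (ev a (p.1 +i* p.2)%C)).
Proof.
move=> ha p; apply/cvgrPdist_lt => e e0.
set z := (p.1 +i* p.2)%C.
have T1 : 1 <= normc z + 2 by have := normc_ge0 z; lra.
have [m hm] := ha (2 * (normc z + 2)) ltac:(lra).
have m0 := bnd_ge0 hm.
pose d : R := Num.min 1 (e / (2 * (m + 1))).
have d0 : 0 < d by rewrite /d lt_min ltr01 divr_gt0//; lra.
have d1 : d <= 1 by rewrite /d ge_min lexx.
have d2 : d <= e / (2 * (m + 1)) by rewrite /d ge_min lexx orbT.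
apply/(@nbhs_ballP R (R * R)%type); exists d => // q [/= q1 q2].
set y := (q.1 +i* q.2)%C.
have zy : normc (z - y) < 2 * d.
  rewrite (le_lt_trans (normc_le _))//=.
  by move: q1 q2; rewrite /ball/= => q1 q2; lra.
have hy : normc y <= normc z + 2.
  by have := normc_lerB y z; rewrite normcB; lra.
have hz : normc z <= normc z + 2 by lra.
have := ev_lipschitz T1 hm hz hy => L.
have L' : normc (z - y) * m <= 2 * d * m by apply: ler_wpM2r => //; exact: ltW.
have L2 : 2 * d * m < e.
  have : d * (2 * (m + 1)) <= e by rewrite -ler_pdivlMr//; lra.
  nra.
have h3 := le_lt_trans (le_trans L L') L2.
change (`|normc (ev a z) - normc (ev a y)| < e).
by rewrite (le_lt_trans _ h3)// ler_norml normc_lerB andbT lerNl opprB normcB normc_lerB.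
Qed.

(** The minimum is taken over a square in R x R, a product of compact segments: it contains the disc
    of radius r and lies in the disc of radius 2 r. *)
Lemma ev_min_modulus a (r : R) : 0 <= r -> ent a ->
  (forall z, normc z <= 2 * r -> ev a z != 0) ->
  exists2 c : R, 0 < c & forall z, normc z <= r -> c <= normc (ev a z).
Proof.
move=> r0 ha hz.
pose A : set (R * R) := `[- r, r]%classic `*` `[- r, r]%classic.
have cA : compact A by apply: compact_setX; exact: segment_compact.
have A0 : A !=set0 by exists (0, 0); split => /=; rewrite in_itv/= oppr_le0 r0.
have cf := @continuous_subspaceT _ _ A _ (normc_ev_continuous ha).
have [c Ac hc] := compact_EVT_min A0 cA cf.
exists (normc (ev a (c.1 +i* c.2)%C)).
  rewrite normc_gt0; apply: hz; apply: le_trans (normc_le _) _.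
  have [h1 h2] := set_mem Ac.
  by rewrite mulr_natl mulr2n; apply: lerD; rewrite ler_norml; [exact: h1|exact: h2].
move=> [x y] hxy; apply: (hc (x, y)).
have := le_trans (normc_Re _) hxy; have := le_trans (normc_Im _) hxy.
by rewrite /= !ler_norml => h1 h2; apply/mem_set; split.
Qed.

Lemma poly_rprod (p : {poly C}) : p`_0 = 1 ->
  exists2 ws, p = rprod ws & forall w, w \in ws -> w != 0 /\ p.[w^-1] = 0.
Proof.
move=> p0; have [rs hrs] := closed_field_poly_normal p.
have pn : p != 0 by apply: contraTneq (oner_neq0 C) => p0'; rewrite -p0 p0' coef0 eqxx.
have ln : lead_coef p != 0 by rewrite lead_coef_eq0.
have rt z : z \in rs -> p.[z] = 0.
  move=> zrs; rewrite hrs hornerZ horner_prod; apply/eqP.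
  rewrite mulf_eq0 (negbTE ln)/= prodf_seq_eq0; apply/hasP; exists z => //=.
  by rewrite !hornerE subrr.
have rn z : z \in rs -> z != 0.
  move=> zrs; apply/eqP => z0; have := rt z zrs.
  by rewrite z0 horner_coef0 p0 => /eqP; rewrite oner_eq0.
exists [seq z^-1 | z <- rs]; last first.
  move=> w /mapP[z zrs ->]; split; first by rewrite invr_eq0 rn.
  by rewrite invrK rt.
(* Each X - z is -z (1 - X / z), with z nonzero because the constant term is 1; the same
   normalization then forces the scalar to be 1. *)
have e : p = (lead_coef p * \prod_(z <- rs) (- z)) *: rprod [seq z^-1 | z <- rs].
  rewrite {1}hrs -scalerA; congr (_ *: _); rewrite /rprod big_map.
  rewrite -mul_polyC rmorph_prod -big_split/=; apply: eq_big_seq => z zrs.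
  rewrite mul_polyC scalerBr scalerA mulNr divff ?rn// scaleN1r opprK addrC.
  by rewrite alg_polyC polyCN.
have r0 : (rprod [seq z^-1 | z <- rs])`_0 = 1.
  have := congr1 (@^~ 0%N) (coef_rprod [seq z^-1 | z <- rs] 1).
  by rewrite mulws0 mulr1 coef1.
by move: p0; rewrite e coefZ r0 mulr1 => ->; rewrite scale1r.
Qed.

(* The zeros of a long truncation of a zero-free series all lie outside the
   disc, and low-order coefficients of the logarithmic derivative are power sums
   of their inverses. *)
Lemma zero_free_log_deriv (c kappa : R) (j N n : nat) a l :
  0 <= c -> 0 <= kappa -> kappa < 4 -> a 0%N = 1 -> ent a ->
  (forall k, bnd a (6 * 2 ^+ (j + k)) (expR (c * kappa ^+ (j + k)))) ->
  (forall z, normc z <= 2 * 2 ^+ j -> ev a z != 0) ->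
  log_deriv N a l -> (0 < n)%N -> (n < N)%N ->
  normc (l n) <= c / ln 2 / (1 - kappa / 4) * (kappa / 4) ^+ j.
Proof.
move=> c0 k0 k4 a0 ha hb hz hl n0 nN.
have j0 : (0 : R) <= 2 ^+ j by rewrite exprn_ge0.
have j1 : (1 : R) <= 2 ^+ j by rewrite exprn_ege1// ler1n.
have [e e0 he] := ev_min_modulus j0 ha hz.
have [m hm] := ha _ j0.
have e2 : 0 < e / 2 by rewrite divr_gt0.
have [M0 hM0] := apsum_tail j0 hm e2.
(* Beyond [M0] the tail of the series on the disc of radius 2^j is below half of the minimum modulus
   [e], so the truncation has no zero there. Exceeding N keeps the coefficients that determine [l]
   up to order N. *)
pose M := maxn M0 N.+1.
pose p : {poly C} := \poly_(i < M) a i.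
have pE i : p`_i = if (i < M)%N then a i else 0 by rewrite coef_poly.
have NM : (N < M)%N by rewrite leq_maxr.
have p0 : p`_0 = 1 by rewrite pE (leq_trans _ NM).
have [ws pws hws] := poly_rprod p0.
have psumE z : p.[z] = psum a z M by rewrite horner_poly.
have wsmall w : w \in ws -> (0 < normc w * 2 ^+ j) && (normc w * 2 ^+ j < 1).
  move=> /hws[w0 pw]; have nw : 0 < normc w by rewrite normc_gt0.
  rewrite mulr_gt0 ?exprn_gt0//= ltNge; apply/negP => hw.
  have zj : normc w^-1 <= 2 ^+ j.
    by rewrite ComplexField.Normc.normcV -[leLHS]mul1r ler_pdivrMr// mulrC.
  have := he _ zj; apply/negP; rewrite -ltNge.
  have hm' : bnd a (normc w^-1) m by apply: bnd_mono hm => //; exact: normc_ge0.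
  have evl := ent_ccvg w^-1 ha.
  have hd : ccvg (fun n => psum a w^-1 (M + n) - psum a w^-1 M) (ev a w^-1 - psum a w^-1 M).
    apply: ccvgB (ccvg_cst _); move/ccvg_normP : evl => H; apply/ccvg_normP => d d0.
    by have [N' hN'] := H d d0; exists N' => k Nk; apply: hN'; rewrite (leq_trans Nk)// leq_addl.
  have : normc (ev a w^-1 - psum a w^-1 M) <= e / 2.
    apply: ccvg_le hd _ => k; rewrite (le_trans (psum_diff _ _ (leq_addr _ _)))//.
    apply: le_trans (ltW (hM0 (M + k)%N M (leq_maxl _ _))).
    rewrite /apsum !big_split_ord/= !(addrAC _ _ (- _)) !subrr !add0r.
    apply: ler_sum => i _; apply: ler_wpM2l; first exact: normc_ge0.
    by rewrite lerXn2r// nnegrE normc_ge0.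
  by rewrite -psumE pw subr0 => h; rewrite (le_lt_trans h)//; lra.
have hlp : log_deriv N (fun k => p`_k) (fun k => - \sum_(w <- ws) w ^+ k.+1).
  have h1 : log_deriv N (fun k => (1 : {poly C})`_k) (fun=> 0).
    move=> k kN; rewrite coef1 mul0rn /conv big1// => i _; exact: mulr0.
  have := log_deriv_mulws ws h1; rewrite -coef_rprod mulr1 -pws.
  move=> h k kN; rewrite -(h k kN); apply: eq_bigr => i _; by rewrite sub0r.
have hla : log_deriv N (fun k => p`_k) l.
  move=> k kN; have kM : (k.+1 < M)%N by exact: leq_ltn_trans NM.
  rewrite pE kM -hl//; apply: eq_bigr => i _; rewrite pE ifT//.
  by rewrite (leq_ltn_trans _ kM)// leqW// -ltnS.
rewrite (log_deriv_uniq p0 hla hlp nN) normcN (le_trans (normc_sum _ _ _))//.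
(* Here n >= 1 is used: the exponent n + 1 is at least 2 and |w| <= 1, so each term is at most
   |w|^2. *)
apply: (@le_trans _ _ (\sum_(w <- ws) normc w ^+ 2)).
  rewrite big_seq [leRHS]big_seq; apply: ler_sum => w /wsmall/andP[w0 w1].
  rewrite normcX; have w1' : normc w <= 1.
    by rewrite (le_trans _ (ltW w1))// ler_peMr// normc_ge0.
  by rewrite ler_wiXn2l// normc_ge0.
apply: sum_sqr_roots => //; first by apply/allP.
move=> k K; rewrite -pws (le_trans _ (hb k (minn K M)))//.
have T0 : (0 : R) <= 6 * 2 ^+ (j + k) by rewrite mulr_ge0// exprn_ge0.
have [KM|MK] := leqP K M.
  apply: ler_sum => i _; rewrite pE ifT// (leq_trans (ltn_ord i))//.
rewrite -(subnKC (ltnW MK)) /apsum big_split_ord/= [X in _ + X]big1 ?addr0.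
  by apply: ler_sum => i _; rewrite pE ltn_ord.
by move=> i _; rewrite pE ltnNge leq_addr [X in normc X]/= ComplexField.Normc.normc0 mul0r.
Qed.

(* [f] and [g] have the same zeros with the same multiplicities: at each point
   some [g / f] and some [f / g] agrees with a quotient of continuous functions
   with nonvanishing denominator. *)
Definition same_zeros (f g : C -> C) := forall z,
  (exists u v, [/\ ccont u, ccont v, forall s, u s * g s = v s * f s & u z != 0]) /\
  (exists u v, [/\ ccont u, ccont v, forall s, u s * g s = v s * f s & v z != 0]).

Lemma same_zerosP f g z : same_zeros f g -> f z = 0 <-> g z = 0.
Proof.
move=> h; have [[u [v [_ _ h1 h2]]] [u' [v' [_ _ h3 h4]]]] := h z; split=> e.
- by have /eqP := h1 z; rewrite e mulr0 mulf_eq0 (negbTE h2) => /eqP.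
- by have /esym/eqP := h3 z; rewrite e mulr0 mulf_eq0 (negbTE h4) => /eqP.
Qed.

(** Away from 1 / w the factor cancels from the relation between f and g. At 1 / w the relation is
    recovered by continuity along a sequence, which is why [same_zeros] asks for continuous
    cofactors. *)
Lemma same_zeros_div f g w : ccont f -> ccont g ->
  same_zeros (fun s => (1 - w * s) * f s) (fun s => (1 - w * s) * g s) ->
  same_zeros f g.
Proof.
move=> cf cg h.
have H u v : ccont u -> ccont v ->
    (forall s, u s * ((1 - w * s) * g s) = v s * ((1 - w * s) * f s)) ->
    forall s, u s * g s = v s * f s.
  move=> cu cv huv s; have [ws|ws] := eqVneq (w * s) 1; last first.
    have n0 : 1 - w * s != 0 by rewrite subr_eq0 eq_sym.
    by apply: (mulfI n0); rewrite mulrCA huv mulrCA.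
  have w0 : w != 0 by apply: contra_eq_neq ws => ->; rewrite mul0r eq_sym oner_eq0.
  pose x n : C := s + w^-1 * ((n.+1%:R)^-1 : R)%:C%C.
  have xs : ccvg x s.
    rewrite -[X in ccvg _ X]addr0; apply: ccvgD; first exact: ccvg_cst.
    rewrite -[X in ccvg _ X](mulr0 w^-1); apply: ccvgM; first exact: ccvg_cst.
    by split => /=; [exact: cvg_harmonic|exact: cvg_cst].
  have e n : u (x n) * g (x n) = v (x n) * f (x n).
    have n0 : 1 - w * x n != 0.
      rewrite /x mulrDr ws mulrA divff// mul1r opprD addrA subrr add0r oppr_eq0.
      by rewrite -normc_eq0 normc_real normr_eq0 invr_eq0 pnatr_eq0.
    by apply: (mulfI n0); rewrite mulrCA huv mulrCA.
  apply: (@ccvg_uniq _ (fun n => u (x n) * g (x n))); first exact: ccvgM (cu _ _ xs) (cg _ _ xs).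
  by rewrite (funext e); exact: ccvgM (cv _ _ xs) (cf _ _ xs).
move=> z; have [[u [v [cu cv h1 h2]]] [u' [v' [cu' cv' h3 h4]]]] := h z; split.
- by exists u, v; split => //; exact: H.
- by exists u', v'; split => //; exact: H.
Qed.

(** The induction is on the number k of divisions still allowed. Each one halves the bound at radius
    3 r while the constant term stays 1, so that bound never drops below 1 and fewer than k
    divisions exhaust the zeros. At radii T >= 3 r no bound gets worse, so the growth hypotheses
    pass to the quotients. *)
Lemma divide_common_zeros (r : R) f g (k : nat) (m : R) :
  0 < r -> f 0%N = 1 -> g 0%N = 1 -> ent f -> ent g ->
  same_zeros (ev f) (ev g) -> bnd f (3 * r) m -> m < 2 ^+ k ->
  exists ws F G,
    [/\ f = mulws ws F, g = mulws ws G,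
        [/\ F 0%N = 1, G 0%N = 1, ent F & ent G],
        (forall z, normc z <= r -> ev F z != 0) /\ (forall z, normc z <= r -> ev G z != 0) &
        forall T m', 3 * r <= T -> (bnd f T m' -> bnd F T m') /\ (bnd g T m' -> bnd G T m')].
Proof.
move=> r0; elim: k f g m => [|k IH] f g m f0 g0 hf hg hz hb hm.
  have := bnd_coef 0 _ hb; rewrite f0 ComplexField.Normc.normc1 expr0 mulr1.
  by move=> /(_ ltac:(lra)); rewrite expr0 in hm; lra.
have [[z zr fz]|nz] := pselect (exists2 z, normc z <= r & ev f z = 0); last first.
  exists [::], f, g; split => //; split => z zr; apply/eqP => e; apply: nz; exists z => //.
  by apply/(same_zerosP z hz).
have gz : ev g z = 0 by apply/(same_zerosP z hz).
have z0 : z != 0.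
  by apply/eqP => z0; move/eqP: fz; rewrite z0 ev0// f0 oner_eq0.
have ef := dvs_ent z0 hf fz; have eg := dvs_ent z0 hg gz.
have zr3 : 3 * normc z <= 3 * r by lra.
have hz' : same_zeros (ev (dvs f z^-1)) (ev (dvs g z^-1)).
  apply: (@same_zeros_div _ _ z^-1); [exact: ccont_ev|exact: ccont_ev|].
  by rewrite (funext (fun s => esym (ev_dvs s z0 hf fz))) (funext (fun s => esym (ev_dvs s z0 hg gz))).
have df0 : dvs f z^-1 0%N = 1 by rewrite dvs0.
have dg0 : dvs g z^-1 0%N = 1 by rewrite dvs0.
have m2 : m / 2 < 2 ^+ k by rewrite exprS in hm; lra.
have [ws [F [G [hF hG [F0 G0 eF eG] nF hT]]]] :=
  IH _ _ _ df0 dg0 ef eg hz' (dvs_bnd z0 hf fz zr3 hb) m2.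
exists (z^-1 :: ws), F, G; split => //=.
- by rewrite -hF mulw_dvs.
- by rewrite -hG mulw_dvs.
- move=> T m' rT; have [h1 h2] := hT T m' rT; have zT := le_trans zr3 rT.
  by split => h; [apply: h1; have := dvs_bnd z0 hf fz zT h|apply: h2; have := dvs_bnd z0 hg gz zT h];
    move=> h' N; rewrite (le_trans (h' N))//; have := bnd_ge0 h; lra.
Qed.

(* Divide out the common zeros in a large disc: by [zero_free_log_deriv], beyond
   the first coefficient the logarithmic derivatives of what remains are as small
   as desired, and those of the common factors cancel. *)
Lemma same_zeros_eq (c kappa : R) f g :
  0 <= c -> 0 <= kappa -> kappa < 4 ->
  f 0%N = 1 -> g 0%N = 1 -> f 1%N = g 1%N -> ent f -> ent g ->
  (forall k, bnd f (6 * 2 ^+ k) (expR (c * kappa ^+ k))) ->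
  (forall k, bnd g (6 * 2 ^+ k) (expR (c * kappa ^+ k))) ->
  same_zeros (ev f) (ev g) -> f = g.
Proof.
move=> c0 k0 k4 f0 g0 fg1 hf hg bf bg hz; apply/funext => N.
have [l hl] := log_deriv_ex N f0; have [l' hl'] := log_deriv_ex N g0.
suff ll n : (n < N)%N -> l n = l' n.
  apply: (@log_deriv_inj _ N f g l) => //; first by rewrite f0.
  move=> n nN; rewrite -hl'//; apply: eq_bigr => i _; rewrite ll//.
  by rewrite (leq_ltn_trans (leq_subr _ _)).
(* Index 0 is the first Taylor coefficient, equal by hypothesis; the decay estimate covers the other
   indices only. *)
case: n => [|n] nN.
  have := hl _ nN; have := hl' _ nN; rewrite /conv !big_ord1 f0 g0 !mul1r !mulr1n.
  by move=> -> ->.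
pose K := c / ln 2 / (1 - kappa / 4).
have key j : normc (l n.+1 - l' n.+1) <= (K + K) * (kappa / 4) ^+ j.
  (* Radius 2 * 2^j is where [zero_free_log_deriv] wants no zeros, and three times it is the radius
     6 * 2^j of the growth bounds. *)
  have r0 : (0 : R) < 2 * 2 ^+ j by rewrite mulr_gt0// exprn_gt0.
  have e6 : (3 : R) * (2 * 2 ^+ j) = 6 * 2 ^+ j by ring.
  have bfj : bnd f (3 * (2 * 2 ^+ j)) (expR (c * kappa ^+ j)) by rewrite e6.
  have [k hk] : exists k, expR (c * kappa ^+ j) < 2 ^+ k :> R.
    have [k hk] : exists k : nat, c * kappa ^+ j / ln 2 < k%:R.
      by exists (Num.truncn (c * kappa ^+ j / ln 2)).+1; exact: truncnS_gt.
    have ln2 : 0 < ln (2 : R) by rewrite ln_gt0// ltr1n.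
    exists k; rewrite -[X in _ < X ^+ _](@lnK _ 2) ?posrE// -expRM_natr ltr_expR [ltRHS]mulrC.
    by rewrite -ltr_pdivrMr.
  have [ws [F [G [hF hG [F0 G0 eF eG] [nF nG] hT]]]] :=
    divide_common_zeros r0 f0 g0 hf hg hz bfj hk.
  have [x hx] := log_deriv_ex N F0; have [y hy] := log_deriv_ex N G0.
  (* The power sums of the common factors [ws] appear in both logarithmic derivatives and cancel in
     the difference. *)
  have := log_deriv_mulws ws hx; rewrite -hF => /(log_deriv_uniq f0 hl) ->//.
  have := log_deriv_mulws ws hy; rewrite -hG => /(log_deriv_uniq g0 hl') ->//.
  rewrite opprB addrA subrK mulrDl (le_trans (le_normcD _ _))// normcN.
  have T6 i : 3 * (2 * 2 ^+ j) <= 6 * 2 ^+ (j + i) :> R.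
    by rewrite e6 ler_pM2l// ler_weXn2l ?leq_addr// ler1n.
  apply: lerD.
  - apply: (zero_free_log_deriv c0 k0 k4 F0 eF _ nF hx) => // i.
    by have [h _] := hT _ (expR (c * kappa ^+ (j + i))) (T6 i); exact: h.
  - apply: (zero_free_log_deriv c0 k0 k4 G0 eG _ nG hy) => // i.
    by have [_ h] := hT _ (expR (c * kappa ^+ (j + i))) (T6 i); exact: h.
apply/eqP; rewrite -subr_eq0 -normc_eq0 eq_le normc_ge0 andbT.
have hlim : (K + K) * (kappa / 4) ^+ j @[j --> \oo] --> (K + K) * 0.
  apply: cvgM; first exact: cvg_cst.
  by apply: cvg_expr; rewrite ger0_norm ?divr_ge0//; lra.
by rewrite -(mulr0 (K + K)); apply: (cvgr_to_ge hlim); exact: nearW.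
Qed.

End SameZeros.

(** * Fourier uniqueness *)

Section BoundedMeasurable.
Context (R : realType) (d : measure_display) (T : measurableType d).
Implicit Types (f g h : T -> R) (P Q : probability T R).

Definition bmf f := measurable_fun setT f /\ exists M : R, forall x, `|f x| <= M.

Lemma bmf_integrable P f : bmf f -> P.-integrable setT (EFin \o f).
Proof.
move=> [mf [M hM]]; apply: measurable_bounded_integrable => //.
  by rewrite (le_lt_trans (probability_le1 P measurableT))// ltry.
by exists M; split; [exact: num_real|move=> x Mx y _; exact: le_trans (hM y) (ltW Mx)].
Qed.

Lemma bmf_cst (c : R) : bmf (cst c).
Proof. by split; [exact: measurable_cst|exists `|c|]. Qed.

Lemma bmfD f g : bmf f -> bmf g -> bmf (fun x => f x + g x).
Proof.
move=> [mf [M hM]] [mg [N hN]]; split; first exact: measurable_funD.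
by exists (M + N) => x; rewrite (le_trans (ler_normD _ _))// lerD.
Qed.

Lemma bmfM f g : bmf f -> bmf g -> bmf (fun x => f x * g x).
Proof.
move=> [mf [M hM]] [mg [N hN]]; split; first exact: measurable_funM.
by exists (M * N) => x; rewrite normrM ler_pM.
Qed.

Lemma bmf_cos f : measurable_fun setT f -> bmf (fun x => cos (f x)).
Proof.
move=> mf; split; last by exists 1 => x; exact: cos_max.
by apply: measurableT_comp => //; apply: continuous_measurable_fun; exact: continuous_cos.
Qed.

Lemma Rintegral_dominated_cvg P (F : nat -> T -> R) f g :
  (forall n, measurable_fun setT (F n)) -> (forall n x, `|F n x| <= g x) ->
  P.-integrable setT (EFin \o g) -> (forall x, F n x @[n --> \oo] --> f x) ->
  P.-integrable setT (EFin \o f) /\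
  (\int[P]_x F n x) @[n --> \oo] --> \int[P]_x f x.
Proof.
move=> mF bF ig cF.
have mf : measurable_fun setT f by apply: (measurable_fun_cvg mF) => x _; exact: cF.
have [|||||fi _ h] := @dominated_convergence _ T R P setT measurableT
  (fun n => EFin \o F n) (EFin \o f) (EFin \o g).
- by move=> n; exact/measurable_EFinP.
- exact/measurable_EFinP.
- by apply: aeW => x _; apply: cvg_EFin; [exact: nearW|exact: cF].
- by [].
- by apply: aeW => x n _ /=; rewrite lee_fin.
split=> //.
have fn : (\int[P]_x (EFin \o f) x)%E \is a fin_num by exact: integrable_fin_num.
rewrite -(fineK fn) in h; exact: fine_cvg h.
Qed.

Lemma Rintegral_bounded_cvg P (F : nat -> T -> R) f (M : R) :
  (forall n, measurable_fun setT (F n)) -> (forall n x, `|F n x| <= M) ->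
  (forall x, F n x @[n --> \oo] --> f x) ->
  (\int[P]_x F n x) @[n --> \oo] --> \int[P]_x f x.
Proof.
move=> mF bF cF.
have iM : P.-integrable setT (EFin \o cst M) by apply: bmf_integrable; exact: bmf_cst.
by have [] := Rintegral_dominated_cvg mF bF iM cF.
Qed.

End BoundedMeasurable.

Definition lower_boxes (R : realType) (T : Type) (n : nat) (X : 'I_n -> T -> R) :
    set (set T) :=
  [set A | exists a : 'I_n -> R, A = [set x | forall i, X i x < a i]].

Section FourierUniqueness.
Context (R : realType) (d : measure_display) (T : measurableType d) (n : nat).
Context (X : 'I_n -> T -> R) (mX : forall i, measurable_fun setT (X i)).
Context (P Q : probability T R).

Definition lform (t : 'I_n -> R) (x : T) : R := \sum_i t i * X i x.

Lemma measurable_lform t : measurable_fun setT (lform t).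
Proof. by apply: measurable_sum => i; apply: measurable_funM. Qed.

(** The phase [c] covers sines and makes the condition stable under the product-to-sum formula. *)
Definition trig_test (h : T -> R) := bmf h /\ forall t c,
  \int[P]_x (h x * cos (lform t x + c)) = \int[Q]_x (h x * cos (lform t x + c)).

(* Closed under products, so that trigonometric polynomials need no explicit
   description. *)
Definition trig_mul (p : T -> R) := forall h, trig_test h -> trig_test (fun x => p x * h x).

Lemma bmf_trig t c : bmf (fun x => cos (lform t x + c)).
Proof. by apply: bmf_cos; apply: measurable_funD => //; exact: measurable_lform. Qed.

Lemma trig_testD h k : trig_test h -> trig_test k -> trig_test (fun x => h x + k x).
Proof.
move=> [bh hh] [bk hk]; split; first exact: bmfD.
move=> t c; under eq_Rintegral do rewrite mulrDl.
under [RHS]eq_Rintegral do rewrite mulrDl.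
by rewrite !RintegralD// ?hh ?hk//; apply: bmf_integrable; apply: bmfM => //; exact: bmf_trig.
Qed.

Lemma trig_mul_cst a : trig_mul (cst a).
Proof.
move=> h [bh hh]; split; first by apply: bmfM => //; exact: bmf_cst.
move=> t c; under eq_Rintegral do rewrite -mulrA.
under [RHS]eq_Rintegral do rewrite -mulrA.
by rewrite !RintegralZl// ?hh//; apply: bmf_integrable; apply: bmfM => //; exact: bmf_trig.
Qed.

Lemma trig_mulD p q : trig_mul p -> trig_mul q -> trig_mul (fun x => p x + q x).
Proof.
move=> hp hq h hh; have := trig_testD (hp h hh) (hq h hh).
by congr trig_test; apply/funext => x; rewrite mulrDl.
Qed.

Lemma trig_mulM p q : trig_mul p -> trig_mul q -> trig_mul (fun x => p x * q x).
Proof.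
move=> hp hq h hh; have := hp _ (hq h hh).
by congr trig_test; apply/funext => x; rewrite mulrA.
Qed.

Lemma trig_mul_cos t c : trig_mul (fun x => cos (lform t x + c)).
Proof.
move=> h [bh hh]; split; first by apply: bmfM => //; exact: bmf_trig.
move=> t' c'.
have lD x : lform (fun i => t' i + t i) x = lform t' x + lform t x.
  by rewrite /lform -big_split; apply: eq_bigr => i _; rewrite mulrDl.
have lB x : lform (fun i => t' i - t i) x = lform t' x - lform t x.
  by rewrite /lform -sumrB; apply: eq_bigr => i _; rewrite mulrBl.
have e x : cos (lform t x + c) * h x * cos (lform t' x + c') =
    2^-1 * (h x * cos (lform (fun i => t' i + t i) x + (c' + c)) +
            h x * cos (lform (fun i => t' i - t i) x + (c' - c))).
  rewrite lD lB; set u := lform t x; set w := lform t' x.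
  rewrite (_ : w + u + (c' + c) = (w + c') + (u + c)); last by ring.
  rewrite (_ : w - u + (c' - c) = (w + c') - (u + c)); last by ring.
  rewrite (cosD (w + c')) (cosB (w + c')); by field.
under eq_Rintegral do rewrite e.
under [RHS]eq_Rintegral do rewrite e.
have b t0 c0 : bmf (fun x => h x * cos (lform t0 x + c0)).
  by apply: bmfM => //; exact: bmf_trig.
rewrite !RintegralZl//; [|by apply: bmf_integrable; apply: bmfD..].
by congr (_ * _); rewrite !RintegralD// ?hh//; apply: bmf_integrable.
Qed.

Lemma trig_mulX p k : trig_mul p -> trig_mul (fun x => p x ^+ k).
Proof.
move=> hp; elim: k => [|k IH]; first exact: (trig_mul_cst 1).
by under eq_fun do rewrite exprS; exact: trig_mulM.
Qed.

Lemma trig_mul_prod (p : 'I_n -> T -> R) : (forall i, trig_mul (p i)) ->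
  trig_mul (fun x => \prod_i p i x).
Proof.
move=> hp; rewrite -fct_prodE.
elim/big_ind: _ => [|f g hf hg|i _]; [exact: (trig_mul_cst 1)|exact: trig_mulM|exact: hp].
Qed.

Lemma trig_mul_sin t c : trig_mul (fun x => sin (lform t x + c)).
Proof.
have := @trig_mul_cos t (c - pi / 2); congr trig_mul.
by apply/funext => x; rewrite addrA cosBpihalf.
Qed.

Lemma bernoulli_ineq (h : R) k : 0 <= h -> 1 + k%:R * h <= (1 + h) ^+ k.
Proof.
move=> h0; elim: k => [|k IH]; first by rewrite mul0r addr0 expr0.
rewrite exprS (le_trans _ (ler_wpM2l _ IH))//; last by lra.
by rewrite -natr1; have := mulr_ge0 (ler0n R k) (mulr_ge0 h0 h0); lra.
Qed.

(** Below 1/2, Bernoulli's inequality bounds the power from below by 1 - k (2 u)^k. From 1/2 on, (1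
    - x)(1 + x) <= 1 with x = 2^-k bounds it by 1 / (k + 1). The factor k in the exponent decides
    the case u = 1/2: with 2^k alone the limit there would be 1/e instead of 0. *)
Lemma sharp_threshold (u : R) : 0 <= u -> u <= 1 ->
  (1 - u ^+ k) ^+ (k * 2 ^ k) @[k --> \oo] --> ((u < 2^-1)%R%:R : R).
Proof.
move=> u0 u1.
have uk k : 0 <= 1 - u ^+ k by rewrite subr_ge0 exprn_ile1.
have uk1 k : 1 - u ^+ k <= 1 by rewrite gerBl exprn_ge0.
have [u2|u2] := ltP u 2^-1.
(* The mean of 1 and 2 u satisfies 2 u <= s^2 and s < 1, so (2 u)^k <= s^k s^k. One factor s^k
   absorbs k, by Bernoulli applied to 1 / s = 1 + h, and the other tends to 0. *)
- pose s := (1 + 2 * u) / 2; pose h := s^-1 - 1.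
  have s0 : 0 < s by rewrite /s; lra.
  have s1 : s < 1 by rewrite /s; lra.
  have h0 : 0 < h by rewrite /h subr_gt0 invf_gt1.
  have us : 2 * u <= s ^+ 2.
    have := sqr_ge0 (1 - 2 * u); rewrite /s expr_div_n !expr2; lra.
  have hs k : k%:R * (2 * u) ^+ k <= s ^+ k / h.
    rewrite ler_pdivlMr//.
    have e1 : (2 * u) ^+ k <= s ^+ k * s ^+ k.
      rewrite -exprMn -expr2; apply: lerXn2r => //; rewrite nnegrE; [exact: mulr_ge0|exact: sqr_ge0].
    have e2 : k%:R * h * s ^+ k <= 1.
      have h1 : 1 + h = s^-1 by rewrite /h addrC subrK.
      have := bernoulli_ineq k (ltW h0); rewrite h1 => b.
      rewrite -ler_pdivlMr ?exprn_gt0// mul1r -exprVn (le_trans _ b)//; lra.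
    have sk : 0 <= s ^+ k by rewrite exprn_ge0// ltW.
    have kh : 0 <= k%:R * h by rewrite mulr_ge0// ltW.
    apply: (@le_trans _ _ (k%:R * h * (s ^+ k * s ^+ k))).
      by rewrite [leLHS]mulrAC; apply: ler_wpM2l.
    by rewrite mulrA ler_piMl.
  have hl k : 1 - s ^+ k / h <= (1 - u ^+ k) ^+ (k * 2 ^ k).
    have B (x : R) m : 0 <= x -> x <= 1 -> 1 - m%:R * x <= (1 - x) ^+ m.
      move=> x0 x1; elim: m => [|m IH]; first by rewrite mul0r subr0 expr0.
      have x1' : 0 <= 1 - x by lra.
      rewrite exprS (le_trans _ (ler_wpM2l x1' IH))// -natr1.
      by have := mulr_ge0 (ler0n R m) (mulr_ge0 x0 x0); lra.
    apply: le_trans (B (u ^+ k) (k * 2 ^ k)%N _ _); [|exact: exprn_ge0|exact: exprn_ile1].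
    by rewrite lerD2l lerN2 natrM natrX -mulrA -exprMn.
  apply: (@squeeze_cvgr _ _ _ _ (fun k => 1 - s ^+ k / h) (fun=> 1)).
  + by apply: nearW => k; rewrite hl exprn_ile1.
  + rewrite -[X in _ --> X]subr0; apply: cvgB; first exact: cvg_cst.
    rewrite -[X in _ --> X](mul0r h^-1); apply: cvgM; last exact: cvg_cst.
    by apply: cvg_expr; rewrite ger0_norm// ltW.
  + exact: cvg_cst.
- apply: (@squeeze_cvgr _ _ _ _ (fun=> 0) (fun k => k.+1%:R^-1)).
  + apply: nearW => k; rewrite exprn_ge0//=.
    have e1 : 1 - u ^+ k <= 1 - (2^-1) ^+ k by rewrite lerD2l lerN2 lerXn2r// nnegrE.
    have e2 : (1 - u ^+ k) ^+ (k * 2 ^ k) <= (1 - (2^-1) ^+ k) ^+ (k * 2 ^ k).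
      by rewrite lerXn2r// nnegrE//; exact: le_trans e1.
    rewrite (le_trans e2)// -[leRHS]mul1r ler_pdivlMr//.
    set x : R := (2^-1) ^+ k.
    have x0 : 0 <= x by rewrite exprn_ge0.
    have x1 : x <= 1 by rewrite exprn_ile1// invf_le1// ler1n.
    have b : k.+1%:R <= (1 + x) ^+ (k * 2 ^ k).
      have := bernoulli_ineq (k * 2 ^ k) x0.
      by rewrite natrM natrX /x exprVn mulfK ?expf_neq0// addrC natr1.
    have c0 : 0 <= (1 - x) ^+ (k * 2 ^ k) by rewrite exprn_ge0// subr_ge0.
    rewrite (le_trans (ler_wpM2l c0 b))// -exprMn exprn_ile1//; nra.
  + exact: cvg_cst.
  + exact: cvg_harmonic.
Qed.

(** Once k + 1 > |y| the argument lies in (-pi, pi), where sine has the sign of its argument; slow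
    frequencies thus remove the periodicity. *)
Lemma sin_sign_scaled (y : R) :
  ((sin (y / k.+1%:R) < 0)%R%:R : R) @[k --> \oo] --> ((y < 0)%R%:R : R).
Proof.
have [N hN] : exists N, forall k, (N <= k)%N -> (sin (y / k.+1%:R) < 0) = (y < 0).
  exists (Num.truncn `|y|) => k kN.
  have k0 : 0 < k.+1%:R :> R by [].
  have yk : `|y| < k.+1%:R by rewrite (lt_le_trans (truncnS_gt _))// ler_nat.
  have ypi : `|y / k.+1%:R| < pi.
    rewrite normrM normfV (ger0_norm (ltW k0)) ltr_pdivrMr//.
    by rewrite (lt_le_trans yk)// ler_peMl// (le_trans _ (pi_ge2 R))// ler1n.
  have [y0|y0|->] := ltgtP y 0; last by rewrite mul0r sin0 ltxx.
  - rewrite -oppr_gt0 -sinN sin_gt0_pi// -mulNr divr_gt0 ?oppr_gt0//=.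
    by rewrite mulNr (le_lt_trans (ler_norm _))// normrN.
  - rewrite ltNge sin_ge0_pi// divr_ge0 ?(ltW y0)//=.
    by rewrite ltW// (le_lt_trans (ler_norm _)).
apply/cvgrPdist_lt => e e0; exists N => // k /= kN.
by rewrite hN// subrr normr0.
Qed.

Lemma cvg_prodr (F : 'I_n -> nat -> R) (l : 'I_n -> R) :
  (forall i, F i k @[k --> \oo] --> l i) -> \prod_i F i k @[k --> \oo] --> \prod_i l i.
Proof.
move=> h.
have -> : (fun k => \prod_i F i k) = \prod_i F i by rewrite fct_prodE.
elim/big_ind2: _ => [|x x' y y' hx hy|i _]; [exact: cvg_cst|exact: cvgM|exact: h].
Qed.

Context (same_trig : forall t c,
  \int[P]_x cos (lform t x + c) = \int[Q]_x cos (lform t x + c)).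

Lemma trig_test1 : trig_test (cst 1).
Proof.
split; first exact: bmf_cst.
move=> t c; under eq_Rintegral do rewrite mul1r.
under [RHS]eq_Rintegral do rewrite mul1r.
exact: same_trig.
Qed.

Lemma trig_mul_Rintegral p : trig_mul p -> \int[P]_x p x = \int[Q]_x p x.
Proof.
move=> /(_ _ trig_test1)[_ /(_ (fun=> 0) 0)].
have e x : p x * cst 1 x * cos (lform (fun=> 0) x + 0) = p x.
  by rewrite /lform big1 ?addr0 ?cos0 ?mulr1// => i _; rewrite mul0r.
under eq_Rintegral do rewrite e.
under [RHS]eq_Rintegral do rewrite e.
by [].

Qed.

Let v (a : 'I_n -> R) k i x : R := (1 + sin ((X i x - a i) / k.+1%:R)) / 2.

Lemma trig_mul_v a k i : trig_mul (v a k i).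
Proof.
pose t j : R := if j == i then k.+1%:R^-1 else 0.
have lE x : lform t x + (- (a i / k.+1%:R)) = (X i x - a i) / k.+1%:R.
  rewrite /lform (bigD1 i)//= /t eqxx big1 ?addr0; first by rewrite mulrBl mulrC.
  by move=> j /negbTE ->; rewrite mul0r.
have := trig_mulM (trig_mulD (trig_mul_cst 1) (trig_mul_sin t (- (a i / k.+1%:R)))) (trig_mul_cst 2^-1).
by congr trig_mul; apply/funext => x; rewrite lE.
Qed.

Lemma v01 a k i x : 0 <= v a k i x <= 1.
Proof.
have := sin_max ((X i x - a i) / k.+1%:R); rewrite ler_norml => /andP[h1 h2].
by rewrite /v; apply/andP; split; lra.
Qed.

Lemma measurable_v a k i : measurable_fun setT (v a k i).
Proof.
apply: measurable_funM => //; apply: measurable_funD => //.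
apply: measurableT_comp; first by apply: continuous_measurable_fun; exact: continuous_sin.
by apply: measurable_funM => //; apply: measurable_funB.
Qed.

(* The lower box is approximated by trigonometric polynomials: with [v < 1/2] iff
   [sin ((X i - a i) / (k + 1)) < 0], the power in [sharp_threshold] tends to the
   indicator of [v < 1/2], which tends to that of [X i < a i] as [k] grows. *)
Lemma same_on_lower_boxes A : lower_boxes X A -> P A = Q A.
Proof.
move=> [a ->]; set A' := [set x | _].
have mA : measurable A'.
  have -> : A' = \bigcap_(i in [set: 'I_n]) (X i @^-1` `]-oo, a i[%classic).
    apply/seteqP; split => [x h i _ /=|x h i]; first by rewrite in_itv/=; exact: h.
    by have := h i I; rewrite /= in_itv.
  apply: fin_bigcap_measurable => // i _; rewrite -[X in measurable X]setTI.
  exact: mX.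
have iA (x : T) : \prod_i ((X i x < a i)%R%:R : R) = \1_A' x.
  rewrite indicE; case: (boolP (x \in A')) => [/set_mem h|/negP h].
    by rewrite big1// => i _; rewrite h.
  have [i hi] : exists i, ~~ (X i x < a i).
    apply/not_existsP => H; apply: h; apply/mem_set => i.
    by apply/negPn/negP; exact: H.
  by rewrite (bigD1 i)//= (negbTE hi) mul0r.
have bd (F : 'I_n -> T -> R) : (forall i x, 0 <= F i x <= 1) -> forall x, `|\prod_i F i x| <= 1.
  move=> h x; rewrite normr_prod; apply: prodr_ile1 => i _.
  by have /andP[h0 h1] := h i x; rewrite normr_ge0 ger0_norm.
have mp (F : 'I_n -> T -> R) : (forall i, measurable_fun setT (F i)) ->
    measurable_fun setT (fun x => \prod_i F i x).
  by move=> h; apply: measurable_prod.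
pose G k m x : R := \prod_i (1 - v a k i x ^+ m) ^+ (m * 2 ^ m).
pose H k x : R := \prod_i ((v a k i x < 2^-1)%R%:R : R).
have mG k m : measurable_fun setT (G k m).
  apply: mp => i; apply: measurable_funX; apply: measurable_funB => //.
  by apply: measurable_funX; exact: measurable_v.
have bG k m x : `|G k m x| <= 1.
  apply: (bd (fun i x => (1 - v a k i x ^+ m) ^+ (m * 2 ^ m))) => i {}x.
  have /andP[h0 h1] := v01 a k i x.
  have h2 : 0 <= 1 - v a k i x ^+ m by rewrite subr_ge0 exprn_ile1.
  by rewrite exprn_ge0//= exprn_ile1// gerBl exprn_ge0.
have cG k x : G k m x @[m --> \oo] --> H k x.
  apply: cvg_prodr => i; have /andP[h0 h1] := v01 a k i x.
  exact: sharp_threshold.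
have GPQ k m : \int[P]_x G k m x = \int[Q]_x G k m x.
  apply: trig_mul_Rintegral; apply: trig_mul_prod => i; apply: trig_mulX.
  have := trig_mulD (trig_mul_cst 1) (trig_mulM (trig_mul_cst (-1)) (trig_mulX m (trig_mul_v a k i))).
  by congr trig_mul; apply/funext => x; rewrite /= mulN1r.
have HPQ k : \int[P]_x H k x = \int[Q]_x H k x.
  have h1 := Rintegral_bounded_cvg (P := P) (mG k) (bG k) (cG k).
  have h2 := Rintegral_bounded_cvg (P := Q) (mG k) (bG k) (cG k).
  by rewrite (funext (GPQ k)) in h1; exact: (cvg_unique _ h1 h2).
have mH k : measurable_fun setT (H k).
  by apply: (measurable_fun_cvg (mG k)) => x _; exact: cG.
have bH k x : `|H k x| <= 1.
  by apply: (bd (fun i x => (v a k i x < 2^-1)%R%:R)) => i {}x; case: (v _ _ _ _ < _); rewrite /= ?lexx ?ler01.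
have cH x : H k x @[k --> \oo] --> (\1_A' x : R).
  rewrite -iA; apply: cvg_prodr => i.
  have := @sin_sign_scaled (X i x - a i); rewrite subr_lt0.
  rewrite (_ : (fun k => _) = (fun k => (v a k i x < 2^-1)%R%:R))//.
  by apply/funext => k; rewrite /v; congr ((_ : bool)%:R); apply/idP/idP; lra.
have h1 := Rintegral_bounded_cvg (P := P) mH bH cH.
have h2 := Rintegral_bounded_cvg (P := Q) mH bH cH.
have h3 : \int[P]_x (\1_A' x : R) = \int[Q]_x (\1_A' x : R).
  by rewrite (funext HPQ) in h1; exact: (cvg_unique _ h1 h2).
move: h3; rewrite /Rintegral !integral_indic// !setIT => h3.
by rewrite -(fineK (fin_num_measure P _ mA)) -(fineK (fin_num_measure Q _ mA)) h3.
Qed.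

Lemma fourier_uniqueness : d.-measurable = <<s lower_boxes X >> ->
  forall A, measurable A -> P A = Q A.
Proof.
move=> mE A mA.
apply: (measure_unique (lower_boxes X) (fun k => [set x | forall i, X i x < k%:R])) => //.
- move=> _ _ [a ->] [b ->]; exists (fun i => Num.min (a i) (b i)).
  apply/seteqP; split => x /=.
    by move=> [h1 h2] i; rewrite lt_min h1 h2.
  by move=> h; split => i; have := h i; rewrite lt_min => /andP[].
- by move=> k; exists (fun=> k%:R).
- apply/seteqP; split => // x _.
  exists (\max_i (Num.truncn `|X i x|).+1)%N => // i.
  rewrite (le_lt_trans (ler_norm _))// (lt_le_trans (truncnS_gt _))// ler_nat.
  exact: (leq_bigmax i).
- exact: same_on_lower_boxes.
- by move=> k; rewrite (le_lt_trans (probability_le1 P _)) ?ltry//; rewrite mE; apply: sub_sigma_algebra; exists (fun=> k%:R).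
Qed.

End FourierUniqueness.

Section LowerBoxes.
Context (R : realType) (T : pointedType) (n : nat) (X : 'I_n -> T -> R).
Let GT := g_sigma_algebraType (lower_boxes X).

Lemma measurable_coord_lower_boxes i : measurable_fun (setT : set GT) (X i : GT -> R).
Proof.
apply: (measurability _ (RGenInftyO.measurableE R)) => _ [_ [a ->] <-]; rewrite setTI.
(* A half-space is the increasing union of the boxes with side [a] in direction i and side k in the
   other directions. *)
rewrite (_ : _ @^-1` _ = \bigcup_k [set x : GT | forall j, X j x < (if j == i then a else k%:R)]); last first.
  apply/seteqP; split => [x /= xa|x [k _] /= h]; last first.
    by have := h i; rewrite eqxx in_itv.
  rewrite in_itv/= in xa; exists (\max_j (Num.truncn `|X j x|).+1)%N => // j.
  case: eqP => [->//|_].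
  rewrite (le_lt_trans (ler_norm _))// (lt_le_trans (truncnS_gt _))// ler_nat.
  exact: (leq_bigmax j).
apply: bigcupT_measurable => k; apply: sub_sigma_algebra.
by exists (fun j => if j == i then a else k%:R).
Qed.

End LowerBoxes.

(** * Borel sets of R^d and of R^d x R^d *)

Section BorelVectors.
Context (R : realType) (d : nat).
Local Notation V := 'rV[R]_d.

Lemma measurable_coord i : measurable_fun (setT : set V) (fun x : V => x 0 i).
Proof.
apply: (measurability _ (RGenInftyO.measurableE R)) => _ [_ [a ->] <-]; rewrite setTI.
apply: sub_sigma_algebra; apply: open_comp; last exact: interval_open.
by move=> x _; exact: coord_continuous.
Qed.

(** A countable base made of open sup-norm balls: through it, measurability of the coordinates
    implies Borel measurability of a vector-valued map. *)
Definition rcube (p : {ffun 'I_d -> rat} * nat) : set V :=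
  [set x | forall i, `|ratr (p.1 i) - x 0 i| < p.2.+1%:R^-1].

Lemma open_rcubes (U : set V) : open U ->
  U = \bigcup_(p in [set p | rcube p `<=` U]) rcube p.
Proof.
move=> oU; apply/seteqP; split => [x Ux|x [p pU] px]; last exact: pU.
have := oU; rewrite openE => /(_ x Ux) /(@nbhs_ballP R V)[e /= e0 eU].
pose m := Num.truncn (2 / e).
have me : m.+1%:R^-1 < e / 2.
  have := truncnS_gt (2 / e); rewrite -/m => h.
  by rewrite -ltf_pV2 ?invrK ?invf_div ?posrE ?invr_gt0 ?divr_gt0.
have m0 : 0 < (m.+1%:R^-1 : R) by rewrite invr_gt0.
have hq i : exists q : rat, `|ratr q - x 0 i| < m.+1%:R^-1.
  have lt : x 0 i - m.+1%:R^-1 < x 0 i + m.+1%:R^-1.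
    by rewrite ltrBlDr -addrA ltrDl addr_gt0.
  have [q] := rat_in_itvoo lt; rewrite in_itv/= => /andP[h1 h2]; exists q.
  by rewrite ltr_norml ltrBrDr ltrBlDr addrC h1 addrC.
pose q := [ffun i => projT1 (cid (hq i))].
have hq' i : `|ratr (q i) - x 0 i| < m.+1%:R^-1.
  by rewrite ffunE; exact: (projT2 (cid (hq i))).
exists (q, m); last exact: hq'.
move=> y hy; apply: eU; split => // i j; rewrite (ord1 i) /ball/=.
have h1 := hq' j; rewrite distrC in h1; have h2 : `|ratr (q j) - y 0 j| < m.+1%:R^-1 := hy j.
rewrite (_ : x 0 j - y 0 j = (x 0 j - ratr (q j)) + (ratr (q j) - y 0 j)); last by ring.
by rewrite (le_lt_trans (ler_normD _ _))// [ltRHS]splitr ltrD// ?(lt_trans h1)// (lt_trans h2).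
Qed.

Lemma measurable_fun_rV (d0 : measure_display) (T : measurableType d0) (f : T -> V) :
  (forall i, measurable_fun setT (fun x => f x 0 i)) -> measurable_fun setT f.
Proof.
move=> mf; apply: (@measurability _ _ T V setT f open) => // _ [U oU <-].
rewrite setTI (open_rcubes oU) preimage_bigcup.
have mc p : measurable (f @^-1` rcube p).
  rewrite (_ : _ @^-1` _ = \bigcap_(i in [set: 'I_d])
      ((fun x => `|ratr (p.1 i) - f x 0 i|) @^-1` `]-oo, p.2.+1%:R^-1[%classic)); last first.
    apply/seteqP; split => [x h i _ /=|x h i]; first by rewrite in_itv/=; exact: h.
    by have := h i I; rewrite /= in_itv.
  apply: fin_bigcap_measurable => // i _; rewrite -[X in measurable X]setTI.
  have m : measurable_fun setT (fun x => `|ratr (p.1 i) - f x 0 i|).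
    by apply: measurableT_comp => //; apply: measurable_funB.
  exact: m.
rewrite bigcup_mkcond.
apply: countable_bigcupT_measurable => //.
by move=> p; case: ifP.
Qed.

Lemma measurable_dotv (t : V) : measurable_fun (setT : set V) (fun x => dotv t x).
Proof.
by apply: measurable_sum => i; apply: measurable_funM => //; exact: measurable_coord.
Qed.

Definition pcoord (i : 'I_(d + d)) (x : V * V) : R :=
  match fintype.split i with inl j => x.1 0 j | inr j => x.2 0 j end.

Lemma measurable_pcoord i : measurable_fun setT (pcoord i).
Proof.
rewrite /pcoord; case: (fintype.split i) => j.
  exact: (measurableT_comp (measurable_coord j) measurable_fst).
exact: (measurableT_comp (measurable_coord j) measurable_snd).
Qed.

Lemma measurable_pair_lower_boxes :
  @measurable _ (V * V)%type = <<s lower_boxes pcoord >>.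
Proof.
apply/seteqP; split => [A mA|].
- pose GT := g_sigma_algebraType (lower_boxes pcoord).
  (* The identity from the box sigma-field is measurable because each of its coordinates is; pulling
     back A along it gives the inclusion. *)
  have mid : measurable_fun (setT : set GT) (fun x : GT => (x.1, x.2) : V * V).
    apply: measurable_fun_pair; apply: measurable_fun_rV => i.
    + have := @measurable_coord_lower_boxes R _ _ pcoord (lshift d i).
      by congr measurable_fun; apply/funext => x; rewrite /pcoord (unsplitK (inl i)).
    + have := @measurable_coord_lower_boxes R _ _ pcoord (rshift d i).
      by congr measurable_fun; apply/funext => x; rewrite /pcoord (unsplitK (inr i)).
  have := mid measurableT A mA; rewrite setTI.
  by congr (<<s _ >> _); apply/seteqP; split => -[x y].
- apply: smallest_sub; first exact: sigma_algebra_measurable.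
  move=> _ [a ->].
  rewrite (_ : [set x | _] = \bigcap_(i in [set: 'I_(d + d)]) (pcoord i @^-1` `]-oo, a i[%classic)); last first.
    apply/seteqP; split => [x h i _ /=|x h i]; first by rewrite in_itv/=; exact: h.
    by have := h i I; rewrite /= in_itv.
  apply: fin_bigcap_measurable => // i _; rewrite -[X in measurable X]setTI.
  exact: measurable_pcoord.
Qed.

Lemma fourier_uniqueness_pair (P Q : probability (V * V)%type R) :
  (forall (t1 t2 : V) c, \int[P]_x cos (dotv t1 x.1 + dotv t2 x.2 + c) =
                         \int[Q]_x cos (dotv t1 x.1 + dotv t2 x.2 + c)) ->
  forall A, measurable A -> P A = Q A.
Proof.
move=> h; apply: (fourier_uniqueness measurable_pcoord); last exact: measurable_pair_lower_boxes.
move=> t c; have := h (\row_j t (lshift d j)) (\row_j t (rshift d j)) c.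
have e x : lform pcoord t x = dotv (\row_j t (lshift d j)) x.1 + dotv (\row_j t (rshift d j)) x.2.
  rewrite /lform big_split_ord/= /dotv; congr (_ + _); apply: eq_bigr => i _.
    by rewrite mxE /pcoord (unsplitK (inl i)).
  by rewrite mxE /pcoord (unsplitK (inr i)).
under [X in _ -> X = _]eq_Rintegral do rewrite e.
under [X in _ -> _ = X]eq_Rintegral do rewrite e.
by [].
Qed.

End BorelVectors.

(** * Laplace transforms *)

Section ComplexIntegral.
Context (R : realType) (d : measure_display) (T : measurableType d).
Context (P : probability T R).
Local Notation C := R[i].
Implicit Types (f g : T -> C) (h : T -> R).

Definition cmeasurable f :=
  measurable_fun setT (fun x => Re (f x)) /\ measurable_fun setT (fun x => Im (f x)).

Definition cintegrable f :=
  P.-integrable setT (EFin \o (fun x => Re (f x))) /\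
  P.-integrable setT (EFin \o (fun x => Im (f x))).

Lemma cmeasurable_cst (c : C) : cmeasurable (cst c).
Proof. by split; exact: measurable_cst. Qed.

Lemma cmeasurable_real h : measurable_fun setT h -> cmeasurable (fun x => (h x)%:C%C).
Proof. by move=> mh; split => //=; exact: measurable_cst. Qed.

Lemma cmeasurableD f g : cmeasurable f -> cmeasurable g -> cmeasurable (fun x => f x + g x).
Proof.
move=> [f1 f2] [g1 g2]; split.
- by under eq_fun do rewrite cReD; apply: measurable_funD.
- by under eq_fun do rewrite cImD; apply: measurable_funD.
Qed.

Lemma cmeasurableM f g : cmeasurable f -> cmeasurable g -> cmeasurable (fun x => f x * g x).
Proof.
move=> [f1 f2] [g1 g2]; split.
- by under eq_fun do rewrite cReM; apply: measurable_funB; apply: measurable_funM.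
- by under eq_fun do rewrite cImM; apply: measurable_funD; apply: measurable_funM.
Qed.

Lemma cmeasurableX f n : cmeasurable f -> cmeasurable (fun x => f x ^+ n).
Proof.
move=> mf; elim: n => [|n IH]; first exact: cmeasurable_cst.
by under eq_fun do rewrite exprS; exact: cmeasurableM.
Qed.

Lemma cmeasurable_sum (F : nat -> T -> C) n : (forall k, cmeasurable (F k)) ->
  cmeasurable (fun x => \sum_(k < n) F k x).
Proof.
move=> mF; elim: n => [|n IH].
  by under eq_fun do rewrite big_ord0; exact: cmeasurable_cst.
by under eq_fun do rewrite big_ord_recr/=; exact: cmeasurableD.
Qed.

Lemma cmeasurable_expC f : cmeasurable f -> cmeasurable (fun x => expC (f x)).
Proof.
move=> [f1 f2]; have m1 : measurable_fun setT (fun x => expR (Re (f x))) by exact: measurableT_comp.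
split; apply: measurable_funM => //; apply: measurableT_comp => //;
  apply: continuous_measurable_fun; [exact: continuous_cos|exact: continuous_sin].
Qed.

Lemma cmeasurable_normc f : cmeasurable f -> measurable_fun setT (fun x => normc (f x)).
Proof.
move=> [m1 m2]; under eq_fun do rewrite normc_Re_Im.
have msqrt : measurable_fun setT (@Num.sqrt R).
  by apply: continuous_measurable_fun; exact: sqrt_continuous.
by apply: (measurableT_comp msqrt); apply: measurable_funD; apply: measurable_funX.
Qed.

Lemma cintegrable_le f h : cmeasurable f -> P.-integrable setT (EFin \o h) ->
  (forall x, normc (f x) <= h x) -> cintegrable f.
Proof.
move=> [f1 f2] ih fh; split.
- apply: (le_integrable measurableT _ _ ih); first exact/measurable_EFinP.
  move=> x _ /=; rewrite lee_fin (le_trans (normc_Re _))// (le_trans (fh x))// ler_norm//.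
- apply: (le_integrable measurableT _ _ ih); first exact/measurable_EFinP.
  move=> x _ /=; rewrite lee_fin (le_trans (normc_Im _))// (le_trans (fh x))// ler_norm//.
Qed.

Lemma cintegrable_bounded f (M : R) : cmeasurable f ->
  (forall x, normc (f x) <= M) -> cintegrable f.
Proof. by move=> mf; apply: cintegrable_le => //; apply: bmf_integrable; exact: bmf_cst. Qed.

Lemma integralCD f g : cintegrable f -> cintegrable g ->
  integralC P (fun x => f x + g x) = integralC P f + integralC P g.
Proof.
move=> [f1 f2] [g1 g2]; apply: complex_ext => /=.
- by under eq_Rintegral do rewrite cReD; rewrite RintegralD.
- by under eq_Rintegral do rewrite cImD; rewrite RintegralD.
Qed.

Lemma cintegrableD f g : cintegrable f -> cintegrable g -> cintegrable (fun x => f x + g x).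
Proof.
move=> [f1 f2] [g1 g2]; split.
- rewrite (_ : _ \o _ = (EFin \o (fun x => Re (f x))) \+ (EFin \o (fun x => Re (g x))))%E.
    exact: integrableD.
  by apply/funext => x /=; rewrite cReD EFinD.
- rewrite (_ : _ \o _ = (EFin \o (fun x => Im (f x))) \+ (EFin \o (fun x => Im (g x))))%E.
    exact: integrableD.
  by apply/funext => x /=; rewrite cImD EFinD.
Qed.

Lemma Rintegrable_lin (a b : R) h k : P.-integrable setT (EFin \o h) ->
  P.-integrable setT (EFin \o k) ->
  P.-integrable setT (EFin \o (fun x => a * h x + b * k x)) /\
  \int[P]_x (a * h x + b * k x) = a * \int[P]_x h x + b * \int[P]_x k x.
Proof.
move=> ih ik.
have iah : P.-integrable setT (EFin \o (fun x => a * h x)).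
  by have := integrableZl measurableT a ih; congr integrable; apply/funext => x /=; rewrite EFinM.
have ibk : P.-integrable setT (EFin \o (fun x => b * k x)).
  by have := integrableZl measurableT b ik; congr integrable; apply/funext => x /=; rewrite EFinM.
split; last by rewrite RintegralD// !RintegralZl.
by have := integrableD measurableT iah ibk; congr integrable; apply/funext => x /=; rewrite EFinD.
Qed.

Lemma cintegrableZ (c : C) f : cintegrable f -> cintegrable (fun x => c * f x).
Proof.
move=> [f1 f2]; split.
- have [h _] := Rintegrable_lin (Re c) (- Im c) f1 f2; move: h; congr integrable.
  by apply/funext => x /=; rewrite cReM mulNr.
- have [h _] := Rintegrable_lin (Re c) (Im c) f2 f1; move: h; congr integrable.
  by apply/funext => x /=; rewrite cImM.
Qed.

Lemma integralCZ (c : C) f : cintegrable f ->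
  integralC P (fun x => c * f x) = c * integralC P f.
Proof.
move=> [f1 f2]; apply: complex_ext => /=.
- have [_ h] := Rintegrable_lin (Re c) (- Im c) f1 f2.
  by under eq_Rintegral do rewrite cReM -mulNr; rewrite h cReM /= mulNr.
- have [_ h] := Rintegrable_lin (Re c) (Im c) f2 f1.
  by under eq_Rintegral do rewrite cImM; rewrite h cImM.
Qed.

Lemma integralC_sum (F : nat -> T -> C) n : (forall k, cintegrable (F k)) ->
  integralC P (fun x => \sum_(k < n) F k x) = \sum_(k < n) integralC P (F k) /\
  cintegrable (fun x => \sum_(k < n) F k x).
Proof.
move=> iF; elim: n => [|n [e i]].
  rewrite big_ord0; under eq_fun do rewrite big_ord0; split.
    by apply: complex_ext => /=; rewrite Rintegral_cst// mul0r.
  by apply: cintegrable_bounded (cmeasurable_cst 0) _ => x; rewrite ComplexField.Normc.normc0.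
rewrite big_ord_recr/=; under eq_fun do rewrite big_ord_recr/=; split.
  by rewrite integralCD// e.
exact: cintegrableD.
Qed.

(** The factor 2 comes from bounding the two components separately; growth estimates only need the
    right order. *)
Lemma normc_integralC f h : cintegrable f -> P.-integrable setT (EFin \o h) ->
  (forall x, normc (f x) <= h x) -> normc (integralC P f) <= 2 * \int[P]_x h x.
Proof.
move=> [f1 f2] ih fh; rewrite (le_trans (normc_le _))//= mulr_natl mulr2n.
apply: lerD.
- rewrite (le_trans (le_normr_Rintegral measurableT f1))//.
  apply: le_Rintegral => //; first by have := integrable_norm f1.
  by move=> x _; exact: le_trans (normc_Re _) (fh x).
- rewrite (le_trans (le_normr_Rintegral measurableT f2))//.
  apply: le_Rintegral => //; first by have := integrable_norm f2.
  by move=> x _; exact: le_trans (normc_Im _) (fh x).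
Qed.

Lemma integralC_dominated_cvg (F : nat -> T -> C) f h :
  (forall n, cmeasurable (F n)) -> (forall n x, normc (F n x) <= h x) ->
  P.-integrable setT (EFin \o h) -> (forall x, ccvg (fun n => F n x) (f x)) ->
  ccvg (fun n => integralC P (F n)) (integralC P f).
Proof.
move=> mF bF ih cF; split => /=.
- have [] := @Rintegral_dominated_cvg _ _ _ P (fun n x => Re (F n x)) (fun x => Re (f x)) h.
  + by move=> n; case: (mF n).
  + by move=> n x; exact: le_trans (normc_Re _) (bF n x).
  + exact: ih.
  + by move=> x; case: (cF x).
  by [].
- have [] := @Rintegral_dominated_cvg _ _ _ P (fun n x => Im (F n x)) (fun x => Im (f x)) h.
  + by move=> n; case: (mF n).
  + by move=> n x; exact: le_trans (normc_Im _) (bF n x).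
  + exact: ih.
  + by move=> x; case: (cF x).
  by [].
Qed.

(** Taylor coefficients in s of the integral of exp(s alpha) w. The weight [w] allows an expansion
    around any base point of the transform, not only the origin. *)
Definition laplace_coef (alpha : T -> C) (w : T -> C) (k : nat) : C :=
  integralC P (fun x => invfact R k * (alpha x ^+ k * w x)).

Section LaplaceSeries.
Context (alpha : T -> C) (w : T -> C).
Context (malpha : cmeasurable alpha) (mw : cmeasurable w).
Context (iw : forall S, 0 <= S ->
  P.-integrable setT (EFin \o (fun x => expR (S * normc (alpha x)) * normc (w x)))).

Let mF k : cmeasurable (fun x => invfact R k * (alpha x ^+ k * w x)).
Proof.
apply: cmeasurableM; first exact: cmeasurable_cst.
by apply: cmeasurableM => //; exact: cmeasurableX.
Qed.

Let normF k x : normc (invfact R k * (alpha x ^+ k * w x)) =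
  normc (invfact R k) * normc (alpha x) ^+ k * normc (w x).
Proof. by rewrite !ComplexField.Normc.normcM normcX mulrA. Qed.

Let invfact_le S k : 0 <= S -> normc (invfact R k) * S ^+ k <= expR S.
Proof. by move=> S0; apply: bnd_coef => //; exact: bnd_invfact. Qed.

Let iF k : cintegrable (fun x => invfact R k * (alpha x ^+ k * w x)).
Proof.
apply: cintegrable_le (mF k) (iw ler01) _ => x.
by rewrite normF ler_wpM2r ?normc_ge0// mul1r invfact_le ?normc_ge0.
Qed.

Lemma bnd_laplace_coef S : 0 <= S ->
  bnd (laplace_coef alpha w) S (2 * \int[P]_x (expR (S * normc (alpha x)) * normc (w x))).
Proof.
move=> S0 N.
pose G (k : nat) x : R := S ^+ k * normc (invfact R k * (alpha x ^+ k * w x)).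
have iG k : P.-integrable setT (EFin \o G k).
  apply: (le_integrable measurableT _ _ (iw S0)).
    apply/measurable_EFinP; apply: measurable_funM => //.
    exact: cmeasurable_normc.
  move=> x _ /=; have G0 : 0 <= G k x by rewrite mulr_ge0 ?exprn_ge0 ?normc_ge0.
  rewrite lee_fin (ger0_norm G0) (le_trans _ (ler_norm _))//.
  rewrite /G normF !mulrA ler_wpM2r ?normc_ge0//.
  rewrite [leLHS](_ : _ = normc (invfact R k) * (S * normc (alpha x)) ^+ k); last by rewrite exprMn; ring.
  by rewrite invfact_le// mulr_ge0 ?normc_ge0.
have step k : normc (laplace_coef alpha w k) * S ^+ k <= 2 * \int[P]_x G k x.
  rewrite -[X in _ * X <= _](ger0_norm (exprn_ge0 k S0)) -normc_real [leLHS]mulrC.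
  rewrite -ComplexField.Normc.normcM -integralCZ//.
  apply: normc_integralC; [exact: cintegrableZ|exact: iG|].
  by move=> x; rewrite ComplexField.Normc.normcM normc_real ger0_norm// exprn_ge0.
apply: (@le_trans _ _ (\sum_(k < N) 2 * \int[P]_x G k x)); first exact: ler_sum.
have sumG : \sum_(k < N) \int[P]_x G k x = \int[P]_x (\sum_(k < N) G k x) /\
    P.-integrable setT (EFin \o (fun x => \sum_(k < N) G k x)).
  elim: N => [|N [IH1 IH2]].
    rewrite big_ord0; under eq_fun do rewrite big_ord0; split.
      by rewrite Rintegral_cst// mul0r.
    by apply: bmf_integrable; exact: bmf_cst.
  have E : (fun x => \sum_(k < N.+1) G k x) = (fun x => \sum_(k < N) G k x + G N x).
    by apply/funext => x; rewrite big_ord_recr.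
  rewrite E big_ord_recr/= IH1; split; first by rewrite RintegralD.
  by have := integrableD measurableT IH2 (iG N); congr integrable; apply/funext => x /=; rewrite EFinD.
rewrite -mulr_sumr ler_wpM2l// sumG.1; apply: le_Rintegral => //; [exact: sumG.2|exact: iw|].
move=> x _; rewrite /G; under eq_bigr do rewrite normF.
rewrite (_ : \sum_(k < N) _ = apsum (invfact R) (S * normc (alpha x)) N * normc (w x)).
  by rewrite ler_wpM2r ?normc_ge0//; apply: bnd_invfact; rewrite mulr_ge0 ?normc_ge0.
rewrite /apsum mulr_suml; apply: eq_bigr => k _; rewrite exprMn; ring.
Qed.

Lemma ent_laplace_coef : ent (laplace_coef alpha w).
Proof. by move=> S S0; eexists; exact: bnd_laplace_coef. Qed.

Lemma ev_laplace_coef s :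
  ev (laplace_coef alpha w) s = integralC P (fun x => expC (s * alpha x) * w x).
Proof.
apply: ev_unique; first exact: ent_laplace_coef.
have E N x : psum (invfact R) (s * alpha x) N * w x =
    \sum_(k < N) s ^+ k * (invfact R k * (alpha x ^+ k * w x)).
  by rewrite /psum mulr_suml; apply: eq_bigr => k _; rewrite exprMn; ring.
have : ccvg (fun N => integralC P (fun x => psum (invfact R) (s * alpha x) N * w x))
    (integralC P (fun x => expC (s * alpha x) * w x)).
  apply: (integralC_dominated_cvg (h := fun x => expR (normc s * normc (alpha x)) * normc (w x))).
  - move=> N; under eq_fun do rewrite E; apply: (@cmeasurable_sum
      (fun k x => s ^+ k * (invfact R k * (alpha x ^+ k * w x)))) => k.
    by apply: cmeasurableM; first exact: cmeasurable_cst.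
  - move=> N x; rewrite ComplexField.Normc.normcM ler_wpM2r ?normc_ge0//.
    rewrite (le_trans (normc_psum _ _ _))// ComplexField.Normc.normcM.
    by apply: bnd_invfact; rewrite mulr_ge0 ?normc_ge0.
  - by apply: iw; exact: normc_ge0.
  - by move=> x; apply: ccvgM; [exact: expC_ccvg|exact: ccvg_cst].
apply: ccvg_eq => N; rewrite (funext (E N)).
have [-> _] := @integralC_sum (fun k x => s ^+ k * (invfact R k * (alpha x ^+ k * w x))) N
  (fun k => cintegrableZ _ (iF k)).
by apply: eq_bigr => k _; rewrite integralCZ// mulrC.
Qed.

End LaplaceSeries.

End ComplexIntegral.

Definition pairing (R : realType) (d : nat) (z1 z2 : 'rV[R[i]]_d)
    (x : 'rV[R]_d * 'rV[R]_d) : R[i] :=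
  dotv z1 (complex_vec x.1) + dotv z2 (complex_vec x.2).

(** The Taylor sequence of [Phi] restricted to the complex line s -> (z1 + s a1, z2 + s a2), see
    [ev_line_coef]. Analyticity in several variables is only ever used along such lines. *)
HB.lock Definition line_coef (R : realType) (d : nat)
    (nu : probability ('rV[R]_d * 'rV[R]_d)%type R) (z1 z2 a1 a2 : 'rV[R[i]]_d) :
    nat -> R[i] :=
  laplace_coef nu (pairing a1 a2) (fun x => expC (pairing z1 z2 x)).

HB.lock Definition lap (R : realType) (d : nat)
    (nu : probability ('rV[R]_d * 'rV[R]_d)%type R) (z1 z2 : 'rV[R[i]]_d) : R[i] :=
  Phi nu z1 z2.

Section ExponentialMoments.
Context (R : realType) (d : nat).
Local Notation C := R[i].
Local Notation V := 'rV[R]_d.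
Local Notation cV := 'rV[R[i]]_d.
Local Notation cv := (@complex_vec R d).
Implicit Types (nu : probability (V * V)%type R) (z : cV) (t a : V).

Definition expmom nu := forall u1 u2 : V,
  nu.-integrable setT (EFin \o (fun x : V * V => expR (dotv u1 x.1 + dotv u2 x.2))).

Lemma dotvDl (K : pzRingType) (u v w : 'rV[K]_d) : dotv (u + v) w = dotv u w + dotv v w.
Proof. by rewrite /dotv -big_split; apply: eq_bigr => i _; rewrite mxE mulrDl. Qed.

Lemma dotvZl (K : pzRingType) (k : K) (u w : 'rV[K]_d) : dotv (k *: u) w = k * dotv u w.
Proof. by rewrite /dotv mulr_sumr; apply: eq_bigr => i _; rewrite mxE mulrA. Qed.

Lemma dotv0l (K : pzRingType) (w : 'rV[K]_d) : dotv 0 w = 0.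
Proof. by rewrite /dotv big1// => i _; rewrite mxE mul0r. Qed.

Lemma dotvDr (u v w : V) : dotv w (u + v) = dotv w u + dotv w v.
Proof. by rewrite /dotv -big_split; apply: eq_bigr => i _; rewrite mxE mulrDr. Qed.

Lemma dotvC (u v : V) : dotv u v = dotv v u.
Proof. by apply: eq_bigr => i _; rewrite mulrC. Qed.

Lemma complex_vecE z : z = cv (map_mx (@complex.Re R) z) + 'i%C *: cv (map_mx (@complex.Im R) z).
Proof. by apply/rowP => i; rewrite !mxE; exact: complexE. Qed.

Lemma dotv_complex_vec (u x : V) : dotv (cv u) (cv x) = (dotv u x)%:C%C.
Proof. by rewrite /dotv rmorph_sum; apply: eq_bigr => i _; rewrite !mxE rmorphM. Qed.

Lemma dotv_complexE z (x : V) :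
  dotv z (cv x) = (dotv (map_mx (@complex.Re R) z) x +i* dotv (map_mx (@complex.Im R) z) x)%C.
Proof.
rewrite {1}(complex_vecE z) dotvDl dotvZl !dotv_complex_vec.
by apply: complex_ext => /=; ring.
Qed.

Lemma normc_expC (w : C) : normc (expC w) = expR (Re w).
Proof.
by rewrite normc_Re_Im /= !exprMn -mulrDr cos2Dsin2 mulr1 sqrtr_sqr ger0_norm//.
Qed.

Lemma Re_pairing z1 z2 x : Re (pairing z1 z2 x) =
  dotv (map_mx (@complex.Re R) z1) x.1 + dotv (map_mx (@complex.Re R) z2) x.2.
Proof. by rewrite /pairing !dotv_complexE cReD. Qed.

Lemma Im_pairing z1 z2 x : Im (pairing z1 z2 x) =
  dotv (map_mx (@complex.Im R) z1) x.1 + dotv (map_mx (@complex.Im R) z2) x.2.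
Proof. by rewrite /pairing !dotv_complexE cImD. Qed.

Lemma measurable_dotv2 (u1 u2 : V) :
  measurable_fun setT (fun x : V * V => dotv u1 x.1 + dotv u2 x.2).
Proof.
apply: measurable_funD.
- exact: (measurableT_comp (measurable_dotv u1) measurable_fst).
- exact: (measurableT_comp (measurable_dotv u2) measurable_snd).
Qed.

Lemma cmeasurable_pairing z1 z2 : cmeasurable (pairing z1 z2).
Proof.
split.
- by under eq_fun do rewrite Re_pairing; exact: measurable_dotv2.
- by under eq_fun do rewrite Im_pairing; exact: measurable_dotv2.
Qed.

Lemma lapE nu z1 z2 : lap nu z1 z2 = integralC nu (fun x => expC (pairing z1 z2 x)).
Proof. by rewrite lap.unlock. Qed.

Lemma expR_abs_le (S x : R) : 0 <= S -> expR (S * `|x|) <= expR (S * x) + expR (- S * x).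
Proof.
move=> S0; case: (ger0P x) => x0.
  by rewrite lerDl expR_ge0.
by rewrite mulrN mulNr lerDr expR_ge0.
Qed.

Lemma expmom_le nu (h : V * V -> R) (r : seq ((V * V)%type)) : expmom nu ->
  measurable_fun setT h -> (forall x, 0 <= h x) ->
  (forall x, h x <= \sum_(u <- r) expR (dotv u.1 x.1 + dotv u.2 x.2)) ->
  nu.-integrable setT (EFin \o h).
Proof.
move=> hnu mh h0 hr.
have ir : nu.-integrable setT
    (EFin \o (fun x => \sum_(u <- r) expR (dotv u.1 x.1 + dotv u.2 x.2))).
  elim: r {hr} => [|u r IH].
    by under eq_fun do rewrite big_nil; apply: bmf_integrable; exact: bmf_cst.
  have := integrableD measurableT (hnu u.1 u.2) IH.
  by congr integrable; apply/funext => x /=; rewrite big_cons EFinD.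
apply: (le_integrable measurableT _ _ ir); first exact/measurable_EFinP.
by move=> x _ /=; rewrite lee_fin (ger0_norm (h0 x)) (le_trans (hr x))// ler_norm.
Qed.

(** Split |Z| <= |Re Z| + |Im Z|, then bound exp(S |x|) by exp(S x) + exp(-S x) in each part. The
    product expands into the four real exponentials given by the sign choices of [p]. *)
Lemma expmom_pairing nu z1 z2 (a1 a2 : cV) (S : R) : expmom nu -> 0 <= S ->
  nu.-integrable setT (EFin \o
    (fun x => expR (S * normc (pairing a1 a2 x)) * normc (expC (pairing z1 z2 x)))).
Proof.
move=> hnu S0.
pose p (k l : R) := (map_mx (@complex.Re R) z1 + k *: map_mx (@complex.Re R) a1 + l *: map_mx (@complex.Im R) a1,
                     map_mx (@complex.Re R) z2 + k *: map_mx (@complex.Re R) a2 + l *: map_mx (@complex.Im R) a2).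
apply: (@expmom_le nu _ [:: p S S; p S (- S); p (- S) S; p (- S) (- S)]) => //.
- apply: measurable_funM.
    apply: measurableT_comp => //; apply: measurable_funM => //.
    by apply: cmeasurable_normc; exact: cmeasurable_pairing.
  by apply: cmeasurable_normc; apply: cmeasurable_expC; exact: cmeasurable_pairing.
- by move=> x; rewrite mulr_ge0 ?expR_ge0 ?normc_ge0.
- move=> x; rewrite !big_cons big_nil addr0 normc_expC.
  have e k l : expR (dotv (p k l).1 x.1 + dotv (p k l).2 x.2) =
     expR (k * Re (pairing a1 a2 x)) * expR (l * Im (pairing a1 a2 x)) * expR (Re (pairing z1 z2 x)).
    by rewrite -!expRD !Re_pairing Im_pairing /= !dotvDl !dotvZl; congr expR; ring.
  rewrite !e; set Z := pairing a1 a2 x.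
  have h1 : expR (S * normc Z) <= expR (S * `|Re Z|) * expR (S * `|Im Z|).
    by rewrite -expRD ler_expR -mulrDr ler_wpM2l// normc_le.
  have h2 := ler_pM (expR_ge0 _) (expR_ge0 _) (expR_abs_le (Re Z) S0) (expR_abs_le (Im Z) S0).
  rewrite (le_trans (ler_wpM2r (expR_ge0 _) (le_trans h1 h2)))//.
  by rewrite !mulrDl !mulrDr !mulrDl !addrA lexx.
Qed.

Lemma pairing_line z1 z2 (a1 a2 : cV) (s : C) x :
  pairing (z1 + s *: a1) (z2 + s *: a2) x = s * pairing a1 a2 x + pairing z1 z2 x.
Proof. by rewrite /pairing !dotvDl !dotvZl; ring. Qed.

Lemma ent_line_coef nu z1 z2 (a1 a2 : cV) : expmom nu -> ent (line_coef nu z1 z2 a1 a2).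
Proof.
move=> hnu; rewrite line_coef.unlock; apply: ent_laplace_coef; first exact: cmeasurable_pairing.
- by apply: cmeasurable_expC; exact: cmeasurable_pairing.
- by move=> S S0; exact: expmom_pairing.
Qed.

Lemma ev_line_coef nu z1 z2 (a1 a2 : cV) s : expmom nu ->
  ev (line_coef nu z1 z2 a1 a2) s = lap nu (z1 + s *: a1) (z2 + s *: a2).
Proof.
move=> hnu; rewrite line_coef.unlock ev_laplace_coef.
- by rewrite lapE; congr integralC; apply/funext => x; rewrite -expCD pairing_line.
- exact: cmeasurable_pairing.
- by apply: cmeasurable_expC; exact: cmeasurable_pairing.
- by move=> S S0; exact: expmom_pairing.
Qed.

Lemma line0 z (s : C) : z + s *: 0 = z.
Proof. by rewrite scaler0 addr0. Qed.

Lemma ev_line_left nu z1 z2 (a : cV) s : expmom nu ->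
  ev (line_coef nu z1 z2 a 0) s = lap nu (z1 + s *: a) z2.
Proof.
move=> h; rewrite (ev_line_coef z1 z2 a 0 s h).
by rewrite line0.
Qed.

Lemma ev_line_right nu z1 z2 (a : cV) s : expmom nu ->
  ev (line_coef nu z1 z2 0 a) s = lap nu z1 (z2 + s *: a).
Proof.
move=> h; rewrite (ev_line_coef z1 z2 0 a s h).
by rewrite line0.
Qed.

Lemma ev_line_left0 nu z2 (a : cV) s : expmom nu ->
  ev (line_coef nu 0 z2 a 0) s = lap nu (s *: a) z2.
Proof. by move=> h; rewrite (ev_line_left 0 z2 a s h) (add0r (s *: a)). Qed.

Lemma ev_line_right0 nu z1 (a : cV) s : expmom nu ->
  ev (line_coef nu z1 0 0 a) s = lap nu z1 (s *: a).
Proof. by move=> h; rewrite (ev_line_right z1 0 a s h) (add0r (s *: a)). Qed.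

Lemma bnd_line_coef nu (a1 a2 : cV) (S : R) : expmom nu -> 0 <= S ->
  bnd (line_coef nu 0 0 a1 a2) S (2 * \int[nu]_x expR (S * normc (pairing a1 a2 x))).
Proof.
move=> hnu S0; rewrite line_coef.unlock.
have := @bnd_laplace_coef R _ _ nu (pairing a1 a2) (fun x => expC (pairing 0 0 x))
  (cmeasurable_pairing _ _) (cmeasurable_expC (cmeasurable_pairing _ _))
  (fun S S0 => expmom_pairing 0 0 a1 a2 hnu S0) S S0.
congr (bnd _ _ (2 * _)); apply: eq_Rintegral => x _.
by rewrite /pairing !dotv0l addr0 normc_expC expR0 mulr1.
Qed.

Lemma lap00 nu : lap nu 0 0 = 1.
Proof.
rewrite lapE.
have -> : (fun x : V * V => expC (pairing 0 0 x)) = cst 1.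
  apply/funext => x; rewrite /pairing !dotv0l addr0.
  by apply: complex_ext; rewrite /= expR0 ?cos0 ?sin0 mul1r.
apply: complex_ext => /=; rewrite Rintegral_cst// ?mul0r//.
by rewrite mul1r (_ : 1 = fine (1%E : \bar R))//; congr fine; exact: probability_setT.
Qed.

End ExponentialMoments.

(** * The functional equation *)

Section CharacteristicFunction.
Context (R : realType) (d : nat).
Local Notation C := R[i].
Local Notation V := 'rV[R]_d.
Local Notation cV := 'rV[R[i]]_d.
Local Notation cv := (@complex_vec R d).
Local Notation ii := ('i%C : R[i]).

Definition charf (P : probability V R) (t : V) : C :=
  integralC P (fun x => expC (ii * (dotv t x)%:C%C)).

Lemma expC0 : expC (0 : C) = 1.
Proof. by apply: complex_ext; rewrite /= expR0 ?cos0 ?sin0 mul1r. Qed.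

Lemma expC_neq0 (z : C) : expC z != 0.
Proof. by rewrite -normc_eq0 normc_expC gt_eqF// expR_gt0. Qed.

Lemma normc_expCi (x : R) : normc (expC (ii * x%:C%C)) = 1.
Proof. by rewrite normc_expC /= mul0r mul1r subrr expR0. Qed.

Lemma ev_geomexp (a s : C) : ev (geomexp a) s = expC (a * s).
Proof.
apply: ev_unique; first exact: ent_geomexp.
apply: ccvg_eq (expC_ccvg (a * s)) => n; apply: eq_bigr => k _.
by rewrite /geomexp exprMn mulrA.
Qed.

Lemma ccont_expC (a : C) : ccont (fun s => expC (a * s)).
Proof. by rewrite -(funext (ev_geomexp a)); apply: ccont_ev; exact: ent_geomexp. Qed.

Lemma bnd_geomexp (a : C) (T : R) : 0 <= T -> bnd (geomexp a) T (expR (T * normc a)).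
Proof.
move=> T0 N; have -> : apsum (geomexp a) T N = apsum (invfact R) (T * normc a) N.
  apply: eq_bigr => k _; rewrite /geomexp ComplexField.Normc.normcM normcX exprMn; ring.
by apply: bnd_invfact; rewrite mulr_ge0 ?normc_ge0.
Qed.

Lemma cmeasurable_char (t : V) : cmeasurable (fun x : V => expC (ii * (dotv t x)%:C%C)).
Proof.
apply: cmeasurable_expC; apply: cmeasurableM; first exact: cmeasurable_cst.
by apply: cmeasurable_real; exact: measurable_dotv.
Qed.

Lemma charf0 P : charf P 0 = 1.
Proof.
rewrite /charf; under [X in integralC _ X]eq_fun do rewrite dotv0l mulr0 expC0.
apply: complex_ext => /=; rewrite Rintegral_cst// ?mul0r//.
by rewrite mul1r (_ : 1 = fine (1%E : \bar R))//; congr fine; exact: probability_setT.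
Qed.

Lemma charf_seq P (t : V) (l : nat -> R) (l0 : R) :
  l n @[n --> \oo] --> l0 ->
  ccvg (fun n => charf P (l n *: t)) (charf P (l0 *: t)).
Proof.
move=> hl; apply: (integralC_dominated_cvg (h := cst 1)).
- by move=> n; exact: cmeasurable_char.
- by move=> n x; rewrite normc_expCi.
- by apply: bmf_integrable; exact: bmf_cst.
- move=> x; have := @ccont_expC ii (fun n => (dotv (l n *: t) x)%:C%C) (dotv (l0 *: t) x)%:C%C.
  apply; split => /=; last exact: cvg_cst.
  by under eq_fun do rewrite dotvZl; rewrite dotvZl; apply: cvgM => //; exact: cvg_cst.
Qed.

(** Continuity at 0, where the value is 1. A ray is enough, because the analytic continuation runs
    along one scaling parameter. *)
Lemma charf_near0 P (t : V) :
  exists2 e : R, 0 < e & forall l, 0 < l -> l < e -> charf P (l *: t) != 0.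
Proof.
apply: contrapT => H.
have h n : exists l : R, [/\ 0 < l, l < n.+1%:R^-1 & charf P (l *: t) = 0].
  apply: contrapT => hn; apply: H; exists n.+1%:R^-1 => // l l0 ln.
  by apply/eqP => e; apply: hn; exists l.
have [l hl] := choice h.
have cl : l n @[n --> \oo] --> (0 : R).
  apply: (@squeeze_cvgr _ _ _ _ (fun=> 0) (fun n => n.+1%:R^-1)).
  - by apply: nearW => n; have [h1 h2 _] := hl n; rewrite !ltW.
  - exact: cvg_cst.
  - exact: cvg_harmonic.
have := charf_seq P t cl; rewrite scale0r charf0.
have -> : (fun n => charf P (l n *: t)) = fun=> 0 by apply/funext => n; have [] := hl n.
by move=> /ccvg_uniq /(_ (ccvg_cst 0)) /eqP; rewrite oner_eq0.
Qed.

End CharacteristicFunction.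

(** Multiply the conclusion by q1 q2: each g q becomes f p, and then a p1 p2 becomes a' q1 q2. *)
Lemma cancel_noise (F : fieldType) (a a' f1 f2 g1 g2 p1 p2 q1 q2 : F) :
  q1 != 0 -> q2 != 0 -> a * (p1 * p2) = a' * (q1 * q2) ->
  f1 * p1 = g1 * q1 -> f2 * p2 = g2 * q2 -> a * (g1 * g2) = a' * (f1 * f2).
Proof.
move=> n1 n2 h h1 h2; apply: (mulIf n1); apply: (mulIf n2).
transitivity (a * ((g1 * q1) * (g2 * q2))); first by ring.
rewrite -h1 -h2; transitivity (a * (p1 * p2) * (f1 * f2)); first by ring.
by rewrite h; ring.
Qed.

Section Core.
Context (R : realType) (d : nat).
Local Notation C := R[i].
Local Notation V := 'rV[R]_d.
Local Notation cV := 'rV[R[i]]_d.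
Local Notation cv := (@complex_vec R d).
Local Notation ii := ('i%C : R[i]).
Context (nu nu' : probability (V * V)%type R) (P P' : probability V R).
Context (enu : expmom nu) (enu' : expmom nu').
Context (same_char : forall t1 t2 : V,
  lap nu (ii *: cv t1) (ii *: cv t2) * (charf P t1 * charf P t2) =
  lap nu' (ii *: cv t1) (ii *: cv t2) * (charf P' t1 * charf P' t2)).

Let f z := lap nu z 0.
Let f' z := lap nu' z 0.

Lemma complex_vec0 : cv 0 = 0.
Proof. by apply/rowP => i; rewrite !mxE. Qed.

Lemma complex_vecD (s t : V) : cv (s + t) = cv s + cv t.
Proof. by apply/rowP => i; rewrite !mxE rmorphD. Qed.

Lemma complex_vecZ (k : R) (t : V) : cv (k *: t) = k%:C%C *: cv t.
Proof. by apply/rowP => i; rewrite !mxE rmorphM. Qed.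

Lemma imag_real (l : R) : ii * l%:C%C = (0 +i* l)%C.
Proof. by apply: complex_ext => /=; ring. Qed.

Lemma same_char1 t : f (ii *: cv t) * charf P t = f' (ii *: cv t) * charf P' t.
Proof.
by have := same_char t 0; rewrite complex_vec0 scaler0 !charf0 !mulr1.
Qed.

Let G z1 z2 := lap nu z1 z2 * (f' z1 * f' z2) - lap nu' z1 z2 * (f z1 * f z2).

Lemma G_line (z1 z2 a1 a2 : cV) : exists2 c, ent c &
  forall s, ev c s = G (z1 + s *: a1) (z2 + s *: a2).
Proof.
pose A mu := line_coef mu z1 z2 a1 a2.
pose B mu := conv (line_coef mu z1 0 a1 0) (line_coef mu z2 0 a2 0).
have eB mu : expmom mu -> ent (B mu) by move=> h; apply: ent_conv; exact: ent_line_coef.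
have eA mu : expmom mu -> ent (A mu) by move=> h; exact: ent_line_coef.
have e1 : ent (conv (A nu) (B nu')) by apply: ent_conv; [exact: eA|exact: eB].
have e2 : ent (conv (A nu') (B nu)) by apply: ent_conv; [exact: eA|exact: eB].
exists (fun k => conv (A nu) (B nu') k - conv (A nu') (B nu) k); first exact: entB.
move=> s; rewrite (evB s e1 e2).
have hB mu : expmom mu -> ev (B mu) s = lap mu (z1 + s *: a1) 0 * lap mu (z2 + s *: a2) 0.
  move=> h; rewrite (ev_conv s (ent_line_coef z1 0 a1 0 h) (ent_line_coef z2 0 a2 0 h)).
  by rewrite (ev_line_left z1 0 a1 s h) (ev_line_left z2 0 a2 s h).
rewrite (ev_conv s (eA _ enu) (eB _ enu')) (ev_conv s (eA _ enu') (eB _ enu)).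
by rewrite (hB _ enu) (hB _ enu') (ev_line_coef z1 z2 a1 a2 s enu) (ev_line_coef z1 z2 a1 a2 s enu').
Qed.

(* The characteristic functions of the noises do not vanish near 0, where they
   cancel; analyticity in the scaling of [(t1, t2)] does the rest. *)
Lemma G_imaginary t1 t2 : G (ii *: cv t1) (ii *: cv t2) = 0.
Proof.
have [c ec hc] := G_line 0 0 (cv t1) (cv t2).
have [e1 e10 h1] := charf_near0 P' t1; have [e2 e20 h2] := charf_near0 P' t2.
have c0 : forall k, c k = 0.
  apply: ev_identity => //; exists (Num.min e1 e2); first by rewrite lt_min e10.
  move=> l l0; rewrite lt_min => /andP[l1 l2].
  have lE (t : V) : (0 +i* l)%C *: cv t = ii *: cv (l *: t).
    by rewrite complex_vecZ scalerA imag_real.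
  rewrite (hc (0 +i* l)%C) (add0r (_ *: cv t1)) (add0r (_ *: cv t2)) !lE /G.
  apply/eqP; rewrite subr_eq0; apply/eqP.
  exact: cancel_noise (h1 l l0 l1) (h2 l l0 l2) (same_char _ _) (same_char1 _) (same_char1 _).
have := hc ii; rewrite (ev_zero _ c0) (add0r (_ *: cv t1)) (add0r (_ *: cv t2)) => h; exact: esym h.
Qed.

(** Second continuation. The line starts at i Im z in the real direction Re z: at s = i l its points
    are purely imaginary, where [G] is already known to vanish, and at s = 1 it passes through z. *)
Lemma functional_equation z1 z2 :
  lap nu z1 z2 * (f' z1 * f' z2) = lap nu' z1 z2 * (f z1 * f z2).
Proof.
apply/eqP; rewrite -subr_eq0 -/(G z1 z2); apply/eqP.
have [c ec hc] := G_line (ii *: cv (map_mx (@complex.Im R) z1)) (ii *: cv (map_mx (@complex.Im R) z2))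
  (cv (map_mx (@complex.Re R) z1)) (cv (map_mx (@complex.Re R) z2)).
have c0 : forall k, c k = 0.
  apply: ev_identity => //; exists 1 => // l l0 _.
  have lE (s t : V) : ii *: cv s + (0 +i* l)%C *: cv t = ii *: cv (s + l *: t).
    by rewrite complex_vecD scalerDr complex_vecZ scalerA imag_real.
  by rewrite (hc (0 +i* l)%C) !lE G_imaginary.
have := hc 1; rewrite (ev_zero _ c0) !scale1r => ->.
by rewrite {1}(complex_vecE z1) {1}(complex_vecE z2) (addrC (cv (map_mx _ z1))) (addrC (cv (map_mx _ z2))).
Qed.

(** Neither series is identically zero, so the zeros of both are isolated at 0 and a small s avoids
    them. Along a line from 0 to [zs] this provides a point at which both a section of one transform
    and the marginal of the other, which is 1 at 0, are nonzero. *)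
Lemma common_nonzero (a b : nat -> C) : ent a -> ent b -> ev a 1 != 0 -> ev b 0 != 0 ->
  exists2 w, ev a w != 0 & ev b w != 0.
Proof.
move=> ha hb a1 b0.
have nz (c : nat -> C) s : ent c -> ev c s != 0 -> exists k, c k != 0.
  move=> hc; apply: contra_neqP => H; apply: ev_zero => k; apply/eqP/negPn/negP => ck.
  by apply: H; exists k.
have [e e0 he] := ev_isolated_zeros ha (nz a 1 ha a1).
have [e' e'0 he'] := ev_isolated_zeros hb (nz b 0 hb b0).
pose l := Num.min e e' / 2.
have m0 : 0 < Num.min e e' by rewrite lt_min e0.
have l0 : 0 < l by rewrite divr_gt0.
have ll : l < Num.min e e' by rewrite /l; lra.
move: ll; rewrite lt_min => /andP[l1 l2].
have nl : normc l%:C%C = l by rewrite normc_real gtr0_norm.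
by exists l%:C%C; [apply: he|apply: he']; rewrite nl.
Qed.

Lemma nonzero_left mu mu' (z1 zs : cV) : expmom mu -> expmom mu' ->
  lap mu z1 zs != 0 -> exists2 z2, lap mu z1 z2 != 0 & lap mu' z2 0 != 0.
Proof.
move=> h h' hz.
have [||||w] := @common_nonzero (line_coef mu z1 0 0 zs) (line_coef mu' 0 0 zs 0).
- exact: ent_line_coef.
- exact: ent_line_coef.
- by rewrite (ev_line_right0 z1 zs 1 h) scale1r.
- by rewrite (ev_line_left0 0 zs 0 h') scale0r lap00 oner_eq0.
by rewrite (ev_line_right0 z1 zs w h) (ev_line_left0 0 zs w h'); exists (w *: zs).
Qed.

Lemma nonzero_right mu mu' (z1 zs : cV) : expmom mu -> expmom mu' ->
  lap mu zs z1 != 0 -> exists2 z2, lap mu z2 z1 != 0 & lap mu' z2 0 != 0.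
Proof.
move=> h h' hz.
have [||||w] := @common_nonzero (line_coef mu 0 z1 zs 0) (line_coef mu' 0 0 zs 0).
- exact: ent_line_coef.
- exact: ent_line_coef.
- by rewrite (ev_line_left0 z1 zs 1 h) scale1r.
- by rewrite (ev_line_left0 0 zs 0 h') scale0r lap00 oner_eq0.
by rewrite (ev_line_left0 z1 zs w h) (ev_line_left0 0 zs w h'); exists (w *: zs).
Qed.

Context (nnu : nonnull_sections nu) (nnu' : nonnull_sections nu').

Lemma nonnullP (mu mu' : probability (V * V)%type R) (z0 : cV) : expmom mu -> expmom mu' -> nonnull_sections mu ->
  (exists2 z2, lap mu z0 z2 != 0 & lap mu' z2 0 != 0) \/
  (exists2 z2, lap mu z2 z0 != 0 & lap mu' z2 0 != 0).
Proof.
move=> h h' /(_ z0)[] hn; [left|right].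
- have [zs hzs] : exists z, lap mu z0 z != 0.
    apply: contrapT => H; apply: hn; apply/funext => z; apply/eqP/negPn/negP => hz.
    by apply: H; exists z; rewrite lap.unlock.
  exact: nonzero_left hzs.
- have [zs hzs] : exists z, lap mu z z0 != 0.
    apply: contrapT => H; apply: hn; apply/funext => z; apply/eqP/negPn/negP => hz.
    by apply: H; exists z; rewrite lap.unlock.
  exact: nonzero_right hzs.
Qed.

(* At a given point of the line, the hypothesis on the sections provides [z2] for
   which the relevant cofactor in [functional_equation] does not vanish. *)
Lemma same_zeros_lines (v : V) (al : C) :
  same_zeros (ev (line_coef nu 0 0 (cv v) 0))
             (ev (conv (line_coef nu' 0 0 (cv v) 0) (geomexp al))).
Proof.
pose a := cv v.
have ccl mu z2 : expmom mu -> ccont (fun s => lap mu (s *: a) z2).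
  move=> h; have -> : (fun s => lap mu (s *: a) z2) = ev (line_coef mu 0 z2 a 0).
    by apply/funext => s; rewrite (ev_line_left0 z2 a s h).
  by apply: ccont_ev; exact: ent_line_coef.
have ccr mu z2 : expmom mu -> ccont (fun s => lap mu z2 (s *: a)).
  move=> h; have -> : (fun s => lap mu z2 (s *: a)) = ev (line_coef mu z2 0 0 a).
    by apply/funext => s; rewrite (ev_line_right0 z2 a s h).
  by apply: ccont_ev; exact: ent_line_coef.
have E2 s : ev (conv (line_coef nu' 0 0 a 0) (geomexp al)) s = f' (s *: a) * expC (al * s).
  rewrite ev_conv; [|exact: ent_line_coef|exact: ent_geomexp].
  by rewrite (ev_line_left0 0 a s enu') ev_geomexp.
(* The exponential has no zeros, so its inverse can be moved into the cofactor without affecting the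
   comparison. *)
have ee s : expC (- al * s) * expC (al * s) = 1 by rewrite -expCD mulNr addNr expC0.
have H1 z2 : [/\ ccont (fun s => lap nu (s *: a) z2 * (f' z2 * expC (- al * s))),
    ccont (fun s => lap nu' (s *: a) z2 * f z2) &
    forall s, lap nu (s *: a) z2 * (f' z2 * expC (- al * s)) *
      ev (conv (line_coef nu' 0 0 a 0) (geomexp al)) s =
      lap nu' (s *: a) z2 * f z2 * ev (line_coef nu 0 0 a 0) s].
  split.
  - apply: ccontM; first exact: ccl.
    by apply: ccontM; [exact: ccont_cst|exact: ccont_expC].
  - by apply: ccontM; [exact: ccl|exact: ccont_cst].
  - move=> s; rewrite E2 (ev_line_left0 0 a s enu) -/(f (s *: a)).
    have := functional_equation (s *: a) z2; rewrite -/(f (s *: a)) => fe.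
    have -> : lap nu' (s *: a) z2 * f z2 * f (s *: a) = lap nu' (s *: a) z2 * (f (s *: a) * f z2) by ring.
    rewrite -fe -[RHS]mulr1 -(ee s); ring.
have H2 z2 : [/\ ccont (fun s => lap nu z2 (s *: a) * (f' z2 * expC (- al * s))),
    ccont (fun s => lap nu' z2 (s *: a) * f z2) &
    forall s, lap nu z2 (s *: a) * (f' z2 * expC (- al * s)) *
      ev (conv (line_coef nu' 0 0 a 0) (geomexp al)) s =
      lap nu' z2 (s *: a) * f z2 * ev (line_coef nu 0 0 a 0) s].
  split.
  - apply: ccontM; first exact: ccr.
    by apply: ccontM; [exact: ccont_cst|exact: ccont_expC].
  - by apply: ccontM; [exact: ccr|exact: ccont_cst].
  - move=> s; rewrite E2 (ev_line_left0 0 a s enu) -/(f (s *: a)).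
    have := functional_equation z2 (s *: a); rewrite -/(f (s *: a)) => fe.
    have -> : lap nu' z2 (s *: a) * f z2 * f (s *: a) = lap nu' z2 (s *: a) * (f z2 * f (s *: a)) by ring.
    rewrite -fe -[RHS]mulr1 -(ee s); ring.
move=> z; split.
- have [[z2 n1 n2]|[z2 n1 n2]] := nonnullP (z *: a) enu enu' nnu.
  + have [c1 c2 e] := H1 z2; do 2 eexists; split; [exact: c1|exact: c2|exact: e|].
    by rewrite !mulf_neq0// expC_neq0.
  + have [c1 c2 e] := H2 z2; do 2 eexists; split; [exact: c1|exact: c2|exact: e|].
    by rewrite !mulf_neq0// expC_neq0.
- have [[z2 n1 n2]|[z2 n1 n2]] := nonnullP (z *: a) enu' enu nnu'.
  + have [c1 c2 e] := H1 z2; do 2 eexists; split; [exact: c1|exact: c2|exact: e|].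
    by rewrite !mulf_neq0.
  + have [c1 c2 e] := H2 z2; do 2 eexists; split; [exact: c1|exact: c2|exact: e|].
    by rewrite !mulf_neq0.
Qed.

Context (growth : forall v : V, exists c kappa : R, [/\ 0 <= c, 2 <= kappa, kappa < 4 &
  forall k, bnd (line_coef nu 0 0 (cv v) 0) (6 * 2 ^+ k) (expR (c * kappa ^+ k)) /\
            bnd (line_coef nu' 0 0 (cv v) 0) (6 * 2 ^+ k) (expR (c * kappa ^+ k))]).
Context (m : V) (hm : forall v : V,
  line_coef nu 0 0 (cv v) 0 1%N - line_coef nu' 0 0 (cv v) 0 1%N = (dotv m v)%:C%C).

Lemma line_coef00 mu (a : cV) : expmom mu -> line_coef mu 0 0 a 0 0%N = 1.
Proof.
move=> h; by rewrite -(ev0 (ent_line_coef 0 0 a 0 h)) (ev_line_left0 0 a 0 h) scale0r lap00.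
Qed.

(** The exponential makes the first Taylor coefficients on the line agree, as [same_zeros_eq]
    requires: [hm] says that m.v is exactly their difference. *)
Lemma marginals_translate (v : V) s :
  f (s *: cv v) = f' (s *: cv v) * expC ((dotv m v)%:C%C * s).
Proof.
pose al := (dotv m v)%:C%C : C.
have [c [kappa [c0 k2 k4 hb]]] := growth v.
rewrite /f /f' -(ev_line_left0 0 (cv v) s enu) -(ev_line_left0 0 (cv v) s enu') -ev_geomexp.
rewrite -ev_conv; [|exact: ent_line_coef|exact: ent_geomexp].
(* The exponential factor adds 6 |al| 2^k to the exponent of the bound at radius 6 * 2^k, and 2^k <=
   kappa^k since kappa >= 2. *)
congr (ev _ s); apply: (@same_zeros_eq _ (c + 6 * normc al) kappa) => //.
- by rewrite addr_ge0// mulr_ge0// normc_ge0.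
- lra.
- exact: line_coef00.
- by rewrite /conv big_ord1 line_coef00// mul1r /geomexp /invfact fact0 invr1 mul1r.
- rewrite /conv big_ord_recl big_ord1 /= line_coef00// mul1r.
  rewrite /geomexp /invfact !fact0 !invr1 !mul1r !expr1 mulr1 /bump/= addn0.
  by rewrite -(hm v) subrK.
- exact: ent_line_coef.
- by apply: ent_conv; [exact: ent_line_coef|exact: ent_geomexp].
- move=> k N; rewrite (le_trans ((hb k).1 N))// ler_expR mulrDl lerDl.
  by rewrite !mulr_ge0 ?normc_ge0 ?exprn_ge0//; lra.
- move=> k; have T0 : (0 : R) <= 6 * 2 ^+ k by rewrite mulr_ge0// exprn_ge0.
  move=> N; rewrite (le_trans (bnd_conv T0 (hb k).2 (bnd_geomexp al T0) N))//.
  rewrite -expRD ler_expR [leRHS]mulrDl lerD2l mulrAC ler_wpM2l ?mulr_ge0 ?normc_ge0//.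
  by rewrite lerXn2r// nnegrE; lra.
- exact: same_zeros_lines.
Qed.

(** On the line s -> (1 + s) i t the point s = -1 is the origin, where the transform is 1. The
    restriction is thus not identically zero, and i t is a limit of points of the line where it does
    not vanish. *)
Lemma marginal_isolated_zeros (t : V) : exists2 e : R, 0 < e &
  forall l, 0 < l -> l < e -> f' (ii *: cv ((1 + l) *: t)) != 0.
Proof.
pose a := ii *: cv t.
have hent := ent_line_coef a 0 a 0 enu'.
have evE s : ev (line_coef nu' a 0 a 0) s = f' ((1 + s) *: a).
  by rewrite (ev_line_left a 0 a s enu') scalerDl scale1r.
have [|e e0 he] := ev_isolated_zeros hent.
  apply: contrapT => H; have := evE (-1).
  rewrite ev_zero ?subrr ?scale0r /f' ?lap00; first by move/esym/eqP; rewrite oner_eq0.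
  by move=> k; apply/eqP/negPn/negP => hk; apply: H; exists k.
exists e => // l l0 le; have := he l%:C%C; rewrite normc_real gtr0_norm// => /(_ l0 le).
rewrite evE complex_vecZ scalerA [ii * _]mulrC -scalerA rmorphD rmorph1//.
Qed.

Lemma cvg_one_plus (e : R) : (1 + e / n.+2%:R) @[n --> \oo] --> (1 : R).
Proof.
rewrite -[X in _ --> X]addr0; apply: cvgD; first exact: cvg_cst.
rewrite -[X in _ --> X](mulr0 e); apply: cvgM; first exact: cvg_cst.
have := @cvg_harmonic R; rewrite -(@cvg_shiftS R); exact.
Qed.

Lemma cvg_one_plusM (e x : R) : ((1 + e / n.+2%:R) * x) @[n --> \oo] --> x.
Proof.
by rewrite -[X in _ --> X]mul1r; apply: cvgM; [exact: cvg_one_plus|exact: cvg_cst].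
Qed.

(** Where f' does not vanish it cancels from [same_char1] combined with [marginals_translate];
    elsewhere t is approached along its own ray. *)
Lemma noise_translate t : charf P' t = expC (ii * (dotv m t)%:C%C) * charf P t.
Proof.
have [e e0 he] := marginal_isolated_zeros t.
(* The shift by 2 keeps e / (n + 2) strictly between 0 and e for every n. *)
pose l n := 1 + e / n.+2%:R.
have ln n : f' (ii *: cv (l n *: t)) != 0.
  apply: he; first by rewrite divr_gt0.
  by rewrite ltr_pdivrMr// ltr_pMr// ltr1n.
have eqn n : charf P' (l n *: t) = expC (ii * (dotv m (l n *: t))%:C%C) * charf P (l n *: t).
  apply: (mulfI (ln n)); rewrite -same_char1 marginals_translate mulrA.
  by rewrite [(_)%:C%C * ii]mulrC.
have h1 := charf_seq P' t (cvg_one_plus e); have h2 := charf_seq P t (cvg_one_plus e).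
rewrite !scale1r in h1 h2; apply: ccvg_uniq h1 _.
rewrite (funext eqn); apply: ccvgM => //.
have := @ccont_expC R ii (fun n => (dotv m (l n *: t))%:C%C) (dotv m t)%:C%C; apply.
split => /=; last exact: cvg_cst.
by under eq_fun do rewrite dotvC dotvZl dotvC; exact: cvg_one_plusM.
Qed.

(** In [functional_equation] replace both f by f' times an exponential, cancel the two values of f'
    where they are nonzero, and pass to the limit with one scaling that serves t1 and t2
    together. *)
Lemma pair_translate t1 t2 : lap nu (ii *: cv t1) (ii *: cv t2) =
  lap nu' (ii *: cv t1) (ii *: cv t2) * expC (ii * (dotv m t1 + dotv m t2)%:C%C).
Proof.
have [e1 e10 h1] := marginal_isolated_zeros t1.
have [e2 e20 h2] := marginal_isolated_zeros t2.
pose e := Num.min e1 e2.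
have e0 : 0 < e by rewrite lt_min e10.
pose l n := 1 + e / n.+2%:R.
have le n : e / n.+2%:R < e by rewrite ltr_pdivrMr// ltr_pMr// ltr1n.
have ln1 n : f' (ii *: cv (l n *: t1)) != 0.
  by apply: h1; rewrite ?divr_gt0// (lt_le_trans (le n))// ge_min lexx.
have ln2 n : f' (ii *: cv (l n *: t2)) != 0.
  by apply: h2; rewrite ?divr_gt0// (lt_le_trans (le n))// ge_min lexx orbT.
have eqn n : lap nu (ii *: cv (l n *: t1)) (ii *: cv (l n *: t2)) =
    lap nu' (ii *: cv (l n *: t1)) (ii *: cv (l n *: t2)) *
    expC (ii * (dotv m (l n *: t1) + dotv m (l n *: t2))%:C%C).
  apply: (mulIf (ln1 n)); apply: (mulIf (ln2 n)).
  have := functional_equation (ii *: cv (l n *: t1)) (ii *: cv (l n *: t2)).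
  rewrite [f (_ *: cv (_ *: t1))]marginals_translate [f (_ *: cv (_ *: t2))]marginals_translate => fe.
  rewrite -!mulrA fe rmorphD/= mulrDr expCD ![ii * _]mulrC; ring.
have cl mu : expmom mu -> ccvg (fun n => lap mu (ii *: cv (l n *: t1)) (ii *: cv (l n *: t2)))
    (lap mu (ii *: cv t1) (ii *: cv t2)).
  move=> h.
  have E s : lap mu (s *: (ii *: cv t1)) (s *: (ii *: cv t2)) =
      ev (line_coef mu 0 0 (ii *: cv t1) (ii *: cv t2)) s.
    by rewrite (ev_line_coef 0 0 _ _ s h) (add0r (_ *: (ii *: cv t1))) (add0r (_ *: (ii *: cv t2))).
  have E' n (t : V) : ii *: cv (l n *: t) = (l n)%:C%C *: (ii *: cv t).
    by rewrite complex_vecZ !scalerA mulrC.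
  under eq_fun do rewrite !E' E.
  rewrite -[ii *: cv t1]scale1r -[ii *: cv t2]scale1r E !scale1r.
  apply: ccont_ev; first exact: ent_line_coef.
  by split => /=; [exact: cvg_one_plus|exact: cvg_cst].
apply: ccvg_uniq (cl nu enu) _; rewrite (funext eqn); apply: ccvgM; first exact: cl.
have := @ccont_expC R ii (fun n => (dotv m (l n *: t1) + dotv m (l n *: t2))%:C%C)
  (dotv m t1 + dotv m t2)%:C%C; apply.
split => /=; last exact: cvg_cst.
have E n : dotv m (l n *: t1) + dotv m (l n *: t2) = l n * (dotv m t1 + dotv m t2).
  by rewrite !(dotvC m) !dotvZl mulrDr.
by under eq_fun do rewrite /= E; exact: cvg_one_plusM.
Qed.

End Core.

(** * The law of two consecutive observations *)

Section Laws.
Context (R : realType) (d1 d2 : measure_display).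
Context (T1 : measurableType d1) (T2 : measurableType d2).
Context (nu : probability T1 R) (mu : probability T2 R) (phi : T1 -> T2).
Context (mphi : measurable_fun setT phi).
Context (law : forall A, measurable A -> nu (phi @^-1` A) = mu A).

Lemma ge0_integral_law (h : T2 -> \bar R) : measurable_fun setT h ->
  (forall y, (0 <= h y)%E) -> (\int[nu]_x h (phi x) = \int[mu]_y h y)%E.
Proof.
move=> mh h0; pose X : {mfun T1 >-> T2} := HB.pack phi (isMeasurableFun.Build _ _ _ _ phi mphi).
rewrite -(@ge0_integral_distribution _ _ _ _ _ nu X)//.
by apply: eq_measure_integral => A mA _; exact: law.
Qed.

Lemma integral_law (h : T2 -> \bar R) : measurable_fun setT h ->
  (\int[nu]_x h (phi x) = \int[mu]_y h y)%E.
Proof.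
move=> mh; rewrite integralE [RHS]integralE; congr (_ - _)%E.
- rewrite -(ge0_integral_law (measurable_funepos mh) (funepos_ge0 h)).
  by apply: eq_integral => x _; exact: (congr1 (@^~ x) (funepos_comp h phi)).
- rewrite -(ge0_integral_law (measurable_funeneg mh) (funeneg_ge0 h)).
  by apply: eq_integral => x _; exact: (congr1 (@^~ x) (funeneg_comp h phi)).
Qed.

Lemma Rintegral_law (h : T2 -> R) : measurable_fun setT h ->
  \int[nu]_x h (phi x) = \int[mu]_y h y.
Proof.
move=> mh; congr fine; apply: (integral_law (h := EFin \o h)).
exact/measurable_EFinP.
Qed.

Lemma integralC_law (h : T2 -> R[i]) : cmeasurable h ->
  integralC nu (fun x => h (phi x)) = integralC mu h.
Proof. by move=> [m1 m2]; apply: complex_ext; apply: Rintegral_law. Qed.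

Lemma integrable_law (h : T2 -> R) : measurable_fun setT h -> (forall y, 0 <= h y) ->
  mu.-integrable setT (EFin \o h) -> nu.-integrable setT (EFin \o (fun x => h (phi x))).
Proof.
move=> mh h0 /integrableP[_ ih]; apply/integrableP; split.
  by apply/measurable_EFinP; exact: measurableT_comp.
apply: le_lt_trans ih; rewrite -(integral_law (h := fun y => `|(h y)%:E|%E))//.
by apply: measurableT_comp => //; exact/measurable_EFinP.
Qed.

End Laws.

Definition prob_prod (R : realType) (d1 d2 : measure_display)
    (T1 : measurableType d1) (T2 : measurableType d2)
    (mu : probability T1 R) (nu : probability T2 R) : set (T1 * T2) -> \bar R :=
  (mu \x nu)%E.

Section ProductProbability.
Context (R : realType) (d1 d2 : measure_display).
Context (T1 : measurableType d1) (T2 : measurableType d2).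
Context (mu : probability T1 R) (nu : probability T2 R).

HB.instance Definition _ := Measure.on (prob_prod mu nu).

Let prob_prodT : prob_prod mu nu setT = 1%E.
Proof.
rewrite /prob_prod -setXTT product_measure1E//.
by rewrite -[RHS]mul1e; congr (_ * _)%E; exact: probability_setT.
Qed.

HB.instance Definition _ := Measure_isProbability.Build _ _ _ (prob_prod mu nu) prob_prodT.

Lemma Rintegral_prod (f : T1 -> R) (g : T2 -> R) : bmf f -> bmf g ->
  \int[prob_prod mu nu]_z (f z.1 * g z.2) = \int[mu]_x f x * \int[nu]_y g y.
Proof.
move=> bf bg.
have bfg : bmf (fun z : T1 * T2 => f z.1 * g z.2).
  apply: bmfM.
  - case: bf => mf [M hM]; split; first exact: (measurableT_comp mf measurable_fst).
    by exists M => z; exact: hM.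
  - case: bg => mg [M hM]; split; first exact: (measurableT_comp mg measurable_snd).
    by exists M => z; exact: hM.
have i := bmf_integrable (prob_prod mu nu) bfg.
have gf : (\int[nu]_y (g y)%:E)%E = (\int[nu]_y g y)%:E.
  by rewrite /Rintegral fineK//; apply: integrable_fin_num => //; exact: bmf_integrable.
rewrite {1}/Rintegral -(integral12_prod_meas1 i) -RintegralZr//; last exact: bmf_integrable.
congr fine; apply: eq_integral => x _ /=.
rewrite /fubini_F /=.
under eq_integral do rewrite EFinM.
by rewrite integralZl//= ?gf//; exact: bmf_integrable.
Qed.

Lemma bmf_Re (d0 : measure_display) (T : measurableType d0) (f : T -> R[i]) (M : R) :
  cmeasurable f -> (forall x, normc (f x) <= M) -> bmf (fun x => Re (f x)).
Proof. by move=> [m1 _] h; split => //; exists M => x; exact: le_trans (normc_Re _) (h x). Qed.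

Lemma bmf_Im (d0 : measure_display) (T : measurableType d0) (f : T -> R[i]) (M : R) :
  cmeasurable f -> (forall x, normc (f x) <= M) -> bmf (fun x => Im (f x)).
Proof. by move=> [_ m1] h; split => //; exists M => x; exact: le_trans (normc_Im _) (h x). Qed.

Lemma integralC_prod (f : T1 -> R[i]) (g : T2 -> R[i]) (M : R) :
  cmeasurable f -> cmeasurable g ->
  (forall x, normc (f x) <= M) -> (forall x, normc (g x) <= M) ->
  integralC (prob_prod mu nu) (fun z => f z.1 * g z.2) = integralC mu f * integralC nu g.
Proof.
move=> mf mg hf hg.
have b (h1 : T1 -> R) (h2 : T2 -> R) : bmf h1 -> bmf h2 ->
    (prob_prod mu nu).-integrable setT (EFin \o (fun z => h1 z.1 * h2 z.2)).
  move=> [m1 [M1 b1]] [m2 [M2 b2]]; apply: bmf_integrable; apply: bmfM; split.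
  - exact: (measurableT_comp m1 measurable_fst).
  - by exists M1 => z; exact: b1.
  - exact: (measurableT_comp m2 measurable_snd).
  - by exists M2 => z; exact: b2.
have [rf jf] := (bmf_Re mf hf, bmf_Im mf hf); have [rg jg] := (bmf_Re mg hg, bmf_Im mg hg).
apply: complex_ext.
- transitivity (\int[prob_prod mu nu]_z (Re (f z.1) * Re (g z.2) - Im (f z.1) * Im (g z.2))).
    by apply: eq_Rintegral => z _; exact: cReM.
  by rewrite cReM RintegralB//; [rewrite (Rintegral_prod rf rg) (Rintegral_prod jf jg)|exact: (b _ _ rf rg)|exact: (b _ _ jf jg)].
- transitivity (\int[prob_prod mu nu]_z (Re (f z.1) * Im (g z.2) + Im (f z.1) * Re (g z.2))).
    by apply: eq_Rintegral => z _; exact: cImM.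
  by rewrite cImM RintegralD//; [rewrite (Rintegral_prod rf jg) (Rintegral_prod jf rg)|exact: (b _ _ rf jg)|exact: (b _ _ jf rg)].
Qed.

End ProductProbability.

Section PairLaw.
Context (R : realType) (d : nat).
Local Notation V := 'rV[R]_d.
Local Notation cv := (@complex_vec R d).
Context (K : R.-pker V ~> V) (mu : probability V R).

Lemma pair_law_rect A B : measurable A -> measurable B ->
  pair_law mu K (A `*` B) = (\int[mu]_(x in A) K x B)%E.
Proof.
move=> mA mB; rewrite /pair_law [RHS]integral_mkcond; apply: eq_integral => x _.
rewrite patchE; case: ifPn => xA.
- transitivity (\int[K x]_y (\1_B y)%:E)%E; last by rewrite integral_indic// setIT.
  by apply: eq_integral => y _; rewrite !indicE in_setX/= xA.
- by rewrite integral0_eq// => y _; rewrite indicE in_setX/= (negbTE xA).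
Qed.

Lemma pair_law_fst A : measurable A -> pair_law mu K (fst @^-1` A) = mu A.
Proof.
move=> mA; rewrite (_ : fst @^-1` A = A `*` setT); last by apply/seteqP; split => x //= [].
rewrite pair_law_rect// (eq_integral (cst 1%E)); last by move=> x _; exact: prob_kernel.
by rewrite integral_cst// mul1e.
Qed.

Lemma pair_law_snd A : stationary K mu -> measurable A -> pair_law mu K (snd @^-1` A) = mu A.
Proof.
move=> st mA; rewrite (_ : snd @^-1` A = setT `*` A); last by apply/seteqP; split => x //= [].
by rewrite pair_law_rect// st.
Qed.

End PairLaw.

Lemma probability_rect_unique (R : realType) (d1 d2 : measure_display)
    (T1 : measurableType d1) (T2 : measurableType d2)
    (P Q : probability (T1 * T2)%type R) :
  (forall A B, measurable A -> measurable B -> P (A `*` B) = Q (A `*` B)) ->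
  forall X, measurable X -> P X = Q X.
Proof.
move=> h X mX.
pose G := [set Z : set (T1 * T2) | exists A, measurable A /\ exists B, measurable B /\ Z = A `*` B].
apply: (measure_unique G (fun=> setT)) => //.
- rewrite measurable_prod_measurableType; congr (<<s _ >>).
  apply/seteqP; split => [_ [A mA [B mB <-]]|_ [A [mA [B [mB ->]]]]].
    by exists A; split => //; exists B.
  by exists A => //; exists B.
- move=> _ _ [A [mA [B [mB ->]]]] [A' [mA' [B' [mB' ->]]]].
  exists (A `&` A'); split; first exact: measurableI.
  by exists (B `&` B'); split; [exact: measurableI|rewrite setXI].
- by move=> _; exists setT; split => //; exists setT; split => //; rewrite setXTT.
- by rewrite bigcup_const.
- by move=> _ [A [mA [B [mB ->]]]]; exact: h.
- by move=> _; rewrite (le_lt_trans (probability_le1 P measurableT))// ltry.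
Qed.

Section ObservationLaw.
Context (R : realType) (d : nat).
Local Notation C := R[i].
Local Notation V := 'rV[R]_d.
Local Notation cv := (@complex_vec R d).
Local Notation ii := ('i%C : R[i]).

Lemma measurable_seq_coord i : measurable_fun setT (fun y : seq_space R d => y i : V).
Proof. by move=> _ B mB; rewrite setTI; apply: sub_sigma_algebra; exists i; exists B. Qed.

Lemma measurable_seq_pair : measurable_fun setT (fun y : seq_space R d => (y 0%N, y 1%N) : V * V).
Proof. by apply: measurable_fun_pair; exact: measurable_seq_coord. Qed.

Lemma measurable_rVD (d0 : measure_display) (T : measurableType d0) (f g : T -> V) :
  measurable_fun setT f -> measurable_fun setT g -> measurable_fun setT (fun x => f x + g x).
Proof.
move=> mf mg; apply: measurable_fun_rV => i; under eq_fun do rewrite mxE.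
by apply: measurable_funD; apply: (measurableT_comp (measurable_coord i)).
Qed.

Lemma cmeasurable_comp (d1 d2 : measure_display) (T1 : measurableType d1) (T2 : measurableType d2)
    (f : T2 -> C) (g : T1 -> T2) :
  cmeasurable f -> measurable_fun setT g -> cmeasurable (fun x => f (g x)).
Proof. by move=> [m1 m2] mg; split; [exact: (measurableT_comp m1)|exact: (measurableT_comp m2)]. Qed.

Section Realization.
Context (K : R.-pker V ~> V) (mu P : probability V R).
Context (d0 : measure_display) (Omega : measurableType d0) (Pr : probability Omega R).
Context (X e : nat -> {RV Pr >-> V}).
Context (mc : markov_chain K X) (lX : has_law (X 0%N) mu).
Context (ie : mutually_independent e) (le : forall i, has_law (e i) P).
Context (iXe : independent_sequences X e).

Let mX i : measurable_fun setT (X i : Omega -> V). Proof. exact: measurable_funPT. Qed.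
Let me i : measurable_fun setT (e i : Omega -> V). Proof. exact: measurable_funPT. Qed.

Let XX w : V * V := (X 0%N w, X 1%N w).
Let EE w : V * V := (e 0%N w, e 1%N w).
Let mXX : measurable_fun setT XX. Proof. exact: measurable_fun_pair. Qed.
Let mEE : measurable_fun setT EE. Proof. exact: measurable_fun_pair. Qed.

Lemma consecutive_states_law A : measurable A -> Pr (XX @^-1` A) = pair_law mu K A.
Proof.
pose F : {mfun Omega >-> (V * V)%type} := HB.pack XX (isMeasurableFun.Build _ _ _ _ XX mXX).
apply: (@probability_rect_unique _ _ _ _ _ (distribution Pr F)) => {}A B mA mB.
rewrite [RHS]pair_law_rect//.
(* The Markov property is used at time 0 only, where the past is the 1-tuple formed by X_0. *)
have mH : measurable [set t : 1.-tuple V | A (tnth t ord0)].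
  rewrite -[X in measurable X]setTI.
  exact: (measurable_tnth ord0).
have := mc mH mB; rewrite /=.
have -> : [set w | A (tnth [tuple X i w | i < 1] ord0)] = X 0%N @^-1` A.
  by apply/seteqP; split => w /=; rewrite tnth_mktuple.
move=> h; transitivity (Pr (X 0%N @^-1` A `&` X 1%N @^-1` B)); first by [].
rewrite h.
have mK : measurable_fun setT (K ^~ B) by exact: measurable_kernel.
rewrite -(@ge0_integral_pushforward _ _ _ _ R (X 0%N) (mX 0%N) Pr A (K ^~ B))//.
- apply: (@eq_measure_integral _ V R A mu (distribution Pr (X 0%N))) => Z mZ _.
  exact: lX.
- exact: measurable_funS mK.
Qed.

Lemma noise_pair_law A : measurable A -> Pr (EE @^-1` A) = prob_prod P P A.
Proof.
pose F : {mfun Omega >-> (V * V)%type} := HB.pack EE (isMeasurableFun.Build _ _ _ _ EE mEE).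
apply: (@probability_rect_unique _ _ _ _ _ (distribution Pr F)) => {}A B mA mB.
rewrite [RHS]product_measure1E//.
(* Independence is stated for a whole sequence of events; only the indices 0 and 1 matter here. *)
have mAB j : measurable (if j == 0%N then A else B) by case: ifP.
have := ie [fset 0%N; 1%N]%fset mAB.
rewrite (_ : [set` _] = [set 0%N; 1%N]); last first.
  apply/seteqP; split => j /=; rewrite !inE.
    by move=> /orP[/eqP ->|/eqP ->]; [left|right].
  by move=> [->|->]; rewrite eqxx ?orbT.
rewrite bigcap_setU !bigcap_set1 /= big_fsetU1 ?inE//= big_seq_fset1 => h.
transitivity (Pr (e 0%N @^-1` A `&` e 1%N @^-1` B)); first by [].
by rewrite h; congr (_ * _)%E; exact: le.
Qed.

Let J w := (XX w, EE w).
Let mJ : measurable_fun setT J. Proof. exact: measurable_fun_pair. Qed.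

Lemma joint_law A : measurable A -> Pr (J @^-1` A) = prob_prod (pair_law mu K) (prob_prod P P) A.
Proof.
pose F : {mfun Omega >-> ((V * V) * (V * V))%type} := HB.pack J (isMeasurableFun.Build _ _ _ _ J mJ).
apply: (@probability_rect_unique _ _ _ _ _ (distribution Pr F)) => {}A B mA mB.
rewrite [RHS]product_measure1E//.
have mS (Z : set (V * V)) : measurable Z ->
    measurable [set y : seq_space R d | Z (y 0%N, y 1%N)].
  by move=> mZ; rewrite -[X in measurable X]setTI; exact: measurable_seq_pair.
have := iXe (mS _ mA) (mS _ mB) => /= h.
transitivity (Pr (XX @^-1` A `&` EE @^-1` B)); first by [].
rewrite -(consecutive_states_law mA); rewrite [X in _ = (_ * X)%E](_ : _ = Pr (EE @^-1` B)).
  exact: h.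
by rewrite noise_pair_law.
Qed.

Lemma realization_char t1 t2 :
  integralC Pr (fun w => expC (pairing (ii *: cv t1) (ii *: cv t2)
    (X 0%N w + e 0%N w, X 1%N w + e 1%N w))) =
  lap (pair_law mu K) (ii *: cv t1) (ii *: cv t2) * (charf P t1 * charf P t2).
Proof.
pose g1 (x : V * V) := expC (pairing (ii *: cv t1) (ii *: cv t2) x).
pose ch t (x : V) := expC (ii * (dotv t x)%:C%C).
pose g2 (x : V * V) := ch t1 x.1 * ch t2 x.2.
have m1 : cmeasurable g1 by apply: cmeasurable_expC; exact: cmeasurable_pairing.
have m2 : cmeasurable g2.
  apply: cmeasurableM; [apply: (cmeasurable_comp (cmeasurable_char t1))|apply: (cmeasurable_comp (cmeasurable_char t2))].
    exact: measurable_fst.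
  exact: measurable_snd.
have pE (x : V * V) : pairing (ii *: cv t1) (ii *: cv t2) x =
    ii * (dotv t1 x.1)%:C%C + ii * (dotv t2 x.2)%:C%C.
  by rewrite /pairing !dotvZl !dotv_complex_vec.
have n2 t x : normc (ch t x) <= 1 by rewrite normc_expCi.
have n1 x : normc (g1 x) <= 1.
  by rewrite /g1 pE expCD ComplexField.Normc.normcM !normc_expCi mulr1.
have E w : expC (pairing (ii *: cv t1) (ii *: cv t2) (X 0%N w + e 0%N w, X 1%N w + e 1%N w)) =
    g1 (J w).1 * g2 (J w).2.
  rewrite /g1 /g2 /ch !pE /= -!expCD; congr expC.
  by rewrite !dotvDr !rmorphD/=; ring.
rewrite (funext E).
rewrite (@integralC_law _ _ _ _ _ Pr (prob_prod (pair_law mu K) (prob_prod P P)) J mJ joint_law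
  (fun z => g1 z.1 * g2 z.2)); last first.
  by apply: cmeasurableM; [exact: (cmeasurable_comp m1 measurable_fst)|exact: (cmeasurable_comp m2 measurable_snd)].
rewrite (@integralC_prod _ _ _ _ _ _ _ _ _ 1)//; last first.
  by move=> x; rewrite /g2 ComplexField.Normc.normcM !normc_expCi mulr1.
rewrite -lapE; congr (_ * _).
by rewrite (@integralC_prod _ _ _ _ _ _ _ _ _ 1)//; exact: cmeasurable_char.
Qed.

End Realization.

(** The left side depends on Q alone. The hypothesis that the two observation laws agree enters the
    argument through this identity. *)
Lemma observation_char (K : R.-pker V ~> V) (mu P : probability V R)
    (Q : probability (seq_space R d) R) t1 t2 : is_observation_law K mu P Q ->
  integralC Q (fun y => expC (pairing (ii *: cv t1) (ii *: cv t2) (y 0%N, y 1%N))) =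
  lap (pair_law mu K) (ii *: cv t1) (ii *: cv t2) * (charf P t1 * charf P t2).
Proof.
move=> [d0 [ Om [Pr [X [e [[mc lX] [ie le] iXe hQ]]]]]].
rewrite -(realization_char mc lX ie le iXe).
pose phi (w : Om) : seq_space R d := fun i => X i w + e i w.
have mphi : measurable_fun setT phi.
  apply: (@measurability _ _ _ (seq_space R d) setT phi (@coordinate_sets R d)) => //.
  move=> _ [_ [i [B mB ->]] <-].
  have : measurable_fun setT (fun w => X i w + e i w).
    by apply: measurable_rVD; exact: measurable_funPT.
  exact.
rewrite -(@integralC_law _ _ _ _ _ Pr Q phi mphi _
  (fun y => expC (pairing (ii *: cv t1) (ii *: cv t2) (y 0%N, y 1%N))))//.
- by move=> A mA; rewrite (hQ A mA).
- apply: (@cmeasurable_comp _ _ _ _ (fun x : V * V => expC (pairing (ii *: cv t1) (ii *: cv t2) x))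
    (fun y : seq_space R d => (y 0%N, y 1%N) : V * V)); last exact: measurable_seq_pair.
  by apply: cmeasurable_expC; exact: cmeasurable_pairing.
Qed.

End ObservationLaw.

(** * Growth of the marginal Laplace transform *)

Section LightTails.
Context (R : realType) (d : nat).
Local Notation V := 'rV[R]_d.
Local Notation cv := (@complex_vec R d).

Lemma euclidean_normZ (k : R) (v : V) : euclidean_norm (k *: v) = `|k| * euclidean_norm v.
Proof.
rewrite /euclidean_norm dotvZl dotvC dotvZl mulrA -expr2 sqrtrM ?sqr_ge0//.
by rewrite sqrtr_sqr.
Qed.

Lemma measurable_expR_dotv (u : V) : measurable_fun setT (fun x => expR (dotv u x)).
Proof. by apply: measurableT_comp => //; exact: measurable_dotv. Qed.

Section Marginal.
Context (mu : probability V R) (rho : R) (tail : light_tailed rho mu).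
Context (nu : probability (V * V)%type R).
Context (law1 : forall A : set V, measurable A -> nu (fst @^-1` A) = mu A).

Lemma light_tailed_integrable (u : V) :
  mu.-integrable setT (EFin \o (fun x => expR (dotv u x))).
Proof.
case: tail => A [B [_ _ h]]; apply/integrableP; split.
  by apply/measurable_EFinP; exact: measurable_expR_dotv.
under eq_integral do rewrite /= ger0_norm ?expR_ge0//.
exact: le_lt_trans (h u) (ltry _).
Qed.

Lemma light_tailed_bound : exists A B : R, [/\ 0 < A, 0 < B & forall u : V,
  \int[mu]_x expR (dotv u x) <= A * expR (B * euclidean_norm u `^ rho)].
Proof.
case: tail => A [B [A0 B0 h]]; exists A, B; split => // u.
rewrite -lee_fin /Rintegral fineK//.
by apply: integrable_fin_num => //; exact: light_tailed_integrable.
Qed.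

(** exp(a + b) <= exp(2 a) + exp(2 b), so exponential moments of the two marginals suffice whatever
    the dependence between the coordinates. *)
Lemma expmom_of_marginals : (forall A : set V, measurable A -> nu (snd @^-1` A) = mu A) ->
  expmom nu.
Proof.
move=> law2 u1 u2.
have i1 := integrable_law measurable_fst law1 (measurable_expR_dotv (2 *: u1))
  (fun y => expR_ge0 _) (light_tailed_integrable _).
have i2 := integrable_law measurable_snd law2 (measurable_expR_dotv (2 *: u2))
  (fun y => expR_ge0 _) (light_tailed_integrable _).
apply: (le_integrable measurableT _ _ (integrableD measurableT i1 i2)).
  by apply/measurable_EFinP; apply: measurableT_comp => //; exact: measurable_dotv2.
move=> [x y] _ /=; rewrite lee_fin !dotvZl ger0_norm ?expR_ge0//.
rewrite ger0_norm ?addr_ge0 ?expR_ge0//.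
set a := dotv u1 x; set b := dotv u2 y.
case: (leP a b) => ab.
- rewrite (le_trans (y := expR (2 * b))) ?lerDr ?expR_ge0// ler_expR; lra.
- rewrite (le_trans (y := expR (2 * a))) ?lerDl ?expR_ge0// ler_expR; lra.
Qed.

Lemma pairing_real (v : V) x : pairing (cv v) 0 x = (dotv v x.1)%:C%C.
Proof. by rewrite /pairing dotv_complex_vec dotv0l addr0. Qed.

(** The constant 4 A collects the factor 2 of [normc_integralC] and the two signs in exp(S |x|) <=
    exp(S x) + exp(-S x). *)
Lemma marginal_bnd (enu : expmom nu) : exists A B : R, [/\ 0 < A, 0 < B & forall v S, 0 <= S ->
  bnd (line_coef nu 0 0 (cv v) 0) S (A * expR (B * (S * euclidean_norm v) `^ rho))].
Proof.
case: light_tailed_bound => A [B [A0 B0 h]]; exists (4 * A), B; split => //; first lra.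
move=> v S S0 N; apply: (le_trans (bnd_line_coef (cv v) 0 enu S0 N)).
under eq_Rintegral do rewrite pairing_real normc_real.
have mS : measurable_fun setT (fun x => expR (S * `|dotv v x|)).
  apply: measurableT_comp => //; apply: measurable_funM => //.
  by apply: measurableT_comp => //; exact: measurable_dotv.
rewrite (Rintegral_law measurable_fst law1 mS).
have [i1 i2] := (light_tailed_integrable (S *: v), light_tailed_integrable (- S *: v)).
have le1 x : expR (S * `|dotv v x|) <= expR (dotv (S *: v) x) + expR (dotv (- S *: v) x).
  by rewrite !dotvZl; exact: expR_abs_le.
have iD := integrableD measurableT i1 i2.
have : \int[mu]_x expR (S * `|dotv v x|) <= 
    \int[mu]_x (expR (dotv (S *: v) x) + expR (dotv (- S *: v) x)).
  apply: le_Rintegral => //.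
  apply: (le_integrable measurableT _ _ iD); first exact/measurable_EFinP.
  move=> x _ /=; rewrite lee_fin (ger0_norm (expR_ge0 _)) (le_trans (le1 x))//.
  exact: ler_norm.
rewrite RintegralD// => h1.
have := h (S *: v); have := h (- S *: v).
rewrite !euclidean_normZ normrN (ger0_norm S0).
move: h1; set I0 := \int[mu]_x _; set I1 := \int[mu]_x _; set I2 := \int[mu]_x _; set e := expR _.
move=> *; lra.
Qed.

End Marginal.

Lemma two_powR_lt4 (rho : R) : rho < 2 -> 2 `^ rho < 4.
Proof.
move=> h; rewrite (_ : 4 = 2 `^ 2%:R); last by rewrite powR_mulrn// expr2; lra.
by rewrite /powR pnatr_eq0/= ltr_expR ltr_pM2r// ln_gt0//; lra.
Qed.

(** Doubling the radius multiplies its power rho by 2^rho, which is below 4. The maximum with 2 lets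
    kappa^k >= 1 absorb the constant ln A, and later the growth of an exponential factor. *)
Lemma geometric_growth (A B n rho : R) : 0 < A -> 0 < B -> 0 <= n -> rho < 2 ->
  exists2 c : R, 0 <= c & forall k,
    A * expR (B * (6 * 2 ^+ k * n) `^ rho) <= expR (c * (Num.max 2 (2 `^ rho)) ^+ k).
Proof.
move=> A0 B0 n0 h; exists (`|ln A| + B * (6 * n) `^ rho).
  by rewrite addr_ge0// mulr_ge0 ?powR_ge0// ltW.
move=> k; set kap := Num.max _ _.
have k1 : 1 <= kap ^+ k by rewrite exprn_ege1// /kap le_max; apply/orP; left; lra.
have eA : A = expR (ln A) by rewrite lnK.
rewrite [in leLHS]eA -expRD ler_expR [leRHS]mulrDl lerD//.
  by rewrite (le_trans (ler_norm _))// ler_peMr.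
rewrite -[leRHS]mulrA ler_wpM2l ?(ltW B0)//.
have -> : 6 * 2 ^+ k * n = 6 * n * 2 ^+ k by rewrite mulrAC.
rewrite powRM ?mulr_ge0 ?exprn_ge0//; apply: ler_wpM2l; first exact: powR_ge0.
rewrite -powR_mulrn// powRAC powR_mulrn ?powR_ge0//.
by rewrite lerXn2r ?nnegrE ?powR_ge0 ?le_max ?lexx ?orbT//; lra.
Qed.


Section Mean.
Context (mu : probability V R) (rho : R) (tail : light_tailed rho mu).

Definition mean_vec : V := \row_i \int[mu]_x (x 0 i).

(** |x_i| <= exp(x_i) + exp(-x_i), from 1 + y <= exp y at y = x_i and y = -x_i. *)
Lemma coord_integrable i : mu.-integrable setT (EFin \o (fun x : V => x 0 i)).
Proof.
have e (x : V) k : dotv (k *: delta_mx 0 i) x = k * x 0 i.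
  rewrite dotvZl /dotv (bigD1 i)//= mxE !eqxx mul1r big1 ?addr0// => j ji.
  by rewrite mxE (negbTE ji) andbF mul0r.
have iD := integrableD measurableT (light_tailed_integrable tail (1 *: delta_mx 0 i))
  (light_tailed_integrable tail ((-1) *: delta_mx 0 i)).
apply: (le_integrable measurableT _ _ iD).
  by apply/measurable_EFinP; exact: measurable_coord.
move=> x _ /=; rewrite lee_fin !e !mul1r mulN1r [leRHS]ger0_norm ?addr_ge0 ?expR_ge0//.
have [h1 h2] := (expR_ge1Dx (x 0 i), expR_ge1Dx (- x 0 i)).
have [h3 h4] := (expR_ge0 (x 0 i), expR_ge0 (- x 0 i)).
by rewrite ler_norml; apply/andP; split; lra.
Qed.

Lemma Rintegral_dotv v : \int[mu]_x dotv v x = dotv v mean_vec.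
Proof.
rewrite /dotv; under [RHS]eq_bigr do rewrite mxE.
suff [] : mu.-integrable setT (EFin \o (fun x : V => \sum_i v 0 i * x 0 i)) /\
  \int[mu]_x (\sum_i v 0 i * x 0 i) = \sum_i v 0 i * \int[mu]_x (x 0 i) by [].
elim: (index_enum _) => [|i r [IH1 IH2]].
  rewrite big_nil; under eq_fun do rewrite big_nil; split.
    by apply: bmf_integrable; exact: bmf_cst.
  by rewrite Rintegral_cst// mul0r.
have [h1 h2] := Rintegrable_lin (v 0 i) 1 (coord_integrable i) IH1.
have E (x : V) : \sum_(j <- i :: r) v 0 j * x 0 j = v 0 i * x 0 i + 1 * \sum_(j <- r) v 0 j * x 0 j.
  by rewrite big_cons mul1r.
by rewrite (funext E) big_cons -IH2 h2 mul1r.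
Qed.

End Mean.

Lemma line_coef_mean (mu : probability V R) (rho : R) (nu : probability (V * V)%type R) v :
  light_tailed rho mu -> (forall A : set V, measurable A -> nu (fst @^-1` A) = mu A) ->
  line_coef nu 0 0 (cv v) 0 1%N = (dotv v (mean_vec mu))%:C%C.
Proof.
move=> tail law1; rewrite line_coef.unlock /laplace_coef.
have -> : (fun x => invfact R 1 * (pairing (cv v) 0 x ^+ 1 * expC (pairing 0 0 x))) =
    (fun x => (dotv v x.1)%:C%C).
  apply/funext => x; rewrite pairing_real /invfact /pairing !dotv0l addr0 expC0 mulr1 expr1.
  by rewrite invr1 mul1r.
rewrite -(Rintegral_dotv tail) -(Rintegral_law measurable_fst law1 (measurable_dotv v)).
by apply: complex_ext => //=; rewrite Rintegral_cst// mul0r.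
Qed.

End LightTails.

(** * Identification up to translation *)

Section Uniqueness.
Context (R : realType) (d : nat).
Local Notation V := 'rV[R]_d.
Local Notation cv := (@complex_vec R d).
Local Notation ii := ('i%C : R[i]).
Implicit Types pi : probability (V * V)%type R.

Lemma pairing_imaginary t1 t2 (x : V * V) : pairing (ii *: cv t1) (ii *: cv t2) x =
  ii * (dotv t1 x.1 + dotv t2 x.2)%:C%C.
Proof. by rewrite /pairing !dotvZl !dotv_complex_vec -mulrDr -rmorphD. Qed.

Lemma expCi (x : R) : expC (ii * x%:C%C) = (cos x +i* sin x)%C.
Proof. by apply: complex_ext; rewrite /= !mul0r !mul1r !add0r oppr0 expR0 !mul1r. Qed.

Lemma lap_unique pi pi' :
  (forall t1 t2, lap pi (ii *: cv t1) (ii *: cv t2) = lap pi' (ii *: cv t1) (ii *: cv t2)) ->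
  forall A, measurable A -> pi A = pi' A.
Proof.
move=> h; apply: fourier_uniqueness_pair => t1 t2 c.
pose th (x : V * V) := dotv t1 x.1 + dotv t2 x.2.
have mth : measurable_fun setT th by exact: measurable_dotv2.
have E pi0 : lap pi0 (ii *: cv t1) (ii *: cv t2) =
    (\int[pi0]_x cos (th x) +i* \int[pi0]_x sin (th x))%C.
  rewrite lapE; have -> // : (fun x => expC (pairing (ii *: cv t1) (ii *: cv t2) x)) =
      (fun x => (cos (th x) +i* sin (th x))%C).
  by apply/funext => x; rewrite pairing_imaginary expCi.
have icos pi0 : pi0.-integrable setT (EFin \o (fun x => cos (th x))).
  by apply: bmf_integrable; exact: bmf_cos.
have isin pi0 : pi0.-integrable setT (EFin \o (fun x => sin (th x))).
  apply: bmf_integrable; split; first exact: (measurableT_comp (continuous_measurable_fun (@continuous_sin R))).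

  by exists 1 => x; rewrite ler_norml sin_geN1 sin_le1.
have F pi0 : \int[pi0]_x cos (th x + c) =
    cos c * \int[pi0]_x cos (th x) + (- sin c) * \int[pi0]_x sin (th x).
  have [_ <-] := Rintegrable_lin (cos c) (- sin c) (icos pi0) (isin pi0).
  by apply: eq_Rintegral => x _; rewrite cosD; ring.
rewrite !F; have := h t1 t2; rewrite !E => -[-> ->].
by [].
Qed.

End Uniqueness.

Section Translation.
Context (R : realType) (d : nat).
Local Notation V := 'rV[R]_d.
Local Notation cv := (@complex_vec R d).
Local Notation ii := ('i%C : R[i]).

Lemma dotvNr (u v : V) : dotv u (- v) = - dotv u v.
Proof. by rewrite -sumrN; apply: eq_bigr => i _; rewrite mxE mulrN. Qed.

Lemma lap_translate (pi pi' : probability (V * V)%type R) (m : V) :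
  (forall t1 t2, lap pi' (ii *: cv t1) (ii *: cv t2) =
     lap pi (ii *: cv t1) (ii *: cv t2) * expC (ii * (dotv t1 m + dotv t2 m)%:C%C)) ->
  forall E, measurable E -> pushforward pi (fun x => (x.1 + m, x.2 + m)) E = pi' E.
Proof.
move=> h; pose phi (x : V * V) : V * V := (x.1 + m, x.2 + m).
have mphi : measurable_fun setT phi.
  by apply: measurable_fun_pair; apply: measurable_rVD.
pose F : {mfun (V * V)%type >-> (V * V)%type} := HB.pack phi (isMeasurableFun.Build _ _ _ _ phi mphi).
apply: (@lap_unique R d (distribution pi F) pi') => t1 t2.
pose g (x : V * V) := expC (pairing (ii *: cv t1) (ii *: cv t2) x).
have mg : cmeasurable g by apply: cmeasurable_expC; exact: cmeasurable_pairing.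
rewrite h !lapE -(@integralC_law _ _ _ _ _ pi (distribution pi F) phi mphi _ g mg); last by [].
have ig : cintegrable pi g.
  apply: (@cintegrable_bounded _ _ _ _ _ 1) => // x.
  by rewrite /g pairing_imaginary normc_expCi.
rewrite [RHS]mulrC -(integralCZ _ ig); congr integralC; apply/funext => x.
rewrite /g !pairing_imaginary -expCD; congr expC.
by rewrite !dotvDr !rmorphD/=; ring.
Qed.

Lemma lap_prob_prod (P : probability V R) t1 t2 :
  lap (prob_prod P P) (ii *: cv t1) (ii *: cv t2) = charf P t1 * charf P t2.
Proof.
have n1 t (x : V) : normc (expC (ii * (dotv t x)%:C%C)) <= 1 by rewrite normc_expCi.
rewrite lapE -(integralC_prod P P (cmeasurable_char t1) (cmeasurable_char t2) (n1 t1) (n1 t2)).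
congr integralC; apply/funext => x.
by rewrite pairing_imaginary -expCD -mulrDr -rmorphD.
Qed.

End Translation.

Theorem theorem1 (R : realType) (d : nat)
    (K K' : R.-pker 'rV[R]_d ~> 'rV[R]_d)
    (muK muK' P P' : probability 'rV[R]_d R)
    (hmuK : unique_stationary K muK)
    (hmuK' : unique_stationary K' muK')
    (hrho : exists rho : R,
      [/\ 0 < rho, rho < 2, light_tailed rho muK & light_tailed rho muK'])
    (hPhi : nonnull_sections (pair_law muK K))
    (hPhi' : nonnull_sections (pair_law muK' K'))
    (Q Q' : probability (seq_space R d) R)
    (hQ : is_observation_law K muK P Q)
    (hQ' : is_observation_law K' muK' P' Q')
    (hQQ' : forall A : set (seq_space R d), measurable A -> Q A = Q' A) :
  equal_up_to_translation (pair_law muK K) (pair_law muK' K') P P'.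
Proof.
case: hrho => rho [_ rho2 tail tail'].
have law1 := @pair_law_fst R d K muK; have law1' := @pair_law_fst R d K' muK'.
have law2 A : measurable A -> _ := @pair_law_snd R d K muK A hmuK.1.
have law2' A : measurable A -> _ := @pair_law_snd R d K' muK' A hmuK'.1.
have enu := expmom_of_marginals tail law1 law2.
have enu' := expmom_of_marginals tail' law1' law2'.
have same_char t1 t2 :
    lap (pair_law muK K) ('i%C *: complex_vec t1) ('i%C *: complex_vec t2) *
      (charf P t1 * charf P t2) =
    lap (pair_law muK' K') ('i%C *: complex_vec t1) ('i%C *: complex_vec t2) *
      (charf P' t1 * charf P' t2).
  (* Both sides are the characteristic function of the first two observations, under Q and under
     Q'. *)
  rewrite -(observation_char t1 t2 hQ) -(observation_char t1 t2 hQ').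
  by apply: complex_ext => /=; congr fine; apply: eq_measure_integral => A mA _; exact: hQQ'.
have growth v : exists c kappa : R, [/\ 0 <= c, 2 <= kappa, kappa < 4 & forall k,
    bnd (line_coef (pair_law muK K) 0 0 (complex_vec v) 0) (6 * 2 ^+ k) (expR (c * kappa ^+ k)) /\
    bnd (line_coef (pair_law muK' K') 0 0 (complex_vec v) 0) (6 * 2 ^+ k) (expR (c * kappa ^+ k))].
  have [A [B [A0 B0 bA]]] := marginal_bnd tail law1 enu.
  have [A' [B' [A0' B0' bA']]] := marginal_bnd tail' law1' enu'.
  have nv : 0 <= euclidean_norm v by exact: sqrtr_ge0.
  have [c c0 hc] := geometric_growth A0 B0 nv rho2.
  have [c' c0' hc'] := geometric_growth A0' B0' nv rho2.
  exists (c + c'), (Num.max 2 (2 `^ rho)); split; first exact: addr_ge0.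
  - by rewrite le_max lexx.
  - by rewrite gt_max two_powR_lt4// andbT; lra.
  - move=> k; have k0 : 0 <= Num.max 2 (2 `^ rho) ^+ k.
      by rewrite exprn_ge0// le_max powR_ge0 orbT.
    have S0 : 0 <= 6 * 2 ^+ k :> R by rewrite mulr_ge0 ?exprn_ge0.
    split => N.
    + rewrite (le_trans (bA v _ S0 N))// (le_trans (hc k))// ler_expR ler_wpM2r//.
      by rewrite lerDl.
    + rewrite (le_trans (bA' v _ S0 N))// (le_trans (hc' k))// ler_expR ler_wpM2r//.
      by rewrite lerDr.
(* The states must move by the difference of their means, so no other translation is possible. *)
pose m := mean_vec muK - mean_vec muK'.
have hm v : line_coef (pair_law muK K) 0 0 (complex_vec v) 0 1%N -
    line_coef (pair_law muK' K') 0 0 (complex_vec v) 0 1%N = (dotv m v)%:C%C.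
  rewrite (line_coef_mean v tail law1) (line_coef_mean v tail' law1').
  by rewrite -rmorphB (dotvC m) /m dotvDr dotvNr.
have hP := noise_translate enu enu' same_char hPhi hPhi' growth hm.
have hR := pair_translate enu enu' same_char hPhi hPhi' growth hm.
exists m => E mE; split.
(* The states are shifted by -m and the noises by +m, which leaves their sum unchanged. *)
- apply: (lap_translate (m := - m)) mE => t1 t2.
  rewrite hR -mulrA -expCD -[LHS]mulr1 -expC0; congr (_ * expC _).
  by rewrite !dotvNr !(dotvC _ m) -opprD rmorphN/= mulrN subrr.
- apply: (@lap_translate R d (prob_prod P P) (prob_prod P' P') m) mE => t1 t2.
  rewrite !lap_prob_prod !hP !(dotvC _ m) rmorphD mulrDr expCD; ring.
Qed.
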